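(* Let $\Lambda$ be a finite dimensional associative algebra over a field $k$ with a distinguished idempotent $e$ such that $\Lambda e\Lambda$ is a strongly stratifying ideal, and let $f=1-e$. If $HH_*(\Lambda)$ is finite, then $HH_*(e\Lambda e)$ and $HH_*(f\Lambda f)$ are finite.
   Context: Throughout, ''algebra'' means a finite dimensional associative unital algebra over a fixed field $k$. For an algebra $\Lambda$, $HH_*(\Lambda)=\mathrm{Tor}_*^{\Lambda\otimes_k\Lambda^{\mathrm{op}}}(\Lambda,\Lambda)$ is its Hochschild homology; it is called finite if there is $N$ with $HH_m(\Lambda)=0$ for all $m>N$. Let $e\in\Lambda$ be an idempotent and $f=1-e$. The ideal $\Lambda e\Lambda$ is strongly stratifying if: (1) $\mathrm{Tor}_n^{e\Lambda e}(\Lambda e,e\Lambda)=0$ for $n>0$; (2) $f\Lambda e\otimes_{e\Lambda e}e\Lambda f=0$; (3) $\mathrm{Tor}_n^{f\Lambda f}(\Lambda f,f\Lambda)=0$ for $n>0$. The algebras $e\Lambda e$ and $f\Lambda f$ have units $e$ and $f$ respectively. *)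

(* Defs.v *)
From HB Require Import structures.
From mathcomp Require Import ssreflect ssrfun ssrbool eqtype ssrnat seq choice.
From mathcomp Require Import fintype tuple bigop generic_quotient.
From mathcomp Require Import ssralg ssrint ring_quotient vector falgebra.
From mathcomp Require Import freeg boolp.

Set Implicit Arguments.
Unset Strict Implicit.
Unset Printing Implicit Defensive.

Import GRing.Theory.
Local Open Scope ring_scope.
Local Open Scope quotient_scope.

(* A unital algebra over a field k: a ring with a morphism from k to its      *)
(* center. MathComp's algType and falgType impose 1 != 0 and hence miss the   *)
(* corner algebra eAe when e = 0; they are instances through kalg below.      *)
HB.mixin Record PzRing_isKAlgebra (k : fieldType) A of GRing.PzRing A := {
  kmap : {rmorphism k -> A};
  kmapC : forall (c : k) (x : A), kmap c * x = x * kmap c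
}.

#[short(type="kAlgType")]
HB.structure Definition KAlgebra (k : fieldType) :=
  {A of GRing.PzRing A & PzRing_isKAlgebra k A}.

Arguments kmap {k} s.

Definition finite_dimensional (k : fieldType) (A : kAlgType k) :=
  exists (n : nat) (b : 'I_n -> A),
    forall x : A, exists c : 'I_n -> k, x = \sum_(i < n) kmap A (c i) * b i.

Definition kalg (A : Type) : Type := A.

Section AlgTypeIsKAlgebra.
Variables (k : fieldType) (A : algType k).

HB.instance Definition _ := GRing.PzRing.on (kalg A).

Lemma in_algC (c : k) (x : kalg A) :
  (in_alg A : {rmorphism k -> kalg A}) c * x =
  x * (in_alg A : {rmorphism k -> kalg A}) c.
Proof. by rewrite /= mulr_algl mulr_algr. Qed.

HB.instance Definition _ := PzRing_isKAlgebra.Build k (kalg A) in_algC.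
End AlgTypeIsKAlgebra.

Lemma falg_finite_dimensional (k : fieldType) (A : falgType k) :
  finite_dimensional (kalg A : kAlgType k).
Proof.
exists (\dim {:A}), (fun i => (vbasis {:A})`_i) => x.
exists (fun i => coord (vbasis {:A}) i x).
rewrite {1}(coord_vbasis (memvf x)).
by apply: eq_bigr => i _; rewrite /kmap /= mulr_algl.
Qed.

Section Converse.
Variables (k : fieldType) (A : kAlgType k).

Definition kmap_op (c : k) : A^c := kmap A c.

Fact kmap_op_zmod : zmod_morphism kmap_op.
Proof. by move=> c d; rewrite /kmap_op rmorphB. Qed.
Fact kmap_op_monoid : monoid_morphism kmap_op.
Proof.
by split=> [|c d]; rewrite /kmap_op ?rmorph1 // mulrC rmorphM.
Qed.
HB.instance Definition _ := GRing.isZmodMorphism.Build k A^c kmap_op kmap_op_zmod.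
HB.instance Definition _ :=
  GRing.isMonoidMorphism.Build k A^c kmap_op kmap_op_monoid.

Fact kmap_opC (c : k) (x : A^c) :
  (kmap_op : {rmorphism k -> A^c}) c * x =
  x * (kmap_op : {rmorphism k -> A^c}) c.
Proof. exact: esym (kmapC c (x : A)). Qed.
HB.instance Definition _ := PzRing_isKAlgebra.Build k A^c kmap_opC.
End Converse.

Fact zmod_morphD (U V : zmodType) (f : U -> V) :
  zmod_morphism f -> {morph f : x y / x + y}.
Proof.
move=> fB x y; have f0 : f 0 = 0 by rewrite -(subrr 0) fB subrr.
by rewrite -{1}(opprK y) -(sub0r y) !fB f0 sub0r opprK.
Qed.

(* Tensor product of abelian groups M and N balanced over S, where S acts on  *)
(* the right of M by ract and on the left of N by lact: the quotient of the   *)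
(* free abelian group on M * N by the subgroup generated by the               *)
(* biadditivity and balancing relations.                                      *)
Section Tensor.
Variables (S : Type) (M N : zmodType) (ract : S -> M -> M) (lact : S -> N -> N).

Local Notation F := {freeg (M * N)%type / int}.

Inductive tensor_rel : F -> Prop :=
| TensorRel0 : tensor_rel 0
| TensorRelB x y of tensor_rel x & tensor_rel y : tensor_rel (x - y)
| TensorRelDl m m' n : tensor_rel (<< (m + m', n) >> - (<< (m, n) >> + << (m', n) >>))
| TensorRelDr m n n' : tensor_rel (<< (m, n + n') >> - (<< (m, n) >> + << (m, n') >>))
| TensorRelS s m n : tensor_rel (<< (ract s m, n) >> - << (m, lact s n) >>).

Definition tensor_sub : {pred F} := fun x => `[< tensor_rel x >].

Fact tensor_sub_closed : zmod_closed tensor_sub.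
Proof.
split=> [|x y /asboolP rx /asboolP ry]; apply/asboolP.
  exact: TensorRel0.
exact: TensorRelB.
Qed.
HB.instance Definition _ := GRing.isZmodClosed.Build F tensor_sub tensor_sub_closed.

(* Wrapped in a record so that unification does not unfold the quotient. *)
Record tensor : Type := Tensor { tensor_quot : Quotient.quot tensor_sub }.

HB.instance Definition _ := [isNew for tensor_quot].
HB.instance Definition _ := [Choice of tensor by <:].

Definition tensor_zero := Tensor 0.
Definition tensor_opp x := Tensor (- tensor_quot x).
Definition tensor_add x y := Tensor (tensor_quot x + tensor_quot y).

Fact tensor_addA : associative tensor_add.
Proof. by move=> x y z; apply: val_inj; rewrite /= addrA. Qed.
Fact tensor_addC : commutative tensor_add.
Proof. by move=> x y; apply: val_inj; rewrite /= addrC. Qed.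
Fact tensor_add0 : left_id tensor_zero tensor_add.
Proof. by move=> x; apply: val_inj; rewrite /= add0r. Qed.
Fact tensor_addN : left_inverse tensor_zero tensor_opp tensor_add.
Proof. by move=> x; apply: val_inj; rewrite /= addNr. Qed.
HB.instance Definition _ := GRing.isZmodule.Build tensor
  tensor_addA tensor_addC tensor_add0 tensor_addN.

Definition tensor_pi (x : F) : tensor := Tensor (\pi x).
Definition tensor_repr (x : tensor) : F := repr (tensor_quot x).
Definition pure (m : M) (n : N) : tensor := tensor_pi << (m, n) >>.

Fact tensor_reprK : cancel tensor_repr tensor_pi.
Proof. by move=> x; apply: val_inj; rewrite /= reprK. Qed.

Fact tensor_pi_eq x y : tensor_rel (x - y) <-> tensor_pi x = tensor_pi y.
Proof.
split=> [r|[/eqP]]; last by rewrite -Quotient.idealrBE => /asboolP.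
by apply: val_inj; apply/eqP; rewrite -Quotient.idealrBE; apply/asboolP.
Qed.

Fact tensor_piB : {morph tensor_pi : x y / x - y}.
Proof. by move=> x y; apply: val_inj; rewrite /= raddfB. Qed.

HB.instance Definition _ := GRing.isZmodMorphism.Build F tensor tensor_pi tensor_piB.

Lemma pureDl m m' n : pure (m + m') n = pure m n + pure m' n.
Proof. by rewrite -raddfD; apply/tensor_pi_eq/TensorRelDl. Qed.

Lemma pureDr m n n' : pure m (n + n') = pure m n + pure m n'.
Proof. by rewrite -raddfD; apply/tensor_pi_eq/TensorRelDr. Qed.

Lemma pureBl n : zmod_morphism (pure^~ n).
Proof. by move=> m m'; apply/eqP; rewrite eq_sym subr_eq -pureDl subrK. Qed.

Lemma pureBr m : zmod_morphism (pure m).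
Proof. by move=> n n'; apply/eqP; rewrite eq_sym subr_eq -pureDr subrK. Qed.

Lemma pureS s m n : pure (ract s m) n = pure m (lact s n).
Proof. exact/tensor_pi_eq/TensorRelS. Qed.

Lemma tensor_ind (P : tensor -> Prop) :
  (forall m n, P (pure m n)) -> (forall x y, P x -> P y -> P (x - y)) ->
  forall x, P x.
Proof.
move=> Pp PB x; rewrite -[x]tensor_reprK; move: (tensor_repr x) => {x}.
have P0 : P 0 by rewrite -(subrr (pure 0 0)); apply: PB.
have PN x : P x -> P (- x) by rewrite -sub0r; apply: PB.
have PD x y : P x -> P y -> P (x + y).
  by move=> Px Py; rewrite -[y]opprK; apply: PB => //; apply: PN.
elim/freeg_ind_dom0 => [|c [m n] D _ _ IH]; first by rewrite raddf0.
rewrite raddfD; apply: (PD) => //; rewrite -[c]intz -freegU_mulz raddfMz.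
rewrite -/(pure m n); have Pn i : P (pure m n *+ i).
  by elim: i => [|i IHi]; rewrite ?mulr0n // mulrS; apply: PD.
by case: c => i; rewrite ?NegzE ?mulrNz -pmulrn //; apply: PN.
Qed.

Section Lift.
Variables (Z : zmodType) (b : M -> N -> Z).
Hypothesis bBl : forall n, zmod_morphism (b^~ n).
Hypothesis bBr : forall m, zmod_morphism (b m).
Hypothesis bS : forall s m n, b (ract s m) n = b m (lact s n).

Definition free_lift : F -> Z := fglift (fun p => b p.1 p.2 : zmodule Z).

Definition tensor_lift (x : tensor) : Z := free_lift (tensor_repr x).

Fact free_liftB : zmod_morphism free_lift.
Proof. exact: (@lift_is_additive _ _ (zmodule Z) (fun p => b p.1 p.2)). Qed.

Fact free_lift_rel x : tensor_rel x -> free_lift x = 0.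
Proof.
have fU m n : free_lift << (m, n) >> = b m n by rewrite /free_lift liftU scale1r.
elim=> [|u v _ fu0 _ fv0|m m' n|m n n'|s m n].
- by have := free_liftB 0 0; rewrite !subrr.
- by rewrite free_liftB fu0 fv0 subrr.
- by rewrite free_liftB (zmod_morphD free_liftB) !fU (zmod_morphD (bBl n)) subrr.
- by rewrite free_liftB (zmod_morphD free_liftB) !fU (zmod_morphD (bBr m)) subrr.
- by rewrite free_liftB !fU bS subrr.
Qed.

Fact tensor_lift_pi x : tensor_lift (tensor_pi x) = free_lift x.
Proof.
apply/eqP; rewrite -subr_eq0 /tensor_lift -free_liftB.
by rewrite free_lift_rel //; apply/tensor_pi_eq; rewrite tensor_reprK.
Qed.

Lemma tensor_lift_pure m n : tensor_lift (pure m n) = b m n.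
Proof. by rewrite tensor_lift_pi /free_lift liftU scale1r. Qed.

Lemma tensor_liftB : zmod_morphism tensor_lift.
Proof.
move=> x y; rewrite -[x]tensor_reprK -[y]tensor_reprK -tensor_piB !tensor_lift_pi.
exact: free_liftB.
Qed.

End Lift.
End Tensor.

Arguments tensor_lift {S M N ract lact Z} b x.
Arguments tensor_lift_pure {S M N ract lact Z b}.
Arguments tensor_liftB {S M N ract lact Z b}.

(* Right R-modules are left R^c-modules: (r : R^c) *: m stands for m r. *)
Section TensorMod.
Variables (R : pzRingType) (M : lmodType R^c) (N : lmodType R).

Definition tensor_mod : Type :=
  @tensor R M N (fun r (m : M) => (r : R^c) *: m) (fun r (n : N) => r *: n).
HB.instance Definition _ := GRing.Zmodule.on tensor_mod.

Definition tens (m : M) (n : N) : tensor_mod := pure _ _ m n.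

Lemma tensBl n : zmod_morphism (tens^~ n). Proof. exact: pureBl. Qed.

Lemma tensBr m : zmod_morphism (tens m). Proof. exact: pureBr. Qed.

Lemma tensZ (r : R) m n : tens ((r : R^c) *: m) n = tens m (r *: n).
Proof. exact: (@pureS R M N (fun r m => (r : R^c) *: m) (fun r n => r *: n)). Qed.

End TensorMod.

Section TensorMap.
Variables (R : pzRingType) (M M' : lmodType R^c) (N : lmodType R).
Variable f : {linear M -> M'}.

(* f (x) id_N *)
Definition tensor_map : tensor_mod M N -> tensor_mod M' N :=
  tensor_lift (fun m n => tens (f m) n).

Fact tensor_map_Bl (n : N) : zmod_morphism (fun m => tens (f m) n).
Proof. by move=> m m'; rewrite raddfB tensBl. Qed.

Fact tensor_map_S (r : R) (m : M) (n : N) :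
  tens (f ((r : R^c) *: m)) n = tens (f m) (r *: n).
Proof. by rewrite linearZ tensZ. Qed.

Lemma tensor_mapE m n : tensor_map (tens m n) = tens (f m) n.
Proof.
by rewrite /tensor_map tensor_lift_pure => // [?|?|*];
  [exact: tensor_map_Bl|exact: tensBr|exact: tensor_map_S].
Qed.

Fact tensor_mapB : zmod_morphism tensor_map.
Proof.
by apply: tensor_liftB => [?|?|*];
  [exact: tensor_map_Bl|exact: tensBr|exact: tensor_map_S].
Qed.
HB.instance Definition _ :=
  GRing.isZmodMorphism.Build (tensor_mod M N) (tensor_mod M' N) tensor_map tensor_mapB.

End TensorMap.
Arguments tensor_map {R M M'} N f.

Definition projective (R : pzRingType) (P : lmodType R) :=
  forall (X Y : lmodType R) (g : {linear X -> Y}) (f : {linear P -> Y}),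
    (forall y, exists x, g x = y) ->
    exists h : {linear P -> X}, forall p, g (h p) = f p.

Record proj_resolution (R : pzRingType) (M : lmodType R) := ProjResolution {
  res_mod :> nat -> lmodType R;
  res_diff : forall n, {linear res_mod n.+1 -> res_mod n};
  res_aug : {linear res_mod 0 -> M};
  res_proj : forall n, projective (res_mod n);
  res_aug_surj : forall m, exists x, res_aug x = m;
  res_exact0 : forall x, res_aug x = 0 <-> exists y, res_diff 0 y = x;
  res_exactS : forall n x, res_diff n x = 0 <-> exists y, res_diff n.+1 y = x
}.

(* H_n(P (x)_R N) = 0, the complex ending in P_0 (x)_R N -> 0. *)
Definition homology_vanishes (R : pzRingType) (M : lmodType R^c) (N : lmodType R)
    (P : proj_resolution M) (n : nat) :=
  match n with
  | 0 => forall x : tensor_mod (P 0%N) N,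
      exists y, tensor_map N (res_diff P 0) y = x
  | m.+1 => forall x : tensor_mod (P m.+1) N,
      tensor_map N (res_diff P m) x = 0 ->
      exists y, tensor_map N (res_diff P m.+1) y = x
  end.

(* Tor_n^R(M, N) = 0, for a right module M and a left module N; the group does  *)
(* not depend on the projective resolution of M that computes it.              *)
Definition Tor_vanishes (R : pzRingType) (n : nat) (M : lmodType R^c) (N : lmodType R) :=
  forall P : proj_resolution M, homology_vanishes N P n.

(* Tensor product of k-algebras, with (a (x) b)(a' (x) b') = aa' (x) bb'. *)
Section TensorAlgebra.
Variables (k : fieldType) (A B : kAlgType k).

Definition tensor_alg : Type :=
  @tensor k A B (fun c a => kmap A c * a) (fun c b => kmap B c * b).
HB.instance Definition _ := GRing.Zmodule.on tensor_alg.

Definition atens (a : A) (b : B) : tensor_alg := pure _ _ a b.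

Lemma atensBl b : zmod_morphism (atens^~ b). Proof. exact: pureBl. Qed.

Lemma atensBr a : zmod_morphism (atens a). Proof. exact: pureBr. Qed.

Lemma atensZ c a b : atens (kmap A c * a) b = atens a (kmap B c * b).
Proof.
exact: (@pureS k A B (fun c a => kmap A c * a) (fun c b => kmap B c * b)).
Qed.

Lemma atens_ind (P : tensor_alg -> Prop) :
  (forall a b, P (atens a b)) -> (forall x y, P x -> P y -> P (x - y)) ->
  forall x, P x.
Proof. exact: tensor_ind. Qed.

Definition atens_mull (a : A) (b : B) : tensor_alg -> tensor_alg :=
  tensor_lift (fun a' b' => atens (a * a') (b * b')).

Fact atens_mull_Bl a b b' : zmod_morphism (fun a' => atens (a * a') (b * b')).
Proof. by move=> x y; rewrite mulrBr atensBl. Qed.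
Fact atens_mull_Br a b a' : zmod_morphism (fun b' => atens (a * a') (b * b')).
Proof. by move=> x y; rewrite mulrBr atensBr. Qed.
Fact atens_mull_S a b c a' b' :
  atens (a * (kmap A c * a')) (b * b') = atens (a * a') (b * (kmap B c * b')).
Proof. by rewrite !mulrA -!kmapC -!mulrA atensZ. Qed.

Fact atens_mull_pure a b a' b' :
  atens_mull a b (atens a' b') = atens (a * a') (b * b').
Proof.
by rewrite /atens_mull tensor_lift_pure => // [?|?|*];
  [exact: atens_mull_Bl|exact: atens_mull_Br|exact: atens_mull_S].
Qed.

Fact atens_mullB a b : zmod_morphism (atens_mull a b).
Proof.
by apply: tensor_liftB => [?|?|*];
  [exact: atens_mull_Bl|exact: atens_mull_Br|exact: atens_mull_S].
Qed.

Definition atens_mul (x y : tensor_alg) : tensor_alg :=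
  tensor_lift (fun a b => atens_mull a b y) x.

Fact atens_mul_Bl y b : zmod_morphism (fun a => atens_mull a b y).
Proof.
move=> a a'; elim/atens_ind: y => [c d|u v IHu IHv].
  by rewrite !atens_mull_pure mulrBl atensBl.
by rewrite !atens_mullB IHu IHv !opprB addrACA [in RHS]addrACA [- _ + _]addrC.
Qed.
Fact atens_mul_Br y a : zmod_morphism (fun b => atens_mull a b y).
Proof.
move=> b b'; elim/atens_ind: y => [c d|u v IHu IHv].
  by rewrite !atens_mull_pure mulrBl atensBr.
by rewrite !atens_mullB IHu IHv !opprB addrACA [in RHS]addrACA [- _ + _]addrC.
Qed.
Fact atens_mul_S y c a b : atens_mull (kmap A c * a) b y = atens_mull a (kmap B c * b) y.
Proof.
elim/atens_ind: y => [a' b'|u v IHu IHv]; last by rewrite !atens_mullB IHu IHv.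
by rewrite !atens_mull_pure -!mulrA atensZ.
Qed.

Fact atens_mulBl y : zmod_morphism (atens_mul^~ y).
Proof.
by apply: tensor_liftB => [?|?|*];
  [exact: atens_mul_Bl|exact: atens_mul_Br|exact: atens_mul_S].
Qed.

Fact atens_mul_purel a b y : atens_mul (atens a b) y = atens_mull a b y.
Proof.
by rewrite /atens_mul tensor_lift_pure => // [?|?|*];
  [exact: atens_mul_Bl|exact: atens_mul_Br|exact: atens_mul_S].
Qed.

Lemma atens_mulE a b a' b' :
  atens_mul (atens a b) (atens a' b') = atens (a * a') (b * b').
Proof. by rewrite atens_mul_purel atens_mull_pure. Qed.

Fact atens_mulBr x : zmod_morphism (atens_mul x).
Proof.
move=> y z; elim/atens_ind: x => [a b|u v IHu IHv].
  by rewrite !atens_mul_purel atens_mullB.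
by rewrite !atens_mulBl IHu IHv !opprB addrACA [in RHS]addrACA [- _ + _]addrC.
Qed.

Fact atens_mulA : associative atens_mul.
Proof.
move=> x y z; elim/atens_ind: x => [a b|u v IHu IHv]; last first.
  by rewrite !atens_mulBl IHu IHv.
elim/atens_ind: y => [a' b'|u v IHu IHv]; last first.
  by rewrite !(atens_mulBl, atens_mulBr) IHu IHv.
elim/atens_ind: z => [a'' b''|u v IHu IHv]; last first.
  by rewrite !atens_mulBr IHu IHv.
by rewrite !atens_mulE !mulrA.
Qed.

Fact atens_mul1l : left_id (atens 1 1) atens_mul.
Proof.
move=> x; elim/atens_ind: x => [a b|u v IHu IHv].
  by rewrite atens_mulE !mul1r.
by rewrite atens_mulBr IHu IHv.
Qed.

Fact atens_mul1r : right_id (atens 1 1) atens_mul.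
Proof.
move=> x; elim/atens_ind: x => [a b|u v IHu IHv].
  by rewrite atens_mulE !mulr1.
by rewrite atens_mulBl IHu IHv.
Qed.

Fact atens_mulDl : left_distributive atens_mul +%R.
Proof. by move=> x y z; rewrite (zmod_morphD (atens_mulBl z)). Qed.

Fact atens_mulDr : right_distributive atens_mul +%R.
Proof. by move=> x y z; rewrite (zmod_morphD (atens_mulBr x)). Qed.

HB.instance Definition _ := GRing.Zmodule_isPzRing.Build tensor_alg
  atens_mulA atens_mul1l atens_mul1r atens_mulDl atens_mulDr.

End TensorAlgebra.

(* The enveloping algebra A (x)_k A^op. A definition instead of a notation     *)
(* makes unification of scalars in env A very slow.                            *)
Notation env A := (tensor_alg A A^c).

Section Hochschild.
Variables (k : fieldType) (A : kAlgType k).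

Local Notation env := (env A).

Definition etens (a b : A) : env := atens a (b : A^c).

Lemma etens_ind (P : env -> Prop) :
  (forall a b, P (etens a b)) -> (forall x y, P x -> P y -> P (x - y)) ->
  forall x, P x.
Proof. exact: (@atens_ind k A A^c P). Qed.

Lemma etens1 : etens 1 1 = 1. Proof. by []. Qed.

Lemma etensM a b a' b' : etens a b * etens a' b' = etens (a * a') (b' * b).
Proof. exact: (@atens_mulE k A A^c). Qed.

(* a (x) b acts on the left of A by x |-> a x b. *)
Definition env_lact (u : env) (x : A) : A :=
  tensor_lift (fun (a : A) (b : A^c) => a * x * (b : A)) u.

(* a (x) b acts on the right of A by x |-> b x a. *)
Definition env_ract (u : env) (x : A) : A :=
  tensor_lift (fun (a : A) (b : A^c) => (b : A) * x * a) u.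

Fact env_lact_Bl x (b : A^c) : zmod_morphism (fun a : A => a * x * (b : A)).
Proof. by move=> a a'; rewrite !mulrBl. Qed.
Fact env_lact_Br x (a : A) : zmod_morphism (fun b : A^c => a * x * (b : A)).
Proof. by move=> b b'; rewrite -mulrBr. Qed.
Fact env_lact_S x (c : k) (a : A) (b : A^c) :
  kmap A c * a * x * (b : A) = a * x * ((kmap A^c c * b : A^c) : A).
Proof. by rewrite -!mulrA kmapC -!mulrA. Qed.

Fact env_ract_Bl x (b : A^c) : zmod_morphism (fun a : A => (b : A) * x * a).
Proof. by move=> a a'; rewrite -mulrBr. Qed.
Fact env_ract_Br x (a : A) : zmod_morphism (fun b : A^c => (b : A) * x * a).
Proof. by move=> b b'; rewrite -!mulrBl. Qed.
Fact env_ract_S x (c : k) (a : A) (b : A^c) :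
  (b : A) * x * (kmap A c * a) = ((kmap A^c c * b : A^c) : A) * x * a.
Proof. by rewrite mulrA -kmapC !mulrA kmapC. Qed.

Lemma env_lactE a b x : env_lact (etens a b) x = a * x * b.
Proof.
by rewrite /env_lact tensor_lift_pure => // [?|?|*];
  [exact: env_lact_Bl|exact: env_lact_Br|exact: env_lact_S].
Qed.

Lemma env_ractE a b x : env_ract (etens a b) x = b * x * a.
Proof.
by rewrite /env_ract tensor_lift_pure => // [?|?|*];
  [exact: env_ract_Bl|exact: env_ract_Br|exact: env_ract_S].
Qed.

Fact env_lactBl x : zmod_morphism (env_lact^~ x).
Proof.
by apply: tensor_liftB => [?|?|*];
  [exact: env_lact_Bl|exact: env_lact_Br|exact: env_lact_S].
Qed.

Fact env_ractBl x : zmod_morphism (env_ract^~ x).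
Proof.
by apply: tensor_liftB => [?|?|*];
  [exact: env_ract_Bl|exact: env_ract_Br|exact: env_ract_S].
Qed.

Fact env_lactBr u : zmod_morphism (env_lact u).
Proof.
move=> x y; elim/etens_ind: u => [a b|u v IHu IHv].
  by rewrite !env_lactE mulrBr mulrBl.
by rewrite !env_lactBl IHu IHv !opprB addrACA [in RHS]addrACA [- _ + _]addrC.
Qed.

Fact env_ractBr u : zmod_morphism (env_ract u).
Proof.
move=> x y; elim/etens_ind: u => [a b|u v IHu IHv].
  by rewrite !env_ractE mulrBr mulrBl.
by rewrite !env_ractBl IHu IHv !opprB addrACA [in RHS]addrACA [- _ + _]addrC.
Qed.

Fact env_lactM u v x : env_lact u (env_lact v x) = env_lact (u * v) x.
Proof.
elim/etens_ind: u => [a b|u u' IHu IHu']; last by rewrite mulrBl !env_lactBl IHu IHu'.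
elim/etens_ind: v => [a' b'|v v' IHv IHv'].
  by rewrite etensM !env_lactE !mulrA.
by rewrite mulrBr !env_lactBl env_lactBr IHv IHv'.
Qed.

Fact env_ractM u v x : env_ract u (env_ract v x) = env_ract (v * u) x.
Proof.
elim/etens_ind: u => [a b|u u' IHu IHu']; last by rewrite mulrBr !env_ractBl IHu IHu'.
elim/etens_ind: v => [a' b'|v v' IHv IHv'].
  by rewrite etensM !env_ractE !mulrA.
by rewrite mulrBl !env_ractBl env_ractBr IHv IHv'.
Qed.

(* A as a left and as a right module over A (x)_k A^op. *)
Definition env_left : Type := A.
Definition env_right : Type := A.
HB.instance Definition _ := GRing.Zmodule.on env_left.
HB.instance Definition _ := GRing.Zmodule.on env_right.

Fact env_lact1 x : env_lact 1 x = x.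
Proof. by rewrite -etens1 env_lactE mul1r mulr1. Qed.
Fact env_ract1 x : env_ract 1 x = x.
Proof. by rewrite -etens1 env_ractE mul1r mulr1. Qed.

HB.instance Definition _ := GRing.Zmodule_isLmodule.Build env env_left
  env_lactM env_lact1 (fun u => zmod_morphD (env_lactBr u))
  (fun x => zmod_morphD (env_lactBl x)).

HB.instance Definition _ := GRing.Zmodule_isLmodule.Build env^c env_right
  env_ractM env_ract1 (fun u => zmod_morphD (env_ractBr u))
  (fun x => zmod_morphD (env_ractBl x)).

(* HH_m(A) = 0, where HH_m(A) = Tor_m(A, A) over A (x)_k A^op. *)
Definition HH_vanishes (m : nat) :=
  Tor_vanishes (R := env) m env_right env_left.

Definition HH_finite := exists N : nat, forall m, (N < m)%N -> HH_vanishes m.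

End Hochschild.

Record idem_elt (A : pzRingType) := IdemElt {
  ival :> A;
  idemP : ival * ival = ival
}.

Section Idempotents.
Variable A : pzRingType.

Definition idem1 : idem_elt A := IdemElt (mulr1 1).

Fact idemC_subproof (e : idem_elt A) : (1 - ival e) * (1 - ival e) = 1 - ival e.
Proof. by rewrite mulrBl mul1r mulrBr mulr1 idemP subrr subr0. Qed.
Definition idemC (e : idem_elt A) : idem_elt A := IdemElt (idemC_subproof e).
End Idempotents.
Arguments idem1 {A}.

(* fAe, as the set of x such that x = f x e. *)
Section Peirce.
Variables (A : pzRingType) (f e : idem_elt A).

Definition peirce_pred : {pred A} := fun x => ival f * x * ival e == x.

Record peirce := Peirce { peirce_val :> A; _ : peirce_val \in peirce_pred }.

HB.instance Definition _ := [isSub for peirce_val].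
HB.instance Definition _ := [Choice of peirce by <:].

Fact peirce_zmod_closed : zmod_closed peirce_pred.
Proof.
split=> [|x y]; rewrite /peirce_pred !unfold_in; first by rewrite mulr0 mul0r.
by move=> /eqP ex /eqP ey; rewrite mulrBr mulrBl ex ey.
Qed.
HB.instance Definition _ := GRing.isZmodClosed.Build A peirce_pred peirce_zmod_closed.
HB.instance Definition _ := [SubChoice_isSubZmodule of peirce by <:].

Fact peirceP (x : peirce) : ival f * val x * ival e = val x.
Proof. exact/eqP/(valP x). Qed.
Fact peirce_mull (x : peirce) : ival f * val x = val x.
Proof. by rewrite -{1}(peirceP x) !mulrA idemP peirceP. Qed.
Fact peirce_mulr (x : peirce) : val x * ival e = val x.
Proof. by rewrite -{1}(peirceP x) -mulrA idemP peirceP. Qed.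

Fact peirce_subproof (x : A) : ival f * x = x -> x * ival e = x -> x \in peirce_pred.
Proof. by move=> fx xe; rewrite unfold_in fx xe. Qed.
Definition mk_peirce (x : A) (fx : ival f * x = x) (xe : x * ival e = x) : peirce :=
  Peirce (peirce_subproof fx xe).
End Peirce.

Section PeirceMul.
Variables (A : pzRingType) (g f e : idem_elt A).

Fact peirce_mul_l (x : peirce g f) (y : peirce f e) : ival g * (val x * val y) = val x * val y.
Proof. by rewrite mulrA peirce_mull. Qed.
Fact peirce_mul_r (x : peirce g f) (y : peirce f e) : val x * val y * ival e = val x * val y.
Proof. by rewrite -mulrA peirce_mulr. Qed.

(* gAf x fAe -> gAe *)
Definition peirce_mul (x : peirce g f) (y : peirce f e) : peirce g e :=
  mk_peirce (peirce_mul_l x y) (peirce_mul_r x y).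
End PeirceMul.

Section PeirceUnit.
Variables (A : pzRingType) (e : idem_elt A).

Definition peirce_one : peirce e e := mk_peirce (idemP e) (idemP e).

Definition corner : Type := peirce e e.
HB.instance Definition _ := GRing.Zmodule.on corner.

Fact corner_mulA : associative (@peirce_mul A e e e).
Proof. by move=> x y z; apply/val_inj; rewrite /= mulrA. Qed.
Fact corner_mul1l : left_id peirce_one (@peirce_mul A e e e).
Proof. by move=> x; apply/val_inj; rewrite /= peirce_mull. Qed.
Fact corner_mul1r : right_id peirce_one (@peirce_mul A e e e).
Proof. by move=> x; apply/val_inj; rewrite /= peirce_mulr. Qed.
Fact corner_mulDl : left_distributive (@peirce_mul A e e e) +%R.
Proof. by move=> x y z; apply/val_inj; rewrite /= mulrDl. Qed.
Fact corner_mulDr : right_distributive (@peirce_mul A e e e) +%R.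
Proof. by move=> x y z; apply/val_inj; rewrite /= mulrDr. Qed.

HB.instance Definition _ := GRing.Zmodule_isPzRing.Build corner
  corner_mulA corner_mul1l corner_mul1r corner_mulDl corner_mulDr.
End PeirceUnit.

Section PeirceModules.
Variables (A : pzRingType) (f e : idem_elt A).

(* fAe as a left fAf-module and as a right eAe-module. *)
Definition peirce_left : Type := peirce f e.
Definition peirce_right : Type := peirce f e.
HB.instance Definition _ := GRing.Zmodule.on peirce_left.
HB.instance Definition _ := GRing.Zmodule.on peirce_right.

Definition peirce_scalel (r : corner f) (x : peirce_left) : peirce_left :=
  peirce_mul r x.
Definition peirce_scaler (r : (corner e)^c) (x : peirce_right) : peirce_right :=
  peirce_mul x (r : corner e).

Fact peirce_scalelA r s x :
  peirce_scalel r (peirce_scalel s x) = peirce_scalel (r * s) x.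
Proof. by apply/val_inj; rewrite /= mulrA. Qed.
Fact peirce_scalel1 : left_id 1 peirce_scalel.
Proof. by move=> x; apply/val_inj; rewrite /= peirce_mull. Qed.
Fact peirce_scalelDr : right_distributive peirce_scalel +%R.
Proof. by move=> r x y; apply/val_inj; rewrite /= mulrDr. Qed.
Fact peirce_scalelDl x : {morph peirce_scalel^~ x : r s / r + s}.
Proof. by move=> r s; apply/val_inj; rewrite /= mulrDl. Qed.
HB.instance Definition _ := GRing.Zmodule_isLmodule.Build (corner f) peirce_left
  peirce_scalelA peirce_scalel1 peirce_scalelDr peirce_scalelDl.

Fact peirce_scalerA r s x :
  peirce_scaler r (peirce_scaler s x) = peirce_scaler (r * s) x.
Proof. by apply/val_inj; rewrite /= mulrA. Qed.
Fact peirce_scaler1 : left_id 1 peirce_scaler.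
Proof. by move=> x; apply/val_inj; rewrite /= peirce_mulr. Qed.
Fact peirce_scalerDr : right_distributive peirce_scaler +%R.
Proof. by move=> r x y; apply/val_inj; rewrite /= mulrDl. Qed.
Fact peirce_scalerDl x : {morph peirce_scaler^~ x : r s / r + s}.
Proof. by move=> r s; apply/val_inj; rewrite /= mulrDr. Qed.
HB.instance Definition _ := GRing.Zmodule_isLmodule.Build (corner e)^c peirce_right
  peirce_scalerA peirce_scaler1 peirce_scalerDr peirce_scalerDl.
End PeirceModules.

(* eAe as a k-algebra, with structure map c |-> c e. *)
Section CornerAlgebra.
Variables (k : fieldType) (A : kAlgType k) (e : idem_elt A).

Fact corner_kmap_l c : ival e * (kmap A c * ival e) = kmap A c * ival e.
Proof. by rewrite mulrA -kmapC -mulrA idemP. Qed.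
Fact corner_kmap_r c : kmap A c * ival e * ival e = kmap A c * ival e.
Proof. by rewrite -mulrA idemP. Qed.

Definition corner_kmap (c : k) : corner e :=
  mk_peirce (corner_kmap_l c) (corner_kmap_r c).

Fact corner_kmap_zmod : zmod_morphism corner_kmap.
Proof. by move=> c d; apply/val_inj; rewrite /= rmorphB mulrBl. Qed.
Fact corner_kmap_monoid : monoid_morphism corner_kmap.
Proof.
split=> [|c d]; apply/val_inj; rewrite /= ?rmorph1 ?mul1r // rmorphM.
by rewrite -[in RHS]mulrA [ival e * (_ * _)]mulrA -(kmapC d (ival e)) -[kmap A d * _ * _]mulrA idemP mulrA.
Qed.
HB.instance Definition _ :=
  GRing.isZmodMorphism.Build k (corner e) corner_kmap corner_kmap_zmod.
HB.instance Definition _ :=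
  GRing.isMonoidMorphism.Build k (corner e) corner_kmap corner_kmap_monoid.

Fact corner_kmapC (c : k) (x : corner e) :
  (corner_kmap : {rmorphism k -> corner e}) c * x =
  x * (corner_kmap : {rmorphism k -> corner e}) c.
Proof.
by apply/val_inj; rewrite /= -mulrA peirce_mull kmapC -kmapC mulrA -kmapC -mulrA peirce_mulr.
Qed.
HB.instance Definition _ := PzRing_isKAlgebra.Build k (corner e) corner_kmapC.
End CornerAlgebra.

(* The ideal AeA is strongly stratifying. Ae and eA are the Peirce components *)
(* 1Ae and eA1.                                                               *)
Definition strongly_stratifying (A : pzRingType) (e : idem_elt A) :=
  let f := idemC e in
  [/\ forall n, (0 < n)%N ->
        Tor_vanishes (R := corner e) n (peirce_right idem1 e) (peirce_left e idem1),
      forall t : tensor_mod (R := corner e) (peirce_right f e) (peirce_left e f),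
        t = 0
    & forall n, (0 < n)%N ->
        Tor_vanishes (R := corner f) n (peirce_right idem1 f) (peirce_left f idem1)].

(* Main.v *)
(* Let A = eLe, B = fLf, M = eLf and N = fLe. Condition (2) says that           *)
(* N (x)_A M = 0, so NM = 0, the ideal I = LeL is {x | fxf = 0} and x |-> fxf   *)
(* is an algebra morphism L -> B with kernel I, split by the inclusion of B;    *)
(* hence HH_*(B) is a direct summand of HH_*(L). Conditions (1) and (2) say     *)
(* that the two-sided bar complex Le (x) A^q (x) eL resolves I. Since eB = 0,   *)
(* this makes B(I, L, B) acyclic, so B(B, L, B) is a projective resolution of   *)
(* B over its enveloping algebra and HH_*(L, B) = HH_*(B). The long exact       *)
(* sequence of 0 -> I -> L -> B -> 0 then gives HH_m(L, I) = 0 for large m.     *)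
(* Finally the bicomplex of Hochschild chains of L with coefficients in         *)
(* Le (x) A^q (x) eL has rows resolving the chains with coefficients in I and   *)
(* columns resolving the Hochschild chains of A, so HH_*(A) = HH_*(L, I).       *)

Require Import Defs.
From HB Require Import structures.
From mathcomp Require Import ssreflect ssrfun ssrbool eqtype ssrnat seq choice.
From mathcomp Require Import fintype finfun bigop ssralg ssrint freeg boolp.

Set Implicit Arguments.
Unset Strict Implicit.
Unset Printing Implicit Defensive.

Import GRing.Theory.
Local Open Scope ring_scope.

(** Write A = eLe, B = fLf and I = {x | fxf = 0}. Vanishing passes from HH(L) to HH(B), then to H(L,
    I), then to HH(A), with the same bound throughout. Homology groups are never formed:
    [exact_at d n] says that a complex has no homology in degree n, and such statements are moved by
    retracts ([exact_retract]), by two segments of the long exact sequence ([exact_sub],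
    [exact_quo]) and by bicomplexes whose rows and columns are resolutions ([bicomplex_exact]).

    The definitions of Tor and HH quantify over all projective resolutions. The comparison theorem
    [Tor_vanishes_res] makes one resolution enough, and bar resolutions then give explicit
    complexes: [Tor_vanishes_exact] for Tor, [HH_hoch] for the Hochschild homology of C computed
    over an algebra S mapping onto C.

    The vanishing of fLe (x)_A eLf enters twice. Multiplying out, fLeLf = 0 ([NM_mul0]), hence x |->
    fxf is multiplicative with kernel I, and B is a retract of L ([HH_retract]). Read inside Le (x)
    eL, every fx (x) yf is a boundary ([NM_boundary]); hence the kernel of Le (x) eL -> I consists
    of boundaries ([mu_ker]), and with the Tor condition on A the complex Z_q = Le (x) A^q (x) eL
    resolves I.

    This resolution is good on both sides. On the right, Z_q is a sum of copies of eL and e acts as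
    zero on B, so B(Z_q, L, B) is contractible; therefore B(I, L, B) is acyclic ([IR_exact]), B(B,
    L, B) is exact in positive degrees ([proj_exact]) and HH(B) = H(L, B) ([HH_quotient]). The long
    exact sequence then bounds H(L, I) ([ideal_exact]). On the left, Z_q is a sum of copies of Le,
    so H(L, Z_q) is concentrated in degree 0, where it is A (x) A^q ([Zcol_exact], [wrapA_ker]); a
    second bicomplex turns H(L, I) into HH(A) ([corner_exact]). *)

(** * Bilinear maps and tensor products in coordinates *)

Section Bilinear.
Variable k : fieldType.

Record bil (U V Z : lmodType k) := Bil {
  bil_fun :> U -> V -> Z;
  bil_l : forall v, linear (bil_fun^~ v);
  bil_r : forall u, linear (bil_fun u)
}.

Section Theory.
Variables (U V Z : lmodType k) (f : bil U V Z).

HB.instance Definition _ (u : U) :=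
  GRing.isLinear.Build k V Z *:%R (f u) (bil_r f u).

Definition bil_flip (v : V) : U -> Z := f^~ v.
HB.instance Definition _ (v : V) :=
  GRing.isLinear.Build k U Z *:%R (bil_flip v) (bil_l f v).

Lemma bilDl v : {morph f^~ v : x y / x + y}. Proof. exact: (linearD (bil_flip v)). Qed.
Lemma bilBl v : {morph f^~ v : x y / x - y}. Proof. exact: (linearB (bil_flip v)). Qed.
Lemma bilNl v : {morph f^~ v : x / - x}. Proof. exact: (linearN (bil_flip v)). Qed.
Lemma bil0l v : f 0 v = 0. Proof. exact: (linear0 (bil_flip v)). Qed.
Lemma bilZl v c u : f (c *: u) v = c *: f u v. Proof. exact: (linearZ_LR (bil_flip v)). Qed.
Lemma bil_suml v (I : Type) (r : seq I) (P : pred I) (F : I -> U) :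
  f (\sum_(i <- r | P i) F i) v = \sum_(i <- r | P i) f (F i) v.
Proof. exact: (linear_sum (bil_flip v)). Qed.
Lemma bilDr u : {morph f u : x y / x + y}. Proof. exact: linearD. Qed.
Lemma bilBr u : {morph f u : x y / x - y}. Proof. exact: linearB. Qed.
Lemma bil0r u : f u 0 = 0. Proof. exact: linear0. Qed.
Lemma bilZr u c v : f u (c *: v) = c *: f u v. Proof. exact: linearZ_LR. Qed.
Lemma bil_sumr u (I : Type) (r : seq I) (P : pred I) (F : I -> V) :
  f u (\sum_(i <- r | P i) F i) = \sum_(i <- r | P i) f u (F i).
Proof. exact: linear_sum. Qed.
End Theory.

Arguments bil_fun : simpl never.

Record kbasis (V : lmodType k) := KBasis {
  bdim : nat;
  bvec :> 'I_bdim -> V;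
  bco : 'I_bdim -> {scalar V};
  bco_sum : forall v, \sum_i bco i v *: bvec i = v;
  bco_vec : forall i j, bco i (bvec j) = (i == j)%:R
}.
Arguments bco {V} k0 i : rename.

Definition spanned (V : lmodType k) :=
  exists (n : nat) (b : 'I_n -> V),
    forall x : V, exists c : 'I_n -> k, x = \sum_i c i *: b i.

(** A generating family of least length is free, since a nontrivial relation would express one of
    its members through the others. *)
Lemma spanned_basis (V : lmodType k) : spanned V -> inhabited (kbasis V).
Proof.
move=> sV; pose P n := `[< exists b : 'I_n -> V,
    forall x : V, exists c : 'I_n -> k, x = \sum_i c i *: b i >].
have [n /asboolP [b bP] nmin] : exists2 n, P n & forall m, P m -> (n <= m)%N.
  have exP : exists n, P n by case: sV => n sn; exists n; apply/asboolP.
  by case: (ex_minnP exP) => n Pn nP; exists n.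
have free c : \sum_i c i *: b i = 0 -> forall i, c i = 0.
  move=> c0; case: n b bP nmin c c0 => [|n] b bP nmin c c0 i; first by case: i.
  apply/eqP/negPn/negP => ci0.
  suff /nmin : P n by rewrite ltnn.
  apply/asboolP; exists (fun j => b (fintype.lift i j)) => x.
  have [d ->] := bP x; exists (fun j => d (fintype.lift i j) - d i / c i * c (fintype.lift i j)).
  have bi : b i = - (c i)^-1 *: \sum_j c (fintype.lift i j) *: b (fintype.lift i j).
    move: c0; rewrite (bigD1_ord i) //= => /eqP; rewrite addr_eq0 => /eqP cb.
    by rewrite scaleNr -scalerN -cb scalerA mulVf // scale1r.
  rewrite (bigD1_ord i) //= bi scalerA scaler_sumr -big_split /=.
  apply: eq_bigr => j _; rewrite scalerA -scalerDl; congr (_ *: _).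
  by rewrite addrC mulrN mulNr.
pose co x := projT1 (cid (bP x)).
have coP x : x = \sum_i co x i *: b i by apply: (projT2 (cid (bP x))).
have coE x c : x = \sum_i c i *: b i -> co x =1 c.
  move=> xc i; apply/eqP; rewrite -subr_eq0; apply/eqP; move: i; apply: free.
  under eq_bigr do rewrite scalerBl.
  by rewrite sumrB -coP -xc subrr.
have co_lin i : scalar (co^~ i).
  move=> a x y; apply: (coE _ (fun i => a * co x i + co y i)).
  under eq_bigr do rewrite scalerDl -scalerA.
  by rewrite big_split /= -scaler_sumr -!coP.
pose coL i : {scalar V} := HB.pack (co^~ i) (GRing.isLinear.Build _ _ _ _ _ (co_lin i)).
split; apply: (@KBasis V n b coL) => [v|i j]; first exact/esym/coP.
apply: (coE _ (fun i => (i == j)%:R)); rewrite (bigD1 j) //= eqxx scale1r.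
by rewrite big1 ?addr0 // => l /negbTE->; rewrite scale0r.
Qed.

(* [ot W] stands for W (x) V in coordinates with respect to a basis of V. *)
Section CoordTensor.
Variables (V : lmodType k) (b : kbasis V).

Definition ot (W : Type) : Type := {ffun 'I_(bdim b) -> W}.
HB.instance Definition _ (W : lmodType k) := GRing.Lmodule.on (ot W).

Section Tp.
Variable W : lmodType k.

Definition tp_fun (w : W) (v : V) : ot W := [ffun j => bco b j v *: w].
Fact tp_l v : linear (tp_fun^~ v).
Proof.
by move=> c x y; apply/ffunP => j; rewrite !ffunE scalerDr !scalerA mulrC.
Qed.
Fact tp_r w : linear (tp_fun w).
Proof.
by move=> c x y; apply/ffunP => j; rewrite !ffunE linearP scalerDl -scalerA.
Qed.
Definition tp : bil W V (ot W) := Bil tp_l tp_r.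

Lemma ot_sum (t : ot W) : t = \sum_j tp (t j) (b j).
Proof.
apply/ffunP => i; rewrite sum_ffunE (bigD1 i) //= !ffunE bco_vec eqxx scale1r.
by rewrite big1 ?addr0 // => j /negbTE ne; rewrite ffunE bco_vec eq_sym ne scale0r.
Qed.

(** Linear maps out of a tensor product agree once they agree on pure tensors. Most identities
    between maps of bar complexes below are stated as equalities of bundled linear maps in order to
    be checked this way. *)
Lemma ot_ext (Z : lmodType k) (f g : {linear ot W -> Z}) :
  (forall w v, f (tp w v) = g (tp w v)) -> f =1 g.
Proof.
move=> fg t; rewrite (ot_sum t) !linear_sum; apply: eq_bigr => j _; exact: fg.
Qed.
End Tp.
Arguments tp {W}.

Section Olift.
Variables (W Z : lmodType k) (phi : bil W V Z).

Definition tlift (t : ot W) : Z := \sum_j phi (t j) (b j).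
Fact tlift_linear : linear tlift.
Proof.
move=> c x y; rewrite /tlift scaler_sumr -big_split /=; apply: eq_bigr => j _.
by rewrite !ffunE bilDl bilZl.
Qed.
HB.instance Definition _ := GRing.isLinear.Build k (ot W) Z *:%R tlift tlift_linear.

Lemma tlift_tp w v : tlift (tp w v) = phi w v.
Proof.
rewrite /tlift -[in RHS](bco_sum b v) bil_sumr; apply: eq_bigr => j _.
by rewrite ffunE bilZl bilZr.
Qed.
End Olift.

Section Tmap.
Variables (W W' : lmodType k).

Definition tmap (f : W -> W') (t : ot W) : ot W' := [ffun j => f (t j)].
Fact tmap_linear (f : {linear W -> W'}) : linear (tmap f).
Proof. by move=> c x y; apply/ffunP => j; rewrite !ffunE linearP. Qed.
HB.instance Definition _ (f : {linear W -> W'}) :=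
  GRing.isLinear.Build k (ot W) (ot W') *:%R (tmap f) (tmap_linear f).

Lemma tmap_tp (f : {linear W -> W'}) w v : tmap f (tp w v) = tp (f w) v.
Proof. by apply/ffunP => j; rewrite !ffunE linearZ_LR. Qed.
End Tmap.

End CoordTensor.
Arguments tp {V} b {W}.
End Bilinear.
Arguments bco {k V} k0 i : rename.
Arguments tp {k V} b {W} : simpl never.
Arguments ot {k V} b W.
Arguments tmap {k V} b {W W'} f.
Arguments bil_fun {k U V Z} b _ _ : simpl never, rename.

(** * Complexes, bicomplexes and projective resolutions *)

Definition exact_at (X : nat -> zmodType) (d : forall n, X n.+1 -> X n) (n : nat) :=
  match n with
  | 0 => forall x : X 0%N, exists y, d 0%N y = x
  | m.+1 => forall x : X m.+1, d m x = 0 -> exists y, d m.+1 y = x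
  end.

(* [i] and [r] need to commute with the differentials only up to sign, whence  *)
(* the weak hypotheses.                                                        *)
Lemma exact_retract (X X' : nat -> zmodType)
    (d : forall n, X n.+1 -> X n) (d' : forall n, X' n.+1 -> X' n)
    (i : forall n, X n -> X' n) (r : forall n, X' n -> X n) :
  (forall n x, d n x = 0 -> d' n (i n.+1 x) = 0) ->
  (forall n x, exists y, r n (d' n x) = d n y) ->
  (forall n x, r n (i n x) = x) ->
  forall n, exact_at d' n -> exact_at d n.
Proof.
move=> iD rD ri [|n] /= ex x; first have [y yx] := ex (i _ x).
  by have [z yz] := rD _ y; exists z; rewrite -yz yx ri.
move=> dx; have [|y yx] := ex (i _ x); first exact: iD.
by have [z yz] := rD _ y; exists z; rewrite -yz yx ri.
Qed.

Section ShortExact.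
Variables (X' X X'' : nat -> zmodType).
Variables (d' : forall n, {additive X' n.+1 -> X' n}).
Variables (d : forall n, {additive X n.+1 -> X n}).
Variables (d'' : forall n, {additive X'' n.+1 -> X'' n}).
Variables (i : forall n, {additive X' n -> X n}) (p : forall n, {additive X n -> X'' n}).
Hypothesis iD : forall n x, i n (d' n x) = d n (i n.+1 x).
Hypothesis pD : forall n x, p n (d n x) = d'' n (p n.+1 x).
Hypothesis i_inj : forall n x, i n x = 0 -> x = 0.
Hypothesis pi0 : forall n x, p n (i n x) = 0.
Hypothesis p_ker : forall n x, p n x = 0 -> exists y, i n y = x.
Hypothesis p_surj : forall n y, exists x, p n x = y.
Hypothesis dd : forall n x, d n (d n.+1 x) = 0.

(** The segment H_(n+2)(X'') -> H_(n+1)(X') -> H_(n+1)(X) of the long exact sequence. *)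
Lemma exact_sub n : exact_at d n.+1 -> exact_at d'' n.+2 -> exact_at d' n.+1.
Proof.
move=> ex ex'' z dz; have [|u du] := ex (i _ z); first by rewrite -iD dz raddf0.
have [|v dv] := ex'' (p _ u); first by rewrite -pD du pi0.
have [w pw] := p_surj v.
have [|y iy] := @p_ker _ (u - d _ w); first by rewrite raddfB pD pw dv subrr.
exists y; apply/eqP; rewrite -subr_eq0; apply/eqP; apply: i_inj.
by rewrite raddfB iD iy raddfB dd subr0 du subrr.
Qed.

(** The segment H_(n+1)(X) -> H_(n+1)(X'') -> H_n(X') of the long exact sequence. *)
Lemma exact_quo n : exact_at d n.+1 -> exact_at d' n -> exact_at d'' n.+1.
Proof.
move=> ex ex' z dz; have [x px] := p_surj z.
have [|y iy] := @p_ker _ (d _ x); first by rewrite pD px dz.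
(* In positive degree [y] is a cycle, because its image d x is one and [i] is injective; in degree 0
   exactness is surjectivity and asks for no cycle condition. *)
have [y' dy'] : exists y', d' _ y' = y.
  case: n ex ex' z dz x px y iy => [|n] ex ex' z dz x px y iy; first exact: ex'.
  by apply: ex'; apply: i_inj; rewrite iD iy dd.
have [|u du] := ex (x - i _ y'); first by rewrite raddfB -iD dy' iy subrr.
by exists (p _ u); rewrite -pD du raddfB pi0 subr0.
Qed.
End ShortExact.

Section Bicomplex.
Variables (X : nat -> nat -> zmodType) (R S : nat -> zmodType).
Variables (dv : forall i j, {additive X i.+1 j -> X i j}).
Variables (dh : forall i j, {additive X i j.+1 -> X i j}).
Variables (rho : forall i, {additive X i 0 -> R i}) (sg : forall j, {additive X 0 j -> S j}).
Variables (dR : forall i, {additive R i.+1 -> R i}) (dS : forall j, {additive S j.+1 -> S j}).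
Hypothesis dvh : forall i j x, dv i j (dh i.+1 j x) = dh i j (dv i j.+1 x).
Hypothesis dvv : forall i j x, dv i j (dv i.+1 j x) = 0.
Hypothesis dhh : forall i j x, dh i j (dh i j.+1 x) = 0.
Hypothesis rho_dv : forall i x, rho i (dv i 0 x) = dR i (rho i.+1 x).
Hypothesis rho_dh : forall i x, rho i (dh i 0 x) = 0.
Hypothesis rho_surj : forall i r, exists x, rho i x = r.
Hypothesis rho_ker : forall i x, rho i x = 0 -> exists y, dh i 0 y = x.
Hypothesis dh_ker : forall i j x, dh i j x = 0 -> exists y, dh i j.+1 y = x.
Hypothesis sg_dh : forall j x, sg j (dh 0 j x) = dS j (sg j.+1 x).
Hypothesis sg_dv : forall j x, sg j (dv 0 j x) = 0.
Hypothesis sg_surj : forall j s, exists x, sg j x = s.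
Hypothesis sg_ker : forall j x, sg j x = 0 -> exists y, dv 0 j y = x.
Hypothesis dv_ker : forall i j x, dv i j x = 0 -> exists y, dv i.+1 j y = x.

(** The staircase argument, with commuting squares. For a fixed first index [dh] resolves [R], for a
    fixed second index [dv] resolves [S]. The induction on [i] moves along the antidiagonal until
    the second index is 0, where [rho] leads to [R] and its exactness ends the staircase. *)
Lemma bicomplex_stair n : exact_at dR n.+1 -> forall i j, (i + j = n)%N ->
  forall (x : X j i.+1) (x1 : X j.+1 i), dh j i x = dv j i x1 ->
  exists y z, x = dv j i.+1 y + dh j i.+1 z.
Proof.
move=> exR; elim=> [|i IHi] j; rewrite (add0n, addSn) => ijn x x1 xx1.
  rewrite -{}ijn {n} in exR.
  have [|r rx] := exR (rho _ x1); first by rewrite -rho_dv -xx1 rho_dh.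
  have [z zr] := rho_surj r.
  have [|w wz] := @rho_ker _ (x1 - dv _ _ z); first by rewrite raddfB rho_dv zr rx subrr.
  have [|y yx] := @dh_ker _ _ (x - dv _ _ w).
    by rewrite raddfB -dvh wz raddfB dvv subr0 xx1 subrr.
  by exists w, y; rewrite yx addrC subrK.
have [|x2 x12] := @dv_ker _ _ (dh _ _ x1); first by rewrite dvh -xx1 dhh.
have [||y [z yz]] := IHi j.+1 _ x1 x2 _; [by rewrite addnS|by []|].
have [|u ux] := @dh_ker _ _ (x - dv _ _ z).
  by rewrite raddfB -dvh xx1 yz raddfD dvv add0r subrr.
by exists z, u; rewrite ux addrC subrK.
Qed.

Lemma bicomplex_exact n : exact_at dR n.+1 -> exact_at dS n.+1.
Proof.
move=> exR s ds; have [x xs] := sg_surj s.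
have [|x1 xx1] := @sg_ker _ (dh _ _ x); first by rewrite sg_dh xs.
have [y [z yz]] := bicomplex_stair exR (addn0 n) (esym xx1).
by exists (sg _ z); rewrite -sg_dh -xs yz raddfD sg_dv add0r.
Qed.
End Bicomplex.

(** * Comparison of projective resolutions *)

Section Image.
Variables (R : pzRingType) (X Y : lmodType R) (g : {linear X -> Y}).

Definition image_pred : {pred Y} := fun y => `[< exists x, g x = y >].

Fact image_submod_closed : submod_closed image_pred.
Proof.
split=> [|a u v /asboolP [x <-] /asboolP [y <-]]; apply/asboolP.
  by exists 0; rewrite raddf0.
by exists (a *: x + y); rewrite linearP.
Qed.
HB.instance Definition _ := GRing.isSubmodClosed.Build R Y image_pred image_submod_closed.

Record image := Image { image_val :> Y; _ : image_val \in image_pred }.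
HB.instance Definition _ := [isSub for image_val].
HB.instance Definition _ := [Choice of image by <:].
HB.instance Definition _ := [SubChoice_isSubLmodule of image by <:].

(** [projective] speaks of surjections only. Corestricting [f] and [g] to the image of [g] gives
    lifting along any map whose image contains that of [f], as exactness of a resolution
    provides. *)
Lemma projective_lift (P : lmodType R) (f : {linear P -> Y}) :
  projective P -> (forall p, exists x, g x = f p) ->
  exists h : {linear P -> X}, forall p, g (h p) = f p.
Proof.
move=> projP fg; have fP p : f p \in image_pred by apply/asboolP; apply: fg.
have gP x : g x \in image_pred by apply/asboolP; exists x.
have f'L : linear (fun p => Image (fP p)) by move=> a x y; apply: val_inj; rewrite /= linearP.
have g'L : linear (fun x => Image (gP x)) by move=> a x y; apply: val_inj; rewrite /= linearP.
pose f' : {linear P -> image} := HB.pack (fun p => Image (fP p)) (GRing.isLinear.Build _ _ _ _ _ f'L).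
pose g' : {linear X -> image} := HB.pack (fun p => Image (gP p)) (GRing.isLinear.Build _ _ _ _ _ g'L).
have [|h hP] := projP _ _ g' f'; last by exists h => p; have /(congr1 val) := hP p.
by case=> y yP; have /asboolP [x xy] := yP; exists x; apply: val_inj.
Qed.
End Image.

Section Comparison.
Variables (R : pzRingType).

Section TensorMapComp.
Variables (N : lmodType R).

Lemma tens_ind (M : lmodType R^c) (P : tensor_mod M N -> Prop) :
  (forall m n, P (tens m n)) -> (forall x y, P x -> P y -> P (x - y)) ->
  forall x, P x.
Proof. exact: tensor_ind. Qed.

Lemma tens_ext (M : lmodType R^c) (Z : zmodType) (f g : {additive tensor_mod M N -> Z}) :
  (forall m n, f (tens m n) = g (tens m n)) -> f =1 g.
Proof. by move=> fg; elim/tens_ind=> [m n|x y fx fy] //; rewrite !raddfB /= fx fy. Qed.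

Lemma tensor_map_comp (M M' M'' : lmodType R^c)
    (f : {linear M -> M'}) (g : {linear M' -> M''}) x :
  tensor_map N g (tensor_map N f x) = tensor_map N (g \o f) x.
Proof.
elim/tens_ind: x => [m n|x y fx fy]; first by rewrite !tensor_mapE.
by rewrite !raddfB /= fx fy.
Qed.

Lemma tensor_map_eq (M M' : lmodType R^c) (f g : {linear M -> M'}) :
  f =1 g -> tensor_map N f =1 tensor_map N g.
Proof. by move=> fg; apply: tens_ext => m n /=; rewrite !tensor_mapE fg. Qed.

Lemma tensor_mapD (M M' : lmodType R^c) (f g : {linear M -> M'}) x :
  tensor_map N (f \+ g) x = tensor_map N f x + tensor_map N g x.
Proof.
elim/tens_ind: x => [m n|x y fx fy].
  by rewrite !tensor_mapE /= (zmod_morphD (tensBl n)).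
by rewrite !raddfB /= fx fy opprD addrACA.
Qed.

Lemma tensor_map_id (M : lmodType R^c) (f : {linear M -> M}) x :
  f =1 id -> tensor_map N f x = x.
Proof.
move=> f1; elim/tens_ind: x => [m n|x y fx fy]; first by rewrite tensor_mapE f1.
by rewrite raddfB /= fx fy.
Qed.
End TensorMapComp.

Variables (M : lmodType R^c).

Section ChainMap.
Variables (P Q : proj_resolution M).

Definition is_lift0 (f : {linear P 0%N -> Q 0%N}) := forall x, res_aug Q (f x) = res_aug P x.

(* The next component exists as soon as [d f d = 0]. *)
Definition liftable n : {linear P n -> Q n} -> Prop :=
  match n with
  | 0 => fun f => forall x, res_aug Q (f (res_diff P 0 x)) = 0
  | m.+1 => fun f => forall x, res_diff Q m (f (res_diff P m.+1 x)) = 0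
  end.

Lemma liftable_next n (f : {linear P n -> Q n}) : liftable f ->
  exists f' : {linear P n.+1 -> Q n.+1},
    (forall x, res_diff Q n (f' x) = f (res_diff P n x)) /\ liftable f'.
Proof.
move=> lf.
have [|f' f'P] := @projective_lift _ _ _ (res_diff Q n) _ (f \o res_diff P n) (@res_proj _ _ P n.+1).
  move=> p /=; case: n f lf p => [|n] f lf p; first exact/res_exact0/lf.
  exact/res_exactS/lf.
exists f'; split=> [//|] x; rewrite /= f'P /=.
have -> : res_diff P n (res_diff P n.+1 x) = 0 by apply/res_exactS; exists x.
by rewrite raddf0.
Qed.

Definition next_map n (f : {f : {linear P n -> Q n} | liftable f}) :
  {f : {linear P n.+1 -> Q n.+1} | liftable f} :=
  let s := cid (liftable_next (projT2 f)) in exist _ (projT1 s) (proj2 (projT2 s)).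

Lemma lift0_exists : exists f : {linear P 0%N -> Q 0%N}, is_lift0 f /\ liftable f.
Proof.
have [|f fP] := @projective_lift _ _ _ (res_aug Q) _ (res_aug P) (@res_proj _ _ P 0%N).
  by move=> p; apply: res_aug_surj.
by exists f; split=> // x /=; rewrite fP; apply/res_exact0; exists x.
Qed.

Fixpoint chain_map_sig n : {f : {linear P n -> Q n} | liftable f} :=
  match n with
  | 0 => exist _ _ (proj2 (projT2 (cid lift0_exists)))
  | m.+1 => next_map (chain_map_sig m)
  end.

Definition chain_map n : {linear P n -> Q n} := sval (chain_map_sig n).

Lemma chain_map_aug x : res_aug Q (chain_map 0 x) = res_aug P x.
Proof. by rewrite /chain_map /=; case: cid => f []. Qed.

Lemma chain_map_diff n x : res_diff Q n (chain_map n.+1 x) = chain_map n (res_diff P n x).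
Proof. by rewrite /chain_map /=; case: cid => f []. Qed.
End ChainMap.

Section Homotopy.
Variables (P : proj_resolution M) (f : forall n, {linear P n -> P n}).
Hypothesis f_aug : forall x, res_aug P (f 0 x) = 0.
Hypothesis f_diff : forall n x, res_diff P n (f n.+1 x) = f n (res_diff P n x).

(* [f - h d], the part of [f] that the next component of [h] has to lift. *)
Definition defect n : {linear P n -> P n.+1} -> {linear P n.+1 -> P n.+1} :=
  fun h => f n.+1 \- (h \o res_diff P n).

Definition good_homotopy n (h : {linear P n -> P n.+1}) :=
  forall x, res_diff P n (defect h x) = 0.

Lemma homotopy0 : exists h : {linear P 0%N -> P 1%N},
  (forall x, res_diff P 0 (h x) = f 0 x) /\ good_homotopy h.
Proof.
have [|h hP] := @projective_lift _ _ _ (res_diff P 0) _ (f 0) (@res_proj _ _ P 0%N).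
  by move=> p; apply/res_exact0.
by exists h; split=> // x; rewrite /= raddfB /= hP f_diff subrr.
Qed.

Lemma homotopy_next n (h : {linear P n -> P n.+1}) : good_homotopy h ->
  exists h' : {linear P n.+1 -> P n.+2},
    (forall x, res_diff P n.+1 (h' x) = f n.+1 x - h (res_diff P n x)) /\ good_homotopy h'.
Proof.
move=> gh.
have [|h' hP] := @projective_lift _ _ _ (res_diff P n.+1) _ (defect h) (@res_proj _ _ P n.+1).
  by move=> p; apply/res_exactS/gh.
exists h'; split=> [x|x]; first exact: hP.
rewrite /= raddfB /= hP /= f_diff.
have -> : res_diff P n (res_diff P n.+1 x) = 0 by apply/res_exactS; exists x.
by rewrite raddf0 subr0 subrr.
Qed.

Fixpoint homotopy_sig n : {h : {linear P n -> P n.+1} | good_homotopy h} :=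
  match n with
  | 0 => exist _ _ (proj2 (projT2 (cid homotopy0)))
  | m.+1 =>
    let s := cid (homotopy_next (proj2_sig (homotopy_sig m))) in
    exist _ (projT1 s) (proj2 (projT2 s))
  end.

Definition homotopy n : {linear P n -> P n.+1} := sval (homotopy_sig n).

Lemma homotopyE0 x : res_diff P 0 (homotopy 0 x) = f 0 x.
Proof. by rewrite /homotopy /=; case: cid => h []. Qed.

Lemma homotopyE n x :
  res_diff P n.+1 (homotopy n.+1 x) + homotopy n (res_diff P n x) = f n.+1 x.
Proof. by rewrite /homotopy /=; case: cid => h [/= -> _]; rewrite subrK. Qed.
End Homotopy.

(** With chain maps F : P -> Q and G : Q -> P over the identity of M, the map id - GF on P is
    null-homotopic, so a cycle of P (x) N is G F of itself up to a boundary, and F of it is a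
    boundary by hypothesis. *)
Lemma Tor_vanishes_res (N : lmodType R) (Q : proj_resolution M) n :
  homology_vanishes N Q n -> Tor_vanishes n M N.
Proof.
move=> vQ P; pose F := chain_map P Q; pose G := chain_map Q P.
pose idf n : {linear P n -> P n} := idfun.
pose f n : {linear P n -> P n} := idf n \- (G n \o F n).
have f_aug x : res_aug P (f 0 x) = 0 by rewrite /= raddfB /= !chain_map_aug subrr.
have f_diff m x : res_diff P m (f m.+1 x) = f m (res_diff P m x).
  by rewrite /= raddfB /= !chain_map_diff.
have GF m (x : tensor_mod (P m) N) :
    x = tensor_map N (G m) (tensor_map N (F m) x) + tensor_map N (f m) x.
  rewrite tensor_map_comp -tensor_mapD; apply/esym/tensor_map_id => y /=.
  by rewrite addrC subrK.
have dF m x : tensor_map N (res_diff Q m) (tensor_map N (F m.+1) x) =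
    tensor_map N (F m) (tensor_map N (res_diff P m) x).
  by rewrite !tensor_map_comp; apply: tensor_map_eq => y; apply: chain_map_diff.
have dG m x : tensor_map N (res_diff P m) (tensor_map N (G m.+1) x) =
    tensor_map N (G m) (tensor_map N (res_diff Q m) x).
  by rewrite !tensor_map_comp; apply: tensor_map_eq => y; apply: chain_map_diff.
pose h m := homotopy f_aug f_diff m.
case: n vQ => [|n] vQ x => [|dx].
  have [y yx] := vQ (tensor_map N (F 0) x).
  exists (tensor_map N (G 1) y + tensor_map N (h 0) x).
  rewrite raddfD /= dG yx [RHS]GF; congr (_ + _); rewrite tensor_map_comp.
  by apply: tensor_map_eq => z; apply: homotopyE0.
have [|y yx] := vQ (tensor_map N (F n.+1) x); first by rewrite dF dx raddf0.
exists (tensor_map N (G n.+2) y + tensor_map N (h n.+1) x).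
rewrite raddfD /= dG yx [RHS]GF; congr (_ + _); rewrite tensor_map_comp.
(* As [x] is a cycle, the summand h d of the homotopy vanishes on it and may be added freely. *)
transitivity (tensor_map N ((res_diff P n.+1 \o h n.+1) \+ (h n \o res_diff P n)) x).
  by rewrite tensor_mapD -[tensor_map N (h n \o _) x]tensor_map_comp dx raddf0 addr0.
by apply: tensor_map_eq => z; apply: homotopyE.
Qed.
End Comparison.

(** * Actions on coordinate tensor products, and exactness of tensoring over a field *)

Section BilinearOps.
Variable k : fieldType.

Definition bswap (U V Z : lmodType k) (f : bil U V Z) : bil V U Z :=
  @Bil k V U Z (fun v u => f u v) (bil_r f) (bil_l f).

Section Star.
Variables (V U Z : lmodType k) (bV : kbasis V) (bZ : kbasis Z) (f : bil V U Z).
Variable W : lmodType k.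

(* (w (x) v, u) |-> w (x) f(v, u) *)
Definition star_fun (t : ot bV W) (u : U) : ot bZ W := \sum_j tp bZ (t j) (f (bV j) u).
Fact star_l u : linear (star_fun^~ u).
Proof.
move=> c x y; rewrite /star_fun scaler_sumr -big_split /=; apply: eq_bigr => j _.
by rewrite !ffunE bilDl bilZl.
Qed.
Fact star_r t : linear (star_fun t).
Proof.
move=> c x y; rewrite /star_fun scaler_sumr -big_split /=; apply: eq_bigr => j _.
by rewrite linearP bilDr bilZr.
Qed.
Definition star : bil (ot bV W) U (ot bZ W) := Bil star_l star_r.

Lemma star_tp w v u : star (tp bV w v) u = tp bZ w (f v u).
Proof.
rewrite -[LHS]/(star_fun _ _) /star_fun -[in RHS](bco_sum bV v) bil_suml bil_sumr; apply: eq_bigr => j _.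
by rewrite ffunE [LHS]bilZl bilZl bilZr.
Qed.
End Star.

Section Btmap.
Variables (V U : lmodType k) (b : kbasis U) (W W' : lmodType k) (f : bil V W W').

(* (v, w (x) u) |-> f(v, w) (x) u *)
Definition btmap_fun (v : V) (t : ot b W) : ot b W' := tmap b (f v) t.
Fact btmap_l t : linear (btmap_fun^~ t).
Proof. by move=> c x y; apply/ffunP => j; rewrite !ffunE /= bilDl bilZl. Qed.
Fact btmap_r v : linear (btmap_fun v).
Proof. by move=> c x y; rewrite /btmap_fun linearP. Qed.
Definition btmap : bil V (ot b W) (ot b W') := Bil btmap_l btmap_r.

Lemma btmap_tp v w u : btmap v (tp b w u) = tp b (f v w) u.
Proof. exact: tmap_tp. Qed.
End Btmap.
End BilinearOps.
Arguments star {k V U Z} bV bZ f W.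
Arguments btmap {k V U} b {W W'} f.

Section Tmap.
Variables (k : fieldType) (V : lmodType k) (b : kbasis V).

Lemma tmap0 (W W' : lmodType k) (f : {linear W -> W'}) t :
  (forall w, f w = 0) -> tmap b f t = 0.
Proof. by move=> f0; apply/ffunP => j; rewrite !ffunE f0. Qed.

(** In coordinates (x) V is a finite power, so injectivity, surjectivity and exactness are inherited
    entry by entry. *)
Lemma tmap_inj (W W' : lmodType k) (f : {linear W -> W'}) t :
  (forall w, f w = 0 -> w = 0) -> tmap b f t = 0 -> t = 0.
Proof.
move=> f0 /ffunP t0; apply/ffunP => j; rewrite ffunE; apply: f0.
by have := t0 j; rewrite !ffunE.
Qed.

Lemma tmap_surj (W W' : lmodType k) (f : {linear W -> W'}) t :
  (forall w, exists v, f v = w) -> exists s, tmap b f s = t.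
Proof.
move=> fs; exists [ffun j => projT1 (cid (fs (t j)))].
by apply/ffunP => j; rewrite !ffunE; case: cid.
Qed.

Lemma tmap_exact (W W' W'' : lmodType k) (f : {linear W -> W'}) (g : {linear W' -> W''}) t :
  (forall w, g w = 0 -> exists v, f v = w) -> tmap b g t = 0 -> exists s, tmap b f s = t.
Proof.
move=> fg /ffunP t0; have gt j : exists v, f v = t j.
  by apply: fg; have := t0 j; rewrite !ffunE.
exists [ffun j => projT1 (cid (gt j))].
by apply/ffunP => j; rewrite !ffunE; case: cid.
Qed.
End Tmap.

(** * Bar complexes *)

Section KAlgebraSpace.
Variables (k : fieldType) (A : kAlgType k).

(** A [kAlgType] is not an [lmodType] over k; [kvs] is the algebra seen as a vector space through
    [kmap]. *)
Definition kvs : Type := A.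
HB.instance Definition _ := GRing.PzRing.on kvs.

Definition kvs_scale (c : k) (x : kvs) : kvs := kmap A c * (x : A).
Fact kvs_scaleA a b v : kvs_scale a (kvs_scale b v) = kvs_scale (a * b) v.
Proof. by rewrite /kvs_scale rmorphM mulrA. Qed.
Fact kvs_scale1 : left_id 1 kvs_scale.
Proof. by move=> x; rewrite /kvs_scale rmorph1 mul1r. Qed.
Fact kvs_scaleDr : right_distributive kvs_scale +%R.
Proof. by move=> a x y; rewrite /kvs_scale mulrDr. Qed.
Fact kvs_scaleDl v : {morph kvs_scale^~ v : a b / a + b}.
Proof. by move=> a b; rewrite /kvs_scale rmorphD mulrDl. Qed.
HB.instance Definition _ := GRing.Zmodule_isLmodule.Build k kvs
  kvs_scaleA kvs_scale1 kvs_scaleDr kvs_scaleDl.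

Lemma kvs_scaleE (c : k) (x : kvs) : c *: x = kmap A c * (x : A). Proof. by []. Qed.

Fact kmul_l (y : kvs) : linear (fun x : kvs => x * y).
Proof. by move=> c u v; rewrite mulrDl !kvs_scaleE -mulrA. Qed.
Fact kmul_r (x : kvs) : linear (fun y : kvs => x * y).
Proof. by move=> c u v; rewrite mulrDr !kvs_scaleE !mulrA kmapC. Qed.
Definition kmul : bil kvs kvs kvs := Bil kmul_l kmul_r.
Lemma kmulE x y : kmul x y = x * y. Proof. by []. Qed.

Record rmod := RMod {
  rcar :> lmodType k;
  ract : bil rcar kvs rcar;
  ractM : forall x a b, ract (ract x a) b = ract x (a * b);
  ract1 : forall x, ract x 1 = x
}.

Record lmod := LMod {
  lcar :> lmodType k;
  lact : bil kvs lcar lcar;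
  lactM : forall x a b, lact a (lact b x) = lact (a * b) x;
  lact1 : forall x, lact 1 x = x
}.

Record bimod := BiMod {
  birmod :> rmod;
  bilact : bil kvs birmod birmod;
  bilactM : forall x a b, bilact a (bilact b x) = bilact (a * b) x;
  bilact1 : forall x, bilact 1 x = x;
  bilactr : forall x a b, bilact a (ract birmod x b) = ract birmod (bilact a x) b
}.

Arguments rcar : simpl never.
Arguments ract : simpl never.
Arguments lcar : simpl never.
Arguments lact : simpl never.
Arguments birmod : simpl never.
Arguments bilact : simpl never.

Definition rlin (X Y : rmod) (f : X -> Y) := forall x a, f (ract X x a) = ract Y (f x) a.
End KAlgebraSpace.

Arguments rcar {k A} _ : simpl never.
Arguments ract {k A} _ : simpl never.
Arguments lcar {k A} _ : simpl never.
Arguments lact {k A} _ : simpl never.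
Arguments birmod {k A} _ : simpl never.
Arguments bilact {k A} _ : simpl never.

Section Bar.
Variables (k : fieldType) (S : kAlgType k) (bS : kbasis (kvs S)).

Section Free.
Variable W : lmodType k.

Definition free_act : bil (ot bS W) (kvs S) (ot bS W) := star bS bS (kmul S) W.
Fact free_actM x a b : free_act (free_act x a) b = free_act x (a * b).
Proof.
pose F := bil_flip free_act b \o bil_flip free_act a.
apply: (@ot_ext _ _ _ _ _ F (bil_flip free_act (a * b))) => w v.
by rewrite /F /= /bil_flip !star_tp !kmulE mulrA.
Qed.
Fact free_act1 x : free_act x 1 = x.
Proof.
apply: (@ot_ext _ _ _ _ _ (bil_flip free_act 1) idfun) => w v.
by rewrite /= /bil_flip star_tp kmulE mulr1.
Qed.
Definition free : rmod S := RMod free_actM free_act1.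

Lemma free_act_tp w v a : ract free (tp bS w v) a = tp bS w (v * a).
Proof. exact: star_tp. Qed.
End Free.

(* X (x) S^n *)
Fixpoint Tn (n : nat) (X : rmod S) : rmod S :=
  match n with 0 => X | m.+1 => free (Tn m X) end.

Section Cons.
Variables (X : rmod S) (n : nat).

Definition tc : bil (Tn n X) (kvs S) (Tn n.+1 X) := tp bS.

Lemma Tn_ext (Z : lmodType k) (f g : {linear Tn n.+1 X -> Z}) :
  (forall w a, f (tc w a) = g (tc w a)) -> f =1 g.
Proof. exact: ot_ext. Qed.

Lemma ract_tc w a b : ract (Tn n.+1 X) (tc w a) b = tc w (a * b).
Proof. exact: free_act_tp. Qed.
End Cons.

(* The bar differential with the sign convention that makes its recursion     *)
(* sign-free: x (x) a_1 ... a_n+1 is mapped to                                *)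
(*   ... a_n a_n+1 - ... a_n-1 a_n (x) a_n+1 + ...                            *)
Fixpoint barD (X : rmod S) (n : nat) : Tn n.+1 X -> Tn n X :=
  match n return Tn n.+1 X -> Tn n X with
  | 0 => tlift (ract X)
  | m.+1 => fun t => tlift (ract (Tn m.+1 X)) t - tmap bS (@barD X m) t
  end.
Arguments Tn : simpl never.
Arguments tc {X n}.
Arguments barD X n t : clear implicits, simpl never.

Fact D_linear X n : linear (barD X n).
Proof.
elim: n => [|n IHn]; first exact: linearP.
pose Dn : {linear Tn n.+1 X -> Tn n X} :=
  HB.pack (barD X n) (GRing.isLinear.Build _ _ _ _ _ IHn).
exact: (linearP (tlift (ract (Tn n.+1 X)) \- tmap bS Dn)).
Qed.
HB.instance Definition _ (X : rmod S) (n : nat) :=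
  GRing.isLinear.Build k (Tn n.+1 X) (Tn n X) *:%R (barD X n) (@D_linear X n).

Fixpoint Tmn (X Y : rmod S) (f : X -> Y) (n : nat) : Tn n X -> Tn n Y :=
  match n return Tn n X -> Tn n Y with
  | 0 => f
  | m.+1 => tmap bS (@Tmn X Y f m)
  end.
Arguments Tmn {X Y} f n t : simpl never.

Fact Tmn_linear (X Y : rmod S) (f : {linear X -> Y}) n : linear (Tmn f n).
Proof.
elim: n => [|n IHn]; first exact: linearP.
pose Fn : {linear Tn n X -> Tn n Y} :=
  HB.pack (Tmn f n) (GRing.isLinear.Build _ _ _ _ _ IHn).
exact: (linearP (tmap bS Fn)).
Qed.
HB.instance Definition _ (X Y : rmod S) (f : {linear X -> Y}) (n : nat) :=
  GRing.isLinear.Build k (Tn n X) (Tn n Y) *:%R (Tmn f n) (@Tmn_linear X Y f n).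

Section OneModule.
Variable X : rmod S.

Lemma D0_tc x a : barD X 0 (tc x a) = ract X x a.
Proof. exact: tlift_tp. Qed.

Lemma DS_tc n (w : Tn n.+1 X) a :
  barD X n.+1 (tc w a) = ract (Tn n.+1 X) w a - tc (barD X n w) a.
Proof.
rewrite -[LHS]/(tlift (ract (Tn n.+1 X)) (tp bS w a) - tmap bS (barD X n) (tp bS w a)).
by rewrite tlift_tp tmap_tp.
Qed.

Lemma D_ract n (w : Tn n.+1 X) a :
  barD X n (ract (Tn n.+1 X) w a) = ract (Tn n X) (barD X n w) a.
Proof.
pose R m : {linear Tn m X -> Tn m X} := bil_flip (ract (Tn m X)) a.
apply: (@Tn_ext _ _ _ (barD X n \o R n.+1) (R n \o barD X n)) => v b.
rewrite /R /= /bil_flip ract_tc.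
case: n v {w R} => [|n] v; first by rewrite !D0_tc ractM.
by rewrite !DS_tc bilBl ractM ract_tc.
Qed.

(** By the recursion, D D (w (x) a) is D(wa) - (Dw)a + (D D w) (x) a; the first two terms cancel
    because D is right linear in the last letter. *)
Lemma DD n (w : Tn n.+2 X) : barD X n (barD X n.+1 w) = 0.
Proof.
elim: n w => [|n IHn] w; apply: (@Tn_ext _ _ _ (barD X _ \o barD X _) \0) => {}w a.
  by rewrite /= DS_tc raddfB /= D_ract D0_tc subrr.
by rewrite /= DS_tc raddfB /= D_ract DS_tc IHn bil0l subr0 subrr.
Qed.

Lemma D_tc_D n (w : Tn n.+1 X) a : barD X n (tc (barD X n w) a) = ract (Tn n X) (barD X n w) a.
Proof.
case: n w => [|n] w; first by rewrite D0_tc.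
by rewrite DS_tc DD bil0l subr0.
Qed.
End OneModule.

Section Functor.
Variables X Y Z : rmod S.

Lemma Tmn_tc (f : {linear X -> Y}) n w a : Tmn f n.+1 (tc w a) = tc (Tmn f n w) a.
Proof. exact: (@tmap_tp _ _ bS _ _ (Tmn f n)). Qed.

Lemma Tmn_comp (f : X -> Y) (g : Y -> Z) n t : Tmn g n (Tmn f n t) = Tmn (g \o f) n t.
Proof.
by elim: n t => [//|n IHn] t; apply/ffunP => j; rewrite !ffunE; exact: IHn.
Qed.

Lemma Tmn_eq (f g : X -> Y) n : f =1 g -> Tmn f n =1 Tmn g n.
Proof.
by move=> fg; elim: n => [//|n IHn] t; apply/ffunP => j; rewrite !ffunE; exact: IHn.
Qed.

Lemma Tmn_id (f : X -> X) n t : f =1 id -> Tmn f n t = t.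
Proof.
by move=> fg; elim: n t => [//|n IHn] t; apply/ffunP => j; rewrite !ffunE; exact: IHn.
Qed.

Lemma Tmn_inj (f : {linear X -> Y}) n t : (forall x, f x = 0 -> x = 0) -> Tmn f n t = 0 -> t = 0.
Proof. by move=> f0; elim: n t => [|n IHn] t; [exact: f0|exact: (@tmap_inj _ _ bS _ _ (Tmn f n) _ IHn)]. Qed.

Lemma Tmn0 (f : {linear X -> Y}) n t : (forall x, f x = 0) -> Tmn f n t = 0.
Proof. by move=> f0; elim: n t => [|n IHn] t; [exact: f0|exact: (@tmap0 _ _ bS _ _ (Tmn f n) _ IHn)]. Qed.

Lemma Tmn_surj (f : {linear X -> Y}) n t :
  (forall x, exists v, f v = x) -> exists s, Tmn f n s = t.
Proof. by move=> f0; elim: n t => [|n IHn] t; [exact: f0|exact: (@tmap_surj _ _ bS _ _ (Tmn f n) _ IHn)]. Qed.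

Lemma Tmn_exact (f : {linear X -> Y}) (g : {linear Y -> Z}) n t :
  (forall x, g x = 0 -> exists v, f v = x) -> Tmn g n t = 0 -> exists s, Tmn f n s = t.
Proof. by move=> f0; elim: n t => [|n IHn] t; [exact: f0|exact: (@tmap_exact _ _ bS _ _ _ (Tmn f n) (Tmn g n) _ IHn)]. Qed.

Lemma Tmn_ract (f : {linear X -> Y}) n w a :
  (n = 0%N -> rlin f) -> Tmn f n (ract (Tn n X) w a) = ract (Tn n Y) (Tmn f n w) a.
Proof.
case: n w => [|n] w fR; first exact: fR.
pose R (X : rmod S) : {linear Tn n.+1 X -> Tn n.+1 X} := bil_flip (ract (Tn n.+1 X)) a.
apply: (@Tn_ext _ _ _ (Tmn f n.+1 \o R X) (R Y \o Tmn f n.+1)) => v b.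
by rewrite /R /= /bil_flip !Tmn_tc !ract_tc Tmn_tc.
Qed.

Lemma D_Tmn (f : {linear X -> Y}) n t :
  rlin f -> barD Y n (Tmn f n.+1 t) = Tmn f n (barD X n t).
Proof.
move=> fR; elim: n t => [|n IHn] t.
  apply: (@Tn_ext _ _ _ (barD Y 0 \o Tmn f 1) (Tmn f 0 \o barD X 0)) => v b.
  by rewrite /= Tmn_tc !D0_tc fR.
apply: (@Tn_ext _ _ _ (barD Y n.+1 \o Tmn f n.+2) (Tmn f n.+1 \o barD X n.+1)) => v b.
by rewrite /= Tmn_tc !DS_tc IHn raddfB /= Tmn_tc Tmn_ract.
Qed.
End Functor.
End Bar.
Arguments Tn {k S} bS n X : simpl never.
Arguments tc {k S} bS {X n}.
Arguments barD {k S} bS X n t : simpl never.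
Arguments Tmn {k S} bS {X Y} f n t : simpl never.

(** * Hochschild chains *)

Section BarOperators.
Variables (k : fieldType) (S : kAlgType k) (bS : kbasis (kvs S)).
Local Notation Tn := (Tn bS).
Local Notation barD := (barD bS).
Local Notation Tmn := (Tmn bS).
Local Notation tc := (tc bS).

Section Families.
Variables X Y : rmod S.

(** Linearity in the map rather than in the argument. The form for finite families serves both the
    bilinearity of [bTn] and expansions in a basis such as [sg_act]. *)
Lemma Tmn_lin (I : finType) (c : I -> k) (F : I -> X -> Y) (f : X -> Y) n t :
  (forall x, f x = \sum_i c i *: F i x) -> Tmn f n t = \sum_i c i *: Tmn (F i) n t.
Proof.
move=> fF; elim: n t => [|n IHn] t; first exact: fF.
apply/ffunP => j; rewrite sum_ffunE.
transitivity (\sum_i c i *: Tmn (F i) n (t j)); first by rewrite ffunE; apply: IHn.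
by apply: eq_bigr => i _; rewrite !ffunE.
Qed.

Variables (V : lmodType k) (f : bil V X Y) (n : nat).

Definition bTn_fun (v : V) (t : Tn n X) : Tn n Y := Tmn (f v) n t.
Fact bTn_l t : linear (bTn_fun^~ t).
Proof.
move=> c u v; rewrite /bTn_fun; pose F (b : bool) := if b then f u else f v.
rewrite (@Tmn_lin _ (fun b : bool => if b then c else 1) F) => [|x]; rewrite big_bool /= scale1r //.
by rewrite bilDl bilZl.
Qed.
Fact bTn_r v : linear (bTn_fun v). Proof. exact: (linearP (Tmn (f v) n)). Qed.
Definition bTn : bil V (Tn n X) (Tn n Y) := Bil bTn_l bTn_r.
Lemma bTnE v t : bTn v t = Tmn (f v) n t. Proof. by []. Qed.
End Families.

Section Hochschild.
Variable Y : bimod S.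

Definition twist n : Tn n.+1 Y -> Tn n Y := tlift (bswap (bTn (bilact Y) n)).
Arguments twist : simpl never.

HB.instance Definition _ n :=
  GRing.isLinear.Build k (Tn n.+1 Y) (Tn n Y) *:%R (@twist n) (tlift_linear _).

Lemma tw_tc n w a : twist (tc w a) = Tmn (bilact Y a) n w.
Proof. exact: tlift_tp. Qed.

(* x (x) a_1 ... a_n+1 |-> barD(x (x) a_1 ... a_n+1) - a_n+1 x (x) a_1 ... a_n,  *)
(* the Hochschild differential up to sign *)
Definition hoch n (t : Tn n.+1 Y) : Tn n Y := barD Y n t - twist t.
Fact hoch_linear n : linear (@hoch n). Proof. exact: (linearP (barD Y n \- @twist n)). Qed.
HB.instance Definition _ n :=
  GRing.isLinear.Build k (Tn n.+1 Y) (Tn n Y) *:%R (@hoch n) (@hoch_linear n).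

Lemma hoch_sum n (I : finType) (F : I -> Tn n.+1 Y) :
  hoch (\sum_i F i) = \sum_i hoch (F i).
Proof. exact: raddf_sum. Qed.

Lemma bilact_rlin a : rlin (bilact Y a).
Proof. by move=> x b; rewrite bilactr. Qed.

Lemma hochS_tc n (w : Tn n.+1 Y) a :
  hoch (tc w a) = ract (Tn n.+1 Y) w a - tc (barD Y n w) a - Tmn (bilact Y a) n.+1 w.
Proof. by rewrite /hoch DS_tc tw_tc. Qed.

Lemma hoch0_tc (y : Tn 0 Y) a : hoch (tc y a) = ract Y y a - bilact Y a y.
Proof. by rewrite /hoch D0_tc tw_tc. Qed.

(** On v (x) b both sides are (ba)v. This cyclic invariance is what cancels the remaining terms in
    [hoch_hoch]. *)
Lemma tw_swap n (w : Tn n.+1 Y) a :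
  twist (Tmn (bilact Y a) n.+1 w) = twist (ract (Tn n.+1 Y) w a).
Proof.
pose R : {linear Tn n.+1 Y -> Tn n.+1 Y} := bil_flip (ract (Tn n.+1 Y)) a.
apply: (@Tn_ext _ _ _ _ _ _ (@twist n \o Tmn (bilact Y a) n.+1) (@twist n \o R)) => v b.
rewrite /R /= /bil_flip Tmn_tc ract_tc !tw_tc Tmn_comp.
by apply: Tmn_eq => x /=; rewrite bilactM.
Qed.

Lemma hoch_hoch n (t : Tn n.+2 Y) : hoch (hoch t) = 0.
Proof.
apply: (@Tn_ext _ _ _ _ _ _ (@hoch n \o @hoch n.+1) \0) => w a /=.
rewrite hochS_tc [LHS]/hoch !raddfB /= D_ract D_tc_D subrr sub0r.
rewrite D_Tmn; last exact: bilact_rlin.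
by rewrite tw_tc tw_swap addrAC subrr sub0r opprK addNr.
Qed.
End Hochschild.
Arguments hoch Y n t : clear implicits.

Definition llin (X Y : bimod S) (f : X -> Y) := forall a x, f (bilact X a x) = bilact Y a (f x).

Lemma hoch_Tmn (X Y : bimod S) (f : {linear X -> Y}) n t :
  rlin f -> llin f -> hoch Y n (Tmn f n.+1 t) = Tmn f n (hoch X n t).
Proof.
move=> fR fL; rewrite /hoch raddfB /= D_Tmn //; congr (_ - _).
apply: (@Tn_ext _ _ _ _ _ _ (@twist Y n \o Tmn f n.+1) (Tmn f n \o @twist X n)) => w a.
by rewrite /= Tmn_tc !tw_tc !Tmn_comp; apply: Tmn_eq => x /=; rewrite fL.
Qed.

Section LeftRelativelyProjective.
Variables (Y : bimod S) (sg : 'I_(bdim bS) -> {linear Y -> Y}).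
Hypothesis sg_r : forall j, rlin (sg j).
Hypothesis sg_sum : forall y, \sum_j bilact Y (bS j) (sg j y) = y.
Hypothesis sg_l : forall j a y,
  sg j (bilact Y a y) = \sum_i bco bS j (a * bS i) *: sg i y.

(** The hypotheses on [sg] say that y |-> sum_j b_j (x) sg_j(y) is a bimodule section of the action
    S (x) Y -> Y. In a Hochschild chain the last letter is cyclically adjacent to the left side of
    Y, so b_j is appended at the end. *)
Definition left_homotopy n (t : Tn n Y) : Tn n.+1 Y := \sum_j tc (Tmn (sg j) n t) (bS j).
Fact hl_linear n : linear (@left_homotopy n).
Proof.
move=> c x y; rewrite /left_homotopy scaler_sumr -big_split /=; apply: eq_bigr => j _.
by rewrite linearP bilDl bilZl.
Qed.
HB.instance Definition _ n :=
  GRing.isLinear.Build k (Tn n Y) (Tn n.+1 Y) *:%R (@left_homotopy n) (@hl_linear n).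

Lemma hl_sub n : {morph @left_homotopy n : x y / x - y}. Proof. exact: raddfB. Qed.

Lemma sg_act n t : \sum_j Tmn (bilact Y (bS j)) n (Tmn (sg j) n t) = t.
Proof.
transitivity (Tmn idfun n t); last exact: Tmn_id.
rewrite (@Tmn_lin _ _ _ (fun=> 1) (fun j y => bilact Y (bS j) (sg j y))) => [|x].
  by apply: eq_bigr => j _; rewrite scale1r Tmn_comp.
by under eq_bigr do rewrite scale1r; rewrite sg_sum.
Qed.

(** Left linearity [sg_l] of the section carries the homotopy past the cyclic face. *)
Lemma hl_tw n t : left_homotopy (twist t) = \sum_j ract (Tn n.+1 Y) (Tmn (sg j) n.+1 t) (bS j).
Proof.
pose R j : {linear Tn n.+1 Y -> Tn n.+1 Y} := bil_flip (ract (Tn n.+1 Y)) (bS j).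
have F_lin : linear (fun t => \sum_j ract (Tn n.+1 Y) (Tmn (sg j) n.+1 t) (bS j)).
  move=> c x y; rewrite scaler_sumr -big_split /=; apply: eq_bigr => j _.
  by rewrite linearP bilDl bilZl.
pose F : {linear Tn n.+1 Y -> Tn n.+1 Y} := HB.pack
  (fun t => \sum_j ract (Tn n.+1 Y) (Tmn (sg j) n.+1 t) (bS j))
  (GRing.isLinear.Build _ _ _ _ _ F_lin).
apply: (@Tn_ext _ _ _ _ _ _ (@left_homotopy n \o @twist Y n) F) => w a.
rewrite /F /= tw_tc /left_homotopy.
under [RHS]eq_bigr => j _ do rewrite Tmn_tc ract_tc -(bco_sum bS (a * bS j)) bil_sumr.
rewrite exchange_big /=; apply: eq_bigr => j _.
under eq_bigr do rewrite bilZr -bilZl.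
rewrite -bil_suml; congr (tc _ _); rewrite Tmn_comp.
by apply: Tmn_lin => x /=; rewrite sg_l.
Qed.

(** In degree 0 the homotopy does not contract: it shows that y is homologous to sum_j sg_j(y) b_j,
    which later identifies the surviving group. *)
Lemma hoch_hl0 (y : Y) : hoch Y 0 (@left_homotopy 0 y) = \sum_j ract Y (sg j y) (bS j) - y.
Proof.
rewrite /left_homotopy raddf_sum -[in RHS](sg_sum y) -sumrB /=; apply: eq_bigr => j _.
by rewrite hoch0_tc sg_sum.
Qed.

Lemma hoch_hl n (t : Tn n.+1 Y) : hoch Y n.+1 (left_homotopy t) + left_homotopy (hoch Y n t) = - t.
Proof.
rewrite [hoch Y n t]/hoch hl_sub hl_tw {1}/left_homotopy hoch_sum.
under eq_bigr do rewrite hochS_tc.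
rewrite !sumrB sg_act.
under [X in _ - X - t]eq_bigr do rewrite D_Tmn //.
by rewrite -/(left_homotopy (barD Y n t)) -[left_homotopy _ - _]opprB addrAC subrr add0r.
Qed.

Lemma hoch_lproj_exact n : exact_at (hoch Y) n.+1.
Proof.
move=> t dt; exists (- left_homotopy t); rewrite raddfN /=; apply/eqP; rewrite eqr_oppLR.
by have := hoch_hl t; rewrite dt raddf0 addr0 => ->.
Qed.
End LeftRelativelyProjective.

End BarOperators.
Arguments hoch {k S} bS Y n t.

(** * Two-sided bar complexes *)

Section TwoSidedBar.
Variables (k : fieldType) (S : kAlgType k) (bS : kbasis (kvs S)).
Local Notation Tn := (Tn bS).
Local Notation barD := (barD bS).
Local Notation Tmn := (Tmn bS).
Local Notation tc := (tc bS).
Variables (Y : lmod S) (bY : kbasis Y).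

(* X (x) S^n (x) Y *)
Definition Bn (X : rmod S) n : lmodType k := ot bY (Tn n X).

Section Differential.
Variable X : rmod S.

Definition bc n : bil (Tn n X) Y (Bn X n) := tp bY.

Lemma Bn_ext n (Z : lmodType k) (f g : {linear Bn X n -> Z}) :
  (forall w y, f (bc n w y) = g (bc n w y)) -> f =1 g.
Proof. exact: ot_ext. Qed.

Definition bstar n : bil (Tn n.+1 X) Y (Bn X n) := star bS bY (lact Y) (Tn n X).
Lemma bstar_tc n w a y : bstar n (tc w a) y = bc n w (lact Y a y).
Proof. exact: star_tp. Qed.

Lemma bstar_ract n (w : Tn n.+1 X) a y : bstar n (ract (Tn n.+1 X) w a) y = bstar n w (lact Y a y).
Proof.
pose R : {linear Tn n.+1 X -> Tn n.+1 X} := bil_flip (ract (Tn n.+1 X)) a.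
apply: (@Tn_ext _ _ _ _ _ _ (bil_flip (bstar n) y \o R) (bil_flip (bstar n) (lact Y a y))).
by move=> v b; rewrite /R /= /bil_flip ract_tc !bstar_tc lactM.
Qed.

(* w (x) y |-> w y - barD w (x) y *)
Definition dB n (t : Bn X n.+1) : Bn X n := tlift (bstar n) t - tmap bY (barD X n) t.
Fact dB_linear n : linear (@dB n).
Proof. exact: (linearP (tlift (bstar n) \- tmap bY (barD X n))). Qed.
HB.instance Definition _ n :=
  GRing.isLinear.Build k (Bn X n.+1) (Bn X n) *:%R (@dB n) (@dB_linear n).

Lemma dB_bc n w y : dB (bc n.+1 w y) = bstar n w y - bc n (barD X n w) y.
Proof. by rewrite /dB [tlift _ _]tlift_tp [tmap _ _ _]tmap_tp. Qed.

Lemma dB_sub n : {morph @dB n : x y / x - y}. Proof. exact: raddfB. Qed.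

Lemma dB_dB n (t : Bn X n.+2) : dB (dB t) = 0.
Proof.
apply: (@Bn_ext _ _ (@dB n \o @dB n.+1) \0) => w y.
rewrite /= dB_bc dB_sub dB_bc DD bil0l subr0; apply/eqP.
rewrite subr_eq0; apply/eqP.
pose F : {linear Tn n.+2 X -> Bn X n} := @dB n \o bil_flip (bstar n.+1) y.
pose G : {linear Tn n.+2 X -> Bn X n} := bil_flip (bstar n) y \o barD X n.+1.
apply: (@Tn_ext _ _ _ _ _ _ F G) => v b; rewrite /F /G /= /bil_flip.
by rewrite bstar_tc dB_bc DS_tc bilBl bstar_ract bstar_tc.
Qed.
End Differential.

Section Naturality.
Variables (X X' : rmod S) (f : {linear X -> X'}).

Definition Bmn n : Bn X n -> Bn X' n := tmap bY (Tmn f n).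
HB.instance Definition _ n :=
  GRing.isLinear.Build k (Bn X n) (Bn X' n) *:%R (@Bmn n) (linearP (tmap bY (Tmn f n))).

Lemma Bmn_bc n w y : Bmn (bc X n w y) = bc X' n (Tmn f n w) y.
Proof. exact: (@tmap_tp _ _ bY _ _ (Tmn f n)). Qed.

Lemma dB_Bmn n t : rlin f -> dB (@Bmn n.+1 t) = Bmn (dB t).
Proof.
move=> fR; apply: (@Bn_ext _ _ _ (@dB X' n \o @Bmn n.+1) (@Bmn n \o @dB X n)) => w y.
rewrite /= Bmn_bc !dB_bc raddfB /= Bmn_bc D_Tmn //; congr (_ - _).
pose F : {linear Tn n.+1 X -> Bn X' n} := bil_flip (bstar X' n) y \o Tmn f n.+1.
pose G : {linear Tn n.+1 X -> Bn X' n} := @Bmn n \o bil_flip (bstar X n) y.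
apply: (@Tn_ext _ _ _ _ _ _ F G) => v b; rewrite /F /G /= /bil_flip.
by rewrite Tmn_tc !bstar_tc Bmn_bc.
Qed.
End Naturality.

Lemma Bmn_inj (X X' : rmod S) (f : {linear X -> X'}) n (t : Bn X n) :
  (forall x, f x = 0 -> x = 0) -> Bmn f t = 0 -> t = 0.
Proof. by move=> f0; apply: (@tmap_inj _ _ bY _ _ (Tmn f n)) => w; apply: Tmn_inj. Qed.

Lemma Bmn0 (X X' : rmod S) (f : {linear X -> X'}) n (t : Bn X n) :
  (forall x, f x = 0) -> Bmn f t = 0.
Proof. by move=> f0; apply: (@tmap0 _ _ bY _ _ (Tmn f n)) => w; apply: Tmn0. Qed.

Lemma Bmn_surj (X X' : rmod S) (f : {linear X -> X'}) n (t : Bn X' n) :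
  (forall x, exists v, f v = x) -> exists s, Bmn f s = t.
Proof. by move=> f0; apply: (@tmap_surj _ _ bY _ _ (Tmn f n)) => w; apply: Tmn_surj. Qed.

Lemma Bmn_comp (X X' X'' : rmod S) (f : {linear X -> X'}) (g : {linear X' -> X''}) n (t : Bn X n) :
  Bmn g (Bmn f t) = Bmn (g \o f) t.
Proof.
apply/ffunP => j; rewrite !ffunE; exact: Tmn_comp.
Qed.

Lemma Bmn_exact (X X' X'' : rmod S) (f : {linear X -> X'}) (g : {linear X' -> X''}) n (t : Bn X' n) :
  (forall x, g x = 0 -> exists v, f v = x) -> Bmn g t = 0 -> exists s, Bmn f s = t.
Proof.
move=> f0; apply: (@tmap_exact _ _ bY _ _ _ (Tmn f n) (Tmn g n)) => w.
exact: Tmn_exact.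
Qed.

Section RightRelativelyProjective.
Variables (X : rmod S) (s : {linear X -> Tn 1 X}).
Hypothesis s_r : rlin (Y := Tn 1 X) s.
Hypothesis s_mul : forall x, barD X 0 (s x) = x.

(** [s] is a right linear section of X (x) S -> X, applied to the module at the front of the word;
    the alternating sign matches the recursion of [barD]. *)
Fixpoint right_homotopy n : Tn n X -> Tn n.+1 X :=
  match n return Tn n X -> Tn n.+1 X with
  | 0 => s
  | m.+1 => fun t => - tmap bS (@right_homotopy m) t
  end.
Arguments right_homotopy : simpl never.

Fact gr_linear n : linear (@right_homotopy n).
Proof.
elim: n => [|n IHn]; first exact: linearP.
pose Gn : {linear Tn n X -> Tn n.+1 X} :=
  HB.pack (@right_homotopy n) (GRing.isLinear.Build _ _ _ _ _ IHn).
exact: (linearP (\- tmap bS Gn)).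
Qed.
HB.instance Definition _ n :=
  GRing.isLinear.Build k (Tn n X) (Tn n.+1 X) *:%R (@right_homotopy n) (@gr_linear n).

Lemma gr_sub n : {morph @right_homotopy n : x y / x - y}. Proof. exact: raddfB. Qed.

Lemma gr_tc n w a : right_homotopy (tc w a) = - tc (@right_homotopy n w) a.
Proof. by congr (- _); apply: (@tmap_tp _ _ bS _ _ (@right_homotopy n)). Qed.

Lemma gr_r n : rlin (@right_homotopy n).
Proof.
case: n => [|n] w a; first exact: s_r.
pose R m : {linear Tn m.+1 X -> Tn m.+1 X} := bil_flip (ract (Tn m.+1 X)) a.
apply: (@Tn_ext _ _ _ _ _ _ (@right_homotopy n.+1 \o R n) (R n.+1 \o @right_homotopy n.+1)) => v b.
by rewrite /R /= /bil_flip ract_tc !gr_tc bilNl ract_tc.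
Qed.

Lemma D_gr n t : barD X n.+1 (@right_homotopy n.+1 t) + right_homotopy (barD X n t) = t.
Proof.
elim: n t => [|n IHn] t.
  apply: (@Tn_ext _ _ _ _ _ _ ((barD X 1 \o @right_homotopy 1) \+ (@right_homotopy 0 \o barD X 0)) idfun) => w a.
  by rewrite /= gr_tc raddfN /= DS_tc D0_tc gr_r opprB s_mul subrK.
apply: (@Tn_ext _ _ _ _ _ _ ((barD X n.+2 \o @right_homotopy n.+2) \+ (@right_homotopy n.+1 \o barD X n.+1)) idfun) => w a.
rewrite /= gr_tc raddfN /= !DS_tc gr_sub gr_r gr_tc opprK opprB addrA subrK.
by rewrite -bilDl IHn.
Qed.

Definition two_sided_homotopy n (t : Bn X n) : Bn X n.+1 := - tmap bY (@right_homotopy n) t.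
Fact Bgr_linear n : linear (@two_sided_homotopy n). Proof. exact: (linearP (\- tmap bY (@right_homotopy n))). Qed.
HB.instance Definition _ n :=
  GRing.isLinear.Build k (Bn X n) (Bn X n.+1) *:%R (@two_sided_homotopy n) (@Bgr_linear n).

Lemma Bgr_bc n w y : two_sided_homotopy (bc X n w y) = - bc X n.+1 (right_homotopy w) y.
Proof. by congr (- _); apply: (@tmap_tp _ _ bY _ _ (@right_homotopy n)). Qed.

Lemma Bgr_sub n : {morph @two_sided_homotopy n : x y / x - y}. Proof. exact: raddfB. Qed.

Lemma dB_Bgr n t : dB (@two_sided_homotopy n.+1 t) + two_sided_homotopy (dB t) = t.
Proof.
apply: (@Bn_ext _ _ _ ((@dB X _ \o @two_sided_homotopy n.+1) \+ (@two_sided_homotopy n \o @dB X n)) idfun) => w y.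
rewrite /= Bgr_bc raddfN /= !dB_bc Bgr_sub Bgr_bc opprK opprB.
rewrite [X in _ + X]addrC addrACA -bilDl D_gr.
pose F : {linear Tn n.+1 X -> Bn X n.+1} := @two_sided_homotopy n \o bil_flip (bstar X n) y.
pose G : {linear Tn n.+1 X -> Bn X n.+1} := bil_flip (bstar X n.+1) y \o @right_homotopy n.+1.
have -> : two_sided_homotopy (bstar X n w y) = bstar X n.+1 (right_homotopy w) y; last by rewrite addNr addr0.
apply: (@Tn_ext _ _ _ _ _ _ F G) => v b; rewrite /F /G /= /bil_flip.
by rewrite bstar_tc Bgr_bc gr_tc bilNl bstar_tc.
Qed.

Lemma dB_Bgr0 x y : dB (two_sided_homotopy (bc X 0 x y)) = bc X 0 x y - bstar X 0 (s x) y.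
Proof. by rewrite Bgr_bc raddfN /= dB_bc opprB s_mul. Qed.

Lemma dB_exactS n : exact_at (@dB X) n.+1.
Proof. by move=> t dt; exists (two_sided_homotopy t); rewrite -[RHS]dB_Bgr dt raddf0 addr0. Qed.

(** If [s x] is the sum of the x_i (x) a_i, then x (x) y is homologous to the sum of the x_i (x) a_i
    y. When these sums all vanish, so does X (x)_S Y, the homology in degree 0. *)
Lemma dB_exact0 : (forall x y, bstar X 0 (s x) y = 0) -> exact_at (@dB X) 0.
Proof.
move=> s0 t; exists (two_sided_homotopy t).
apply: (@Bn_ext _ _ _ (@dB X 0 \o @two_sided_homotopy 0) idfun) => x y.
by rewrite /= dB_Bgr0 s0 subr0.
Qed.
End RightRelativelyProjective.
End TwoSidedBar.

(** * Bar resolutions over enveloping algebras *)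

(** The dual basis lemma: f lifts to x |-> sum_i c_i(x) y_i for any preimages y_i of the f(u_i). *)
Lemma dual_basis_projective (R : pzRingType) (P : lmodType R) (I : finType)
    (u : I -> P) (c : I -> P -> R) :
  (forall i a x y, c i (a *: x + y) = a * c i x + c i y) ->
  (forall x, \sum_i c i x *: u i = x) -> projective P.
Proof.
move=> c_lin cu X Y g f g_surj.
pose y i := projT1 (cid (g_surj (f (u i)))).
have yP i : g (y i) = f (u i) := projT2 (cid (g_surj (f (u i)))).
have h_lin : linear (fun x => \sum_i c i x *: y i).
  move=> a v w; rewrite scaler_sumr -big_split /=; apply: eq_bigr => i _.
  by rewrite c_lin scalerDl scalerA.
pose h : {linear P -> X} := HB.pack (fun x => \sum_i c i x *: y i)
  (GRing.isLinear.Build _ _ _ _ _ h_lin).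
exists h => x; rewrite /= linear_sum -[in RHS](cu x) linear_sum.
by apply: eq_bigr => i _; rewrite !linearZ /= yP.
Qed.

Section EnvModule.
Variables (k : fieldType) (C : kAlgType k) (M : bimod C).

(* A C-bimodule as a right module over the enveloping algebra: m (a (x) b) = b m a *)
Definition envmod : Type := M.
HB.instance Definition _ := GRing.Zmodule.on envmod.

Definition env_scale (u : (env C)^c) (m : envmod) : envmod :=
  tensor_lift (fun (a : C) (b : C^c) => ract M (bilact M (b : kvs C) m) (a : kvs C)) (u : env C).

Fact env_scale_Bl m (b : C^c) :
  zmod_morphism (fun a : C => ract M (bilact M (b : kvs C) m) (a : kvs C)).
Proof. by move=> a a'; rewrite -bilBr. Qed.
Fact env_scale_Br m (a : C) :
  zmod_morphism (fun b : C^c => ract M (bilact M (b : kvs C) m) (a : kvs C)).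
Proof. by move=> b b'; rewrite -bilBl -[in RHS](bilBl (bilact M)). Qed.
Fact env_scale_S m (c : k) (a : C) (b : C^c) :
  ract M (bilact M (b : kvs C) m) (kmap C c * a : kvs C) =
  ract M (bilact M ((kmap C^c c * b : C^c) : kvs C) m) (a : kvs C).
Proof.
rewrite -[kmap C c * a]/(c *: (a : kvs C)) bilZr.
have -> : ((kmap C^c c * b : C^c) : kvs C) = c *: (b : kvs C) by exact: (esym (kmapC c (b : C))).
by rewrite bilZl bilZl.
Qed.

Lemma env_scaleE a b m : env_scale (etens a b) m = ract M (bilact M b m) a.
Proof.
by rewrite /env_scale tensor_lift_pure => // [?|?|*];
  [exact: env_scale_Bl|exact: env_scale_Br|exact: env_scale_S].
Qed.

Fact env_scaleBl m : zmod_morphism (env_scale^~ m).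
Proof.
by apply: tensor_liftB => [?|?|*];
  [exact: env_scale_Bl|exact: env_scale_Br|exact: env_scale_S].
Qed.

Fact env_scaleBr u : zmod_morphism (env_scale u).
Proof.
move=> x y; elim/etens_ind: u => [a b|u v IHu IHv].
  by rewrite !env_scaleE bilBr bilBl.
by rewrite !env_scaleBl IHu IHv !opprB addrACA [in RHS]addrACA [- _ + _]addrC.
Qed.

Fact env_scaleM (u v : (env C)^c) m : env_scale u (env_scale v m) = env_scale (u * v) m.
Proof.
rewrite -[(u * v : (env C)^c)]/((v : env C) * (u : env C)).
elim/etens_ind: u => [a b|u u' IHu IHu']; last by rewrite mulrBr !env_scaleBl IHu IHu'.
elim/etens_ind: v => [a' b'|v v' IHv IHv'].
  by rewrite etensM !env_scaleE bilactr bilactM ractM.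
by rewrite mulrBl !env_scaleBl env_scaleBr IHv IHv'.
Qed.

Fact env_scale1 m : env_scale 1 m = m.
Proof. by rewrite -[1]/(etens (1 : C) 1) env_scaleE bilact1 ract1. Qed.

HB.instance Definition _ := GRing.Zmodule_isLmodule.Build (env C)^c envmod
  env_scaleM env_scale1 (fun u => zmod_morphD (env_scaleBr u))
  (fun x => zmod_morphD (env_scaleBl x)).

Lemma env_scaler_etens a b (m : envmod) :
  (etens a b : (env C)^c) *: m = (ract M (bilact M b m) a : envmod).
Proof. exact: env_scaleE. Qed.
End EnvModule.

Section EnvLinear.
Variables (k : fieldType) (C : kAlgType k).

Lemma env_linear (M : bimod C) (N : lmodType (env C)^c) (f : envmod M -> N) :
  zmod_morphism f ->
  (forall a b (m : envmod M), f (ract M (bilact M b m) a) = (etens a b : (env C)^c) *: f m) ->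
  linear f.
Proof.
move=> fB fE u x y; rewrite (zmod_morphD fB); congr (_ + _).
elim/etens_ind: u => [a b|u v IHu IHv]; first by rewrite env_scaler_etens fE.
by rewrite !scalerBl fB IHu IHv.
Qed.
End EnvLinear.

Section EnvSpace.
Variables (k : fieldType) (C : kAlgType k).

(** The enveloping algebra as a vector space, so that functionals with values in it can be built
    with [tlift]. *)
Definition envk : Type := env C.
HB.instance Definition _ := GRing.PzRing.on envk.

Definition envk_scale (c : k) (u : envk) : envk := etens (kmap C c) 1 * u.
Fact envk_scaleA a b v : envk_scale a (envk_scale b v) = envk_scale (a * b) v.
Proof. by rewrite /envk_scale mulrA etensM rmorphM mulr1. Qed.
Fact envk_scale1 : left_id 1 envk_scale.
Proof. by move=> x; rewrite /envk_scale rmorph1 etens1 mul1r. Qed.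
Fact envk_scaleDr : right_distributive envk_scale +%R.
Proof. by move=> a x y; rewrite /envk_scale mulrDr. Qed.
Fact etensD1 (a b : C) : etens (a + b) 1 = etens a 1 + etens b 1.
Proof. exact: (zmod_morphD (@atensBl _ C C^c 1)). Qed.
Fact envk_scaleDl v : {morph envk_scale^~ v : a b / a + b}.
Proof. by move=> a b; rewrite /envk_scale rmorphD etensD1 mulrDl. Qed.
HB.instance Definition _ := GRing.Zmodule_isLmodule.Build k envk
  envk_scaleA envk_scale1 envk_scaleDr envk_scaleDl.

Lemma envk_scale_etens c a b : c *: (etens a b : envk) = etens (kmap C c * a) b.
Proof. by rewrite -[LHS]/(etens (kmap C c) 1 * etens a b) etensM mulr1. Qed.

Fact ete_l b : linear (fun a : kvs C => etens a b : envk).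
Proof.
move=> c x y; rewrite envk_scale_etens.
exact: (zmod_morphD (@atensBl _ C C^c b)).
Qed.
Fact ete_r a : linear (fun b : kvs C => etens a b : envk).
Proof.
move=> c x y; rewrite envk_scale_etens [etens (kmap C c * a) x](@atensZ _ C C^c).
rewrite -[RHS](zmod_morphD (@atensBr _ C C^c a)); congr (atens _ (_ + _)).
refine (kmapC c (x : C)).
Qed.
Definition ete : bil (kvs C) (kvs C) envk := @Bil k (kvs C) (kvs C) envk (fun a b => etens a b) ete_l ete_r.
End EnvSpace.

(* For an algebra morphism p : S -> C such that the two-sided bar complex      *)
(* B(C, S, C) is exact, B(C, S, C) is a projective resolution of C over the    *)
(* enveloping algebra of C, so that HH_*(C) is the Hochschild homology of S    *)
(* with coefficients in C.                                                     *)
Section RelativeBar.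
Variables (k : fieldType) (S C : kAlgType k) (bS : kbasis (kvs S)) (bC : kbasis (kvs C)).
Variable p : {linear kvs S -> kvs C}.
Hypothesis pM : {morph p : x y / x * y}.
Hypothesis p1 : p 1 = 1.

Fact pull_ract_l (a : kvs S) : linear (fun x : kvs C => x * p a).
Proof. exact: (linearP (bil_flip (kmul C) (p a))). Qed.
Fact pull_ract_r (x : kvs C) : linear (fun a : kvs S => x * p a).
Proof. exact: (linearP (kmul C x \o p)). Qed.
Definition pull_ract : bil (kvs C) (kvs S) (kvs C) := Bil pull_ract_l pull_ract_r.
Definition pull_lact : bil (kvs S) (kvs C) (kvs C) :=
  @Bil k (kvs S) (kvs C) (kvs C) (fun a x => p a * x)
    (fun x => linearP (bil_flip (kmul C) x \o p)) (fun a => linearP (kmul C (p a))).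

Fact pull_ractM (x : kvs C) a b : pull_ract (pull_ract x a) b = pull_ract x (a * b).
Proof. by rewrite /pull_ract /bil_fun pM mulrA. Qed.
Fact pull_ract1 (x : kvs C) : pull_ract x 1 = x.
Proof. by rewrite /pull_ract /bil_fun p1 mulr1. Qed.
Fact pull_lactM (x : kvs C) a b : pull_lact a (pull_lact b x) = pull_lact (a * b) x.
Proof. by rewrite /pull_lact /bil_fun pM mulrA. Qed.
Fact pull_lact1 (x : kvs C) : pull_lact 1 x = x.
Proof. by rewrite /pull_lact /bil_fun p1 mul1r. Qed.
Fact pull_lactr (x : kvs C) a b : pull_lact a (pull_ract x b) = pull_ract (pull_lact a x) b.
Proof. by rewrite /pull_lact /pull_ract /bil_fun mulrA. Qed.

Definition pullR : rmod S := RMod pull_ractM pull_ract1.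
Definition pullL : lmod S := LMod pull_lactM pull_lact1.
Definition pullB : bimod S := @BiMod _ _ pullR pull_lact pull_lactM pull_lact1 pull_lactr.

Local Notation Tn := (Tn bS).
Local Notation T n := (Tn n pullR).
Local Notation tc := (tc bS).
Local Notation barD := (barD bS pullR).
Local Notation B := (@Bn k S bS pullL bC pullR).
Local Notation bc := (@bc k S bS pullL bC pullR).
Local Notation dB n := (@dB k S bS pullL bC pullR n).
Local Notation bstar := (@bstar k S bS pullL bC pullR).

Definition lC n : bil (kvs C) (T n) (T n) :=
  @bTn k S bS pullR pullR (kvs C) (kmul C) n.

Lemma lCM n a b w : lC n a (lC n b w) = lC n (a * b) w.
Proof. by rewrite !bTnE Tmn_comp; apply: Tmn_eq => x /=; rewrite !kmulE mulrA. Qed.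
Lemma lC1 n w : lC n 1 w = w.
Proof. by rewrite bTnE Tmn_id // => x; rewrite kmulE mul1r. Qed.
Lemma lC_tc n b w a : lC n.+1 b (tc w a) = tc (lC n b w) a.
Proof. exact: (@Tmn_tc k S bS pullR pullR (kmul C b) n w a). Qed.
Lemma lC_rlin b : rlin (X := pullR) (Y := pullR) (kmul C b).
Proof. by move=> x a; rewrite !kmulE /ract /= /bil_fun /= mulrA. Qed.
Lemma D_lC n b w : barD n (lC n.+1 b w) = lC n b (barD n w).
Proof. exact: (@D_Tmn k S bS pullR pullR (kmul C b) n w (@lC_rlin b)). Qed.

Definition bL n : bil (kvs C) (B n) (B n) := btmap bC (lC n).
Definition bR n : bil (B n) (kvs C) (B n) := star bC bC (kmul C) (T n).
Lemma bL_bc n b w y : bL n b (bc n w y) = bc n (lC n b w) y.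
Proof. exact: btmap_tp. Qed.
Lemma bR_bc n a w y : bR n (bc n w y) a = bc n w (y * a).
Proof. exact: star_tp. Qed.

Fact bRM n x a b : bR n (bR n x a) b = bR n x (a * b).
Proof.
apply: (@Bn_ext _ _ _ _ _ _ _ _ (bil_flip (bR n) b \o bil_flip (bR n) a) (bil_flip (bR n) (a * b))).
by move=> w y; rewrite /= /bil_flip !bR_bc mulrA.
Qed.
Fact bR1 n x : bR n x 1 = x.
Proof.
apply: (@Bn_ext _ _ _ _ _ _ _ _ (bil_flip (bR n) 1) idfun).
by move=> w y; rewrite /= /bil_flip !bR_bc mulr1.
Qed.
Fact bLM n x a b : bL n a (bL n b x) = bL n (a * b) x.
Proof.
apply: (@Bn_ext _ _ _ _ _ _ _ _ (bL n a \o bL n b) (bL n (a * b))).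
by move=> w y; rewrite /= !bL_bc lCM.
Qed.
Fact bL1 n x : bL n 1 x = x.
Proof.
apply: (@Bn_ext _ _ _ _ _ _ _ _ (bL n 1) idfun).
by move=> w y; rewrite /= !bL_bc lC1.
Qed.
Fact bLR n x a b : bL n a (bR n x b) = bR n (bL n a x) b.
Proof.
apply: (@Bn_ext _ _ _ _ _ _ _ _ (bL n a \o bil_flip (bR n) b) (bil_flip (bR n) b \o bL n a)).
by move=> w y; rewrite /= /bil_flip !(bL_bc, bR_bc).
Qed.

Definition BR n : rmod C := RMod (@bRM n) (@bR1 n).
Definition BB n : bimod C := @BiMod _ _ (BR n) (bL n) (@bLM n) (@bL1 n) (@bLR n).
Definition barQ n : lmodType (env C)^c := envmod (BB n).

Lemma bstar_lC n b w y : bstar n (lC n.+1 b w) y = bL n b (bstar n w y).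
Proof.
pose F : {linear T n.+1 -> B n} := bil_flip (bstar n) y \o lC n.+1 b.
pose G : {linear T n.+1 -> B n} := bL n b \o bil_flip (bstar n) y.
apply: (@Tn_ext _ _ _ _ _ _ F G) => v a; rewrite /F /G /= /bil_flip.
by rewrite lC_tc !bstar_tc bL_bc.
Qed.

Lemma bstar_bR n w y a : bstar n w (y * a) = bR n (bstar n w y) a.
Proof.
pose F : {linear T n.+1 -> B n} := bil_flip (bstar n) (y * a).
pose G : {linear T n.+1 -> B n} := bil_flip (bR n) a \o bil_flip (bstar n) y.
apply: (@Tn_ext _ _ _ _ _ _ F G) => v b; rewrite /F /G /= /bil_flip.
by rewrite !bstar_tc bR_bc; congr (bc _ _ _); apply: mulrA.
Qed.

Lemma dB_bimod n b a t : dB n (bR n.+1 (bL n.+1 b t) a) = bR n (bL n b (dB n t)) a.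
Proof.
pose R m : {linear B m -> B m} := bil_flip (bR m) a.
apply: (@Bn_ext _ _ _ _ _ _ _ _ (dB n \o R n.+1 \o bL n.+1 b) (R n \o bL n b \o dB n)).
move=> w y; rewrite /R /= /bil_flip bL_bc bR_bc !dB_bc !bilBr !bilBl bL_bc bR_bc.
by rewrite bstar_bR bstar_lC D_lC.
Qed.

Fact dQ_linear n : linear (dB n : barQ n.+1 -> barQ n).
Proof.
apply: (@env_linear _ _ (BB n.+1) (barQ n)) => [|a b m]; first exact: raddfB.
by rewrite env_scaler_etens; apply: dB_bimod.
Qed.
Definition dQ n : {linear barQ n.+1 -> barQ n} :=
  HB.pack (dB n : barQ n.+1 -> barQ n) (GRing.isLinear.Build _ _ _ _ _ (@dQ_linear n)).

Definition augB : {linear B 0 -> kvs C} := tlift (kmul C).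
Lemma augB_bc x y : augB (bc 0 x y) = x * y. Proof. exact: tlift_tp. Qed.

Fact augQ_linear : linear (augB : barQ 0 -> env_right C).
Proof.
apply: (@env_linear _ _ (BB 0) (env_right C)) => [|a b m]; first exact: (raddfB augB).
rewrite -[RHS]/(env_ract (etens a b) (augB m)) env_ractE.
pose F : {linear B 0 -> kvs C} := augB \o bil_flip (bR 0) a \o bL 0 b.
pose G : {linear B 0 -> kvs C} := bil_flip (kmul C) a \o kmul C b \o augB.
apply: (@Bn_ext _ _ _ _ _ _ _ _ F G) => x y; rewrite /F /G /= /bil_flip.
by rewrite bL_bc bR_bc !augB_bc !kmulE !mulrA.
Qed.
Definition augQ : {linear barQ 0 -> env_right C} :=
  HB.pack (augB : barQ 0 -> env_right C) (GRing.isLinear.Build _ _ _ _ _ augQ_linear).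

(** C (x) S^n is free over C on the left; a basis is given by the words of basis vectors of S with 1
    in front. *)
Lemma left_dual_basis n : exists (I : finType) (u : I -> T n) (c : I -> {linear T n -> kvs C}),
  (forall i b w, c i (lC n b w) = b * c i w) /\ (forall w, \sum_i lC n (c i w) (u i) = w).
Proof.
elim: n => [|n [I [u [c [cL cu]]]]].
  exists unit, (fun=> 1), (fun=> idfun); split=> // w.
  by rewrite big_const card_unit /= addr0 bTnE -[Tmn _ _ _ _]/(w * 1) mulr1.
pose c' (ij : I * 'I_(bdim bS)) (t : T n.+1) : kvs C := c ij.1 ((t : ot bS (T n)) ij.2).
have c'L ij : linear (c' ij).
  by move=> a x y; rewrite /c' -linearP; congr (c _ _); rewrite !ffunE.
pose c'' ij : {linear T n.+1 -> kvs C} :=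
  HB.pack (c' ij) (GRing.isLinear.Build _ _ _ _ _ (c'L ij)).
exists (I * 'I_(bdim bS))%type, (fun ij => tc (u ij.1) (bS ij.2)), c''.
split=> [ij b w|w] /=.
  rewrite /c' -cL; congr (c _ _).
  by rewrite -[lC n.+1 b w]/(tmap bS (lC n b) w) ffunE.
rewrite -(pair_bigA _ (fun i j => lC n.+1 (c' (i, j) w) (tc (u i) (bS j)))) /=.
rewrite exchange_big /= [RHS](@ot_sum _ _ bS _ w); apply: eq_bigr => j _.
under eq_bigr do rewrite lC_tc.
transitivity (tc (\sum_i lC n (c i ((w : ot bS (T n)) j)) (u i)) (bS j)); last by rewrite cu.
by rewrite bil_suml.
Qed.

(** A dual basis over the enveloping algebra consists of the vectors u_i (x) 1 and the functionals w
    (x) y |-> y (x) c_i(w), where u_i and c_i are a left dual basis of C (x) S^n. *)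
Lemma Q_projective n : projective (barQ n).
Proof.
have [I [u [c [cL cu]]]] := left_dual_basis n.
pose phi i : bil (T n) (kvs C) (envk C) := @Bil _ _ _ _ (fun w y => ete C y (c i w))
  (fun y => linearP (ete C y \o c i)) (fun w => linearP (bil_flip (ete C) (c i w))).
pose E i : {linear B n -> envk C} := tlift (phi i).
have E_bc i w y : E i (bc n w y) = ete C y (c i w) by apply: tlift_tp.
apply: (@dual_basis_projective _ (barQ n) _ (fun i => bc n (u i) 1 : barQ n)
  (fun i t => E i t : (env C)^c)) => [i a x y|t].
  apply: (@env_linear _ _ (BB n) (env C)^c^o (E i)) => [|a' b m]; first exact: (raddfB (E i)).
  rewrite -[RHS]/(E i m * etens a' b).
  have mul_lin : linear (fun v : envk C => v * (etens a' b : envk C)).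
    by move=> d v v'; rewrite mulrDl -[d *: v]/(etens (kmap C d) 1 * v) -mulrA.
  pose F : {linear B n -> envk C} := E i \o bil_flip (bR n) a' \o bL n b.
  pose mul : {linear envk C -> envk C} := HB.pack
    (fun v : envk C => v * (etens a' b : envk C)) (GRing.isLinear.Build _ _ _ _ _ mul_lin).
  pose G : {linear B n -> envk C} := mul \o E i.
  apply: (@Bn_ext _ _ _ _ _ _ _ _ F G) => w z; rewrite /F /G /= /bil_flip.
  by rewrite bL_bc bR_bc !E_bc cL; apply: esym; apply: etensM.
have Esum i : (E i t : (env C)^c) *: (bc n (u i) 1 : barQ n) =
    \sum_j bc n (lC n (c i ((t : ot _ _) j)) (u i)) (bC j).
  rewrite -[E i t]/(\sum_j ete C (bC j) (c i ((t : ot _ _) j))).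
  rewrite [LHS]scaler_suml; apply: eq_bigr => j _.
  rewrite [LHS]env_scaleE -[LHS]/(bR n (bL n (c i _) _) (bC j)) bL_bc bR_bc.
  by congr (bc _ _ _); apply: mul1r.
under eq_bigr do rewrite Esum.
rewrite exchange_big /= [RHS](@ot_sum _ _ bC _ t); apply: eq_bigr => j _.
by rewrite -[LHS]bil_suml cu.
Qed.


Lemma augB_dB t : augB (dB 0 t) = 0.
Proof.
apply: (@Bn_ext _ _ _ _ _ _ _ _ (augB \o dB 0) \0) => w y.
rewrite /= dB_bc raddfB /=.
pose F : {linear T 1 -> kvs C} := augB \o bil_flip (bstar 0) y.
pose G : {linear T 1 -> kvs C} := augB \o bil_flip (bc 0) y \o barD 0.
suff -> : augB (bstar 0 w y) = augB (bc 0 (barD 0 w) y) by rewrite subrr.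
apply: (@Tn_ext _ _ _ _ _ _ F G) => x a; rewrite /F /G /= /bil_flip.
by rewrite bstar_tc D0_tc !augB_bc; apply: mulrA.
Qed.

Hypothesis p_surj : forall c, exists a, p a = c.
Hypothesis exB : forall n, exact_at (fun n => dB n) n.+1.

(** The boundary of x (x) a (x) 1 is x (x) p(a) - x p(a) (x) 1, and surjectivity of [p] lets p(a) be
    any basis vector of C. This yields exactness at C (x) C, the degree that [exB] leaves out. *)
Lemma dB_contract0 t : exists u, dB 0 u = t - bc 0 (augB t : T 0) 1.
Proof.
pose a j := projT1 (cid (p_surj (bC j))).
have aP j : p (a j) = bC j := projT2 (cid (p_surj (bC j))).
exists (\sum_j bc 1 (tc ((t : ot _ _) j : T 0) (a j)) 1).
rewrite raddf_sum /= {2}(@ot_sum _ _ bC _ t) -[augB t]/(\sum_j (t : ot _ _) j * bC j).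
rewrite bil_suml -sumrB; apply: eq_bigr => j _.
rewrite dB_bc bstar_tc D0_tc.
rewrite -[lact _ _ _]/(p (a j) * 1) -[ract _ _ _]/((t : ot _ _) j * p (a j)).
by rewrite mulr1 aP.
Qed.

Fact aug_surj (c : env_right C) : exists x, augQ x = c.
Proof. by exists (bc 0 (c : T 0) 1); rewrite -[LHS]/(augB _) augB_bc mulr1. Qed.

Fact Q_exact0 (x : barQ 0) : augQ x = 0 <-> exists y, dQ 0 y = x.
Proof.
split=> [x0|[y <-]]; last exact: augB_dB.
have [u du] := dB_contract0 x; exists u; rewrite -[LHS]/(dB 0 u) du.
by rewrite (x0 : augB x = 0) bil0l subr0.
Qed.

Fact Q_exactS n (x : barQ n.+1) : dQ n x = 0 <-> exists y, dQ n.+1 y = x.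
Proof. by split=> [/exB //|[y <-]]; apply: dB_dB. Qed.

Definition bar_resolution : proj_resolution (env_right C) :=
  ProjResolution Q_projective aug_surj Q_exact0 Q_exactS.

Local Notation QC n := (@tensor_mod (env C) (barQ n) (env_left C)).
Local Notation hoch := (hoch bS pullB).

(* (w (x) y) (x) z |-> (y z) w *)
Definition wrap_bil n (z : kvs C) : bil (T n) (kvs C) (T n) :=
  @Bil k (T n) (kvs C) (T n) (fun w y => lC n (y * z) w)
    (fun y => linearP (lC n (y * z)))
    (fun w => linearP (bil_flip (lC n) w \o bil_flip (kmul C) z)).
Definition wrap_fun n (t : barQ n) (z : env_left C) : T n := tlift (wrap_bil n z) t.
Lemma wrap_fun_bc n w y z : wrap_fun (bc n w y : barQ n) z = lC n (y * z) w.
Proof. exact: tlift_tp. Qed.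

Fact wrap_Bl n z : zmod_morphism (fun t : barQ n => wrap_fun t z).
Proof. exact: (raddfB (tlift (wrap_bil n z))). Qed.
Fact wrap_Br n (t : barQ n) : zmod_morphism (wrap_fun t).
Proof.
move=> z z'; rewrite /wrap_fun /tlift -sumrB; apply: eq_bigr => j _.
by rewrite -[LHS]/(lC n (bC j * (z - z')) _) mulrBr bilBl.
Qed.
Fact wrap_S n (u : env C) (t : barQ n) z :
  wrap_fun ((u : (env C)^c) *: t) z = wrap_fun t (u *: z).
Proof.
elim/etens_ind: u => [a b|u v IHu IHv]; last first.
  by rewrite !scalerBl wrap_Bl IHu IHv wrap_Br.
rewrite env_scaler_etens -[etens a b *: z]/(env_lact (etens a b) z) env_lactE.
pose F : {linear B n -> T n} := tlift (wrap_bil n z) \o bil_flip (bR n) a \o bL n b.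
apply: (@Bn_ext _ _ _ _ _ _ _ _ F (tlift (wrap_bil n (a * z * b)))) => w y.
rewrite /F /= /bil_flip bL_bc bR_bc.
rewrite -[LHS]/(wrap_fun (_ : barQ n) z) wrap_fun_bc lCM.
by rewrite -[RHS]/(wrap_fun (_ : barQ n) _) wrap_fun_bc !mulrA.
Qed.

Definition wrap n : QC n -> T n := tensor_lift (@wrap_fun n).
Lemma wrap_tens n t z : wrap (tens t z : QC n) = wrap_fun t z.
Proof.
by rewrite /wrap [LHS]tensor_lift_pure => // [?|?|*];
  [exact: wrap_Bl|exact: wrap_Br|exact: wrap_S].
Qed.
Fact wrapB n : zmod_morphism (@wrap n).
Proof.
by apply: tensor_liftB => [?|?|*]; [exact: wrap_Bl|exact: wrap_Br|exact: wrap_S].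
Qed.
HB.instance Definition _ n := GRing.isZmodMorphism.Build (QC n) (T n) (@wrap n) (@wrapB n).

Definition unwrap n (w : T n) : QC n := tens (bc n w 1 : barQ n) ((1 : C) : env_left C).
Fact unwrapB n : zmod_morphism (@unwrap n).
Proof. by move=> w w'; rewrite /unwrap bilBl tensBl. Qed.
HB.instance Definition _ n := GRing.isZmodMorphism.Build (T n) (QC n) (@unwrap n) (@unwrapB n).

Lemma unwrapK n w : wrap (@unwrap n w) = w.
Proof. by rewrite /unwrap wrap_tens wrap_fun_bc mulr1 lC1. Qed.

Lemma QC_ext n (Z : zmodType) (f g : {additive QC n -> Z}) :
  (forall w y z, f (tens (bc n w y : barQ n) z) = g (tens (bc n w y : barQ n) z)) -> f =1 g.
Proof.
move=> fg; apply: tens_ext => t z; rewrite (@ot_sum _ _ bC _ t).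
have tsum (I : Type) (r : seq I) (F : I -> barQ n) :
    tens (\sum_(i <- r) F i : barQ n) z = \sum_(i <- r) (tens (F i) z : QC n).
  by elim/big_rec2: _ => [|i x y _ <-];
    rewrite ?(zmod_morphD (tensBl _)) // -[0 in LHS](subrr 0) tensBl subrr.
by rewrite tsum !raddf_sum; apply: eq_bigr => j _; apply: fg.
Qed.

Lemma wrapK n t : unwrap (@wrap n t) = t.
Proof.
apply: (@QC_ext _ _ (@unwrap n \o @wrap n) idfun) => w y z /=.
rewrite wrap_tens wrap_fun_bc /unwrap.
have -> : (bc n (lC n (y * z) w) 1 : barQ n) =
    (etens (1 : C) (y * z : C) : (env C)^c) *: (bc n w 1 : barQ n).
  by rewrite env_scaler_etens [bilact _ _ _]bL_bc [ract _ _ _]bR_bc mulr1.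
rewrite tensZ -[etens _ _ *: _]/(env_lact (etens _ _) (1 : C)) env_lactE !mul1r.
have -> : (bc n w y : barQ n) = (etens (y : C) (1 : C) : (env C)^c) *: (bc n w 1 : barQ n).
  by rewrite env_scaler_etens [bilact _ _ _]bL_bc [ract _ _ _]bR_bc mul1r lC1.
by rewrite tensZ -[etens _ _ *: _]/(env_lact (etens _ _) (z : C)) env_lactE mulr1.
Qed.

(** Closing the word into a circle turns the last bar face, which multiplies a into y, into the
    cyclic face of the Hochschild differential. *)
Lemma wrap_dQ n x : wrap (tensor_map (env_left C) (dQ n) x) = - hoch n (wrap x).
Proof.
apply: (@QC_ext _ _ (@wrap n \o tensor_map _ (dQ n)) (\- (hoch n \o @wrap n.+1))) => w y z.
rewrite /= tensor_mapE !wrap_tens wrap_fun_bc.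
rewrite -[dQ n _]/(dB n _) dB_bc wrap_Bl wrap_fun_bc /hoch opprB D_lC; congr (_ - _).
pose F : {linear T n.+1 -> T n} := tlift (wrap_bil n z) \o bil_flip (bstar n) y.
pose G : {linear T n.+1 -> T n} := @twist _ _ bS pullB n \o lC n.+1 (y * z).
apply: (@Tn_ext _ _ _ _ _ _ F G) => v a; rewrite /F /G /= /bil_flip.
rewrite bstar_tc -[LHS]/(wrap_fun (bc _ _ _ : barQ n) z) wrap_fun_bc lC_tc tw_tc.
rewrite -[Tmn _ _ _ _]/(lC n (p a) (lC n (y * z) v)) lCM.
by rewrite -[lact _ _ _]/(p a * y) mulrA.
Qed.

Lemma homology_hoch n :
  homology_vanishes (env_left C) bar_resolution n <-> exact_at hoch n.
Proof.
have -> : homology_vanishes (env_left C) bar_resolution n =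
    exact_at (fun n => tensor_map (env_left C) (dQ n)) n by case: n.
split; [apply: (exact_retract (i := unwrap) (r := wrap))
       |apply: (exact_retract (i := wrap) (r := unwrap))].
- by move=> m x dx; rewrite -[LHS]wrapK wrap_dQ unwrapK dx oppr0 raddf0.
- by move=> m y; exists (- wrap y); rewrite wrap_dQ raddfN.
- exact: unwrapK.
- by move=> m x dx; apply: oppr_inj; rewrite -wrap_dQ dx raddf0 oppr0.
- move=> m y; exists (- unwrap y); rewrite -[RHS]wrapK wrap_dQ !raddfN /= opprK.
  by rewrite unwrapK.
- exact: wrapK.
Qed.

(** Tensoring [bar_resolution] with C over the enveloping algebra of C gives the Hochschild complex
    of S with coefficients in C. *)
Lemma HH_hoch n : HH_vanishes C n <-> exact_at hoch n.
Proof.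
rewrite -homology_hoch; split=> [/(_ bar_resolution)//|].
exact: Tor_vanishes_res.
Qed.
End RelativeBar.

(** * One-sided bar resolutions and Tor *)

Section Spanned.
Variable k : fieldType.

Lemma spanned_fin (V : lmodType k) (I : finType) (b : I -> V) :
  (forall x, exists c : I -> k, x = \sum_i c i *: b i) -> spanned V.
Proof.
move=> bP; exists #|I|, (fun i => b (enum_val i)) => x.
have [c ->] := bP x; exists (fun i => c (enum_val i)).
by rewrite (reindex _ (onW_bij _ (@enum_val_bij I))).
Qed.

Lemma spanned_ot (U V : lmodType k) (bU : kbasis U) : spanned V -> spanned (ot bU V).
Proof.
move=> [n [b bP]]; apply: (@spanned_fin _ _ (fun ij => tp bU (b ij.1) (bU ij.2))) => t.
pose c j := projT1 (cid (bP (t j))).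
have cP j : t j = \sum_i c j i *: b i := projT2 (cid (bP (t j))).
exists (fun ij => c ij.2 ij.1).
rewrite -(pair_bigA _ (fun i j => c j i *: tp bU (b i) (bU j))) /= exchange_big /=.
rewrite [LHS](ot_sum t); apply: eq_bigr => j _; rewrite cP bil_suml.
by apply: eq_bigr => i _; rewrite bilZl.
Qed.

Lemma spanned_onto (U V : lmodType k) (f : {linear U -> V}) :
  (forall v, exists u, f u = v) -> spanned U -> spanned V.
Proof.
move=> f_surj [n [b bP]]; exists n, (fun i => f (b i)) => v.
have [u <-] := f_surj v; have [c ->] := bP u; exists c.
by rewrite linear_sum; apply: eq_bigr => i _; rewrite linearZ_LR.
Qed.
End Spanned.

Section ModuleOver.
Variables (k : fieldType) (S : kAlgType k).

Lemma ract_kmap (X : rmod S) x c : ract X x (kmap S c : kvs S) = c *: x.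
Proof. by rewrite -[kmap S c : kvs S]mulr1 -[_ * _]/(c *: (1 : kvs S)) bilZr ract1. Qed.

Section OfRight.
Variable M : lmodType S^c.
Definition krmod : Type := M.
HB.instance Definition _ := GRing.Zmodule.on krmod.
Definition krmod_scale (c : k) (m : krmod) : krmod := (kmap S c : S^c) *: (m : M).
Fact krmod_scaleA a b v : krmod_scale a (krmod_scale b v) = krmod_scale (a * b) v.
Proof.
rewrite /krmod_scale scalerA; congr (_ *: _).
by rewrite -[LHS]/((kmap S b : S) * (kmap S a : S)) -rmorphM [b * a]mulrC.
Qed.
Fact krmod_scale1 : left_id 1 krmod_scale.
Proof. by move=> x; rewrite /krmod_scale rmorph1 -[RHS](scale1r (x : M)). Qed.
Fact krmod_scaleDr : right_distributive krmod_scale +%R.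
Proof. by move=> a x y; rewrite /krmod_scale -scalerDr. Qed.
Fact krmod_scaleDl v : {morph krmod_scale^~ v : a b / a + b}.
Proof. by move=> a b; rewrite /krmod_scale rmorphD -[RHS](scalerDl (v : M)). Qed.
HB.instance Definition _ := GRing.Zmodule_isLmodule.Build k krmod
  krmod_scaleA krmod_scale1 krmod_scaleDr krmod_scaleDl.

Definition krmod_act_fun (m : krmod) (a : kvs S) : krmod := (a : S^c) *: (m : M).
Fact krmod_act_l a : linear (krmod_act_fun^~ a).
Proof.
move=> c x y; rewrite /krmod_act_fun scalerDr; congr (_ + _).
apply: etrans (scalerA (a : S^c) (kmap S c : S^c) (x : M)) _.
apply: etrans _ (esym (scalerA (kmap S c : S^c) (a : S^c) (x : M))).
exact: (congr1 (fun u : S^c => u *: (x : M)) (kmapC c (a : S))).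
Qed.
Fact krmod_act_r m : linear (krmod_act_fun m).
Proof.
move=> c a b; rewrite /krmod_act_fun -[LHS]/(((c *: a + b : kvs S) : S^c) *: (m : M)).
rewrite -[RHS]/((kmap S c : S^c) *: ((a : S^c) *: (m : M)) + (b : S^c) *: (m : M)).
rewrite scalerA -scalerDl.
exact: (congr1 (fun u : S^c => (u + (b : S^c)) *: (m : M)) (kmapC c (a : S))).
Qed.
Definition krmod_act : bil krmod (kvs S) krmod := Bil krmod_act_l krmod_act_r.
Fact krmod_actM x a b : krmod_act (krmod_act x a) b = krmod_act x (a * b).
Proof. exact: (scalerA (b : S^c) (a : S^c) (x : M)). Qed.
Fact krmod_act1 x : krmod_act x 1 = x.
Proof. exact: (scale1r (x : M)). Qed.
Definition rmod_of : rmod S := RMod krmod_actM krmod_act1.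
End OfRight.

Section OfLeft.
Variable N : lmodType S.
Definition klmod : Type := N.
HB.instance Definition _ := GRing.Zmodule.on klmod.
Definition klmod_scale (c : k) (m : klmod) : klmod := kmap S c *: (m : N).
Fact klmod_scaleA a b v : klmod_scale a (klmod_scale b v) = klmod_scale (a * b) v.
Proof. by rewrite /klmod_scale scalerA -rmorphM. Qed.
Fact klmod_scale1 : left_id 1 klmod_scale.
Proof. by move=> x; rewrite /klmod_scale rmorph1 scale1r. Qed.
Fact klmod_scaleDr : right_distributive klmod_scale +%R.
Proof. by move=> a x y; rewrite /klmod_scale scalerDr. Qed.
Fact klmod_scaleDl v : {morph klmod_scale^~ v : a b / a + b}.
Proof. by move=> a b; rewrite /klmod_scale rmorphD scalerDl. Qed.
HB.instance Definition _ := GRing.Zmodule_isLmodule.Build k klmod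
  klmod_scaleA klmod_scale1 klmod_scaleDr klmod_scaleDl.

Definition klmod_act_fun (a : kvs S) (m : klmod) : klmod := (a : S) *: (m : N).
Fact klmod_act_l m : linear (klmod_act_fun^~ m).
Proof.
move=> c a b; rewrite /klmod_act_fun -[LHS]/((kmap S c * (a : S) + (b : S)) *: (m : N)).
by rewrite scalerDl -scalerA.
Qed.
Fact klmod_act_r a : linear (klmod_act_fun a).
Proof.
move=> c x y; rewrite /klmod_act_fun -[LHS]/((a : S) *: (kmap S c *: (x : N) + (y : N))).
by rewrite scalerDr scalerA -kmapC -scalerA.
Qed.
Definition klmod_act : bil (kvs S) klmod klmod := Bil klmod_act_l klmod_act_r.
Fact klmod_actM x a b : klmod_act a (klmod_act b x) = klmod_act (a * b) x.
Proof. exact: (scalerA (a : S) (b : S) (x : N)). Qed.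
Fact klmod_act1 x : klmod_act 1 x = x.
Proof. exact: (scale1r (x : N)). Qed.
Definition lmod_of : lmod S := LMod klmod_actM klmod_act1.
End OfLeft.

Section Opposite.
Variable X : rmod S.
Definition opmod : Type := X.
HB.instance Definition _ := GRing.Zmodule.on opmod.
Definition opmod_scale (a : S^c) (x : opmod) : opmod := ract X x (a : kvs S).
Fact opmod_scaleA a b v : opmod_scale a (opmod_scale b v) = opmod_scale (a * b) v.
Proof. by rewrite /opmod_scale ractM. Qed.
Fact opmod_scale1 : left_id 1 opmod_scale.
Proof. by move=> x; rewrite /opmod_scale; apply: ract1. Qed.
Fact opmod_scaleDr : right_distributive opmod_scale +%R.
Proof. by move=> a x y; rewrite /opmod_scale -bilDl. Qed.
Fact opmod_scaleDl v : {morph opmod_scale^~ v : a b / a + b}.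
Proof. by move=> a b; rewrite /opmod_scale -bilDr. Qed.
HB.instance Definition _ := GRing.Zmodule_isLmodule.Build S^c opmod
  opmod_scaleA opmod_scale1 opmod_scaleDr opmod_scaleDl.
End Opposite.

Variable bS : kbasis (kvs S).

(** The vectors w_i (x) 1, for a basis w_i of W, have the dual functionals w (x) a |-> c_i(w) a. *)
Lemma free_projective (W : lmodType k) : spanned W -> projective (opmod (free bS W)).
Proof.
case/spanned_basis => bW.
pose phi i : bil W (kvs S) (kvs S) := @Bil k _ _ _ (fun w a => bco bW i w *: a)
  (fun a => linearP (bil_flip (@Bil k k^o (kvs S) (kvs S) (fun c a => c *: a)
     (fun a c x y => etrans (scalerDl _ _ _) (congr1 (+%R^~ _) (esym (scalerA _ _ _))))
     (fun c => linearP (c \*: idfun))) a \o bco bW i))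
  (fun w => linearP (bco bW i w \*: idfun)).
pose c i : {linear ot bS W -> kvs S} := tlift (phi i).
have c_tp i w a : c i (tp bS w a) = bco bW i w *: a by apply: tlift_tp.
apply: (@dual_basis_projective _ (opmod (free bS W)) _ (fun i => tp bS (bW i) 1)
  (fun i t => c i t : S^c)) => [i a x y|t].
  rewrite -[a *: x]/(ract (free bS W) x a) [LHS](raddfD (c i)); congr (_ + _).
  rewrite -[RHS]/(c i x * (a : kvs S)).
  pose F : {linear free bS W -> kvs S} := c i \o bil_flip (ract (free bS W)) a.
  pose G : {linear free bS W -> kvs S} := bil_flip (kmul S) a \o c i.
  apply: (@ot_ext _ _ bS _ _ F G) => w v; rewrite /F /G /= /bil_flip.
  by rewrite free_act_tp !c_tp kmulE !kvs_scaleE -mulrA.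
have sum_lin : linear (fun t => \sum_i tp bS (bW i) (c i t)).
  move=> d x y; rewrite scaler_sumr -big_split /=; apply: eq_bigr => j _.
  by rewrite linearP bilDr bilZr.
pose F : {linear ot bS W -> ot bS W} := HB.pack (fun t => \sum_i tp bS (bW i) (c i t))
  (GRing.isLinear.Build _ _ _ _ _ sum_lin).
transitivity (F t).
  apply: eq_bigr => i _; rewrite -[LHS]/(ract (free bS W) (tp bS (bW i) 1) (c i t)).
  by rewrite free_act_tp mul1r.
apply: (@ot_ext _ _ bS _ _ F idfun) => w v; rewrite /F /=.
under eq_bigr do rewrite c_tp bilZr -bilZl.
by rewrite -bil_suml bco_sum.
Qed.
End ModuleOver.

Lemma ot_ext_additive (k : fieldType) (V : lmodType k) (b : kbasis V) (W : lmodType k)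
    (Z : zmodType) (f g : {additive ot b W -> Z}) :
  (forall w v, f (tp b w v) = g (tp b w v)) -> f =1 g.
Proof.
move=> fg t; rewrite (ot_sum t) !raddf_sum; apply: eq_bigr => j _; exact: fg.
Qed.

Section OneSidedBar.
Variables (k : fieldType) (S : kAlgType k) (bS : kbasis (kvs S)).
Variables (M : lmodType S^c) (N : lmodType S).
Hypothesis spM : spanned (krmod M).
Local Notation X := (rmod_of M).
Local Notation Y := (lmod_of N).
Variable bY : kbasis Y.
Local Notation T n := (Tn bS n X).
Local Notation barD := (barD bS X).
Local Notation tc := (tc bS).
Local Notation bc := (@bc k S bS Y bY X).
Local Notation bstar := (@bstar k S bS Y bY X).
Local Notation dB n := (@dB k S bS Y bY X n).

(** Degree n is M (x) S^(n+1), free on the right, so that tensoring with N over S leaves M (x) S^n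
    (x) N. *)
Definition FX n : lmodType S^c := opmod (T n.+1).

Fact FX_projective n : projective (FX n).
Proof.
apply: free_projective; elim: n => [|n IHn]; first exact: spM.
exact: spanned_ot.
Qed.

Fact dFX_linear n : linear (barD n.+1 : FX n.+1 -> FX n).
Proof. by move=> a x y; rewrite raddfD; congr (_ + _); exact: (@D_ract k S bS X n.+1 x a). Qed.
Definition dFX n : {linear FX n.+1 -> FX n} :=
  HB.pack (barD n.+1 : FX n.+1 -> FX n) (GRing.isLinear.Build _ _ _ _ _ (@dFX_linear n)).
Fact augFX_linear : linear (barD 0 : FX 0 -> M).
Proof. by move=> a x y; rewrite raddfD; congr (_ + _); exact: (@D_ract k S bS X 0 x a). Qed.
Definition augFX : {linear FX 0 -> M} :=
  HB.pack (barD 0 : FX 0 -> M) (GRing.isLinear.Build _ _ _ _ _ augFX_linear).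

Fact augFX_surj (m : M) : exists x, augFX x = m.
Proof.
exists (tc (m : T 0) 1); rewrite -[LHS]/(barD 0 _) D0_tc; exact: (scale1r m).
Qed.
(** w |-> w (x) 1 is a contracting homotopy: D(w (x) 1) = w - Dw (x) 1. *)
Fact D_exact n (w : T n.+1) : barD n w = 0 <-> exists y, barD n.+1 y = w.
Proof.
split=> [w0|[y <-]]; last exact: DD.
by exists (tc w 1); rewrite DS_tc w0 bil0l subr0 ract1.
Qed.

Fact augFX_exact (x : FX 0) : augFX x = 0 <-> exists y, dFX 0 y = x.
Proof. exact: (@D_exact 0 x). Qed.
Fact dFX_exact n (x : FX n.+1) : dFX n x = 0 <-> exists y, dFX n.+1 y = x.
Proof. exact: (@D_exact n.+1 x). Qed.

Definition one_sided_resolution : proj_resolution M :=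
  ProjResolution FX_projective augFX_surj augFX_exact dFX_exact.

Local Notation FN n := (tensor_mod (FX n) N).

Definition close n (t : FN n) : Bn bS bY X n :=
  tensor_lift (fun (w : FX n) (y : N) => bstar n w (y : Y)) t.
Fact close_Bl n (y : N) : zmod_morphism (fun w : FX n => bstar n w (y : Y)).
Proof. by move=> w w'; rewrite -bilBl. Qed.
Fact close_Br n (w : FX n) : zmod_morphism (fun y : N => bstar n w (y : Y)).
Proof. by move=> y y'; rewrite -bilBr. Qed.
Fact close_S n (a : S) (w : FX n) (y : N) :
  bstar n ((a : S^c) *: w : FX n) (y : Y) = bstar n w (a *: y : N).
Proof. exact: bstar_ract. Qed.
Lemma close_tens n (w : FX n) y : close (tens w y : FN n) = bstar n w y.
Proof.
by rewrite /close [LHS]tensor_lift_pure => // [?|?|*];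
  [exact: close_Bl|exact: close_Br|exact: close_S].
Qed.
Fact closeB n : zmod_morphism (@close n).
Proof.
by apply: tensor_liftB => [?|?|*]; [exact: close_Bl|exact: close_Br|exact: close_S].
Qed.
HB.instance Definition _ n :=
  GRing.isZmodMorphism.Build (FN n) (Bn bS bY X n) (@close n) (@closeB n).

(** A chain-level section of [close]: in w (x) y a letter 1 is inserted between w and y. With
    [close] it exhibits the two-sided bar complex as a retract, which is all that [exact_retract]
    requires. *)
Definition opening n (t : Bn bS bY X n) : FN n :=
  \sum_j tens (tc ((t : ot _ _) j) 1 : FX n) (bY j : N).
Fact openingB n : zmod_morphism (@opening n).
Proof.
move=> t u; rewrite /opening -sumrB; apply: eq_bigr => j _.
by rewrite !ffunE bilBl tensBl.
Qed.
HB.instance Definition _ n :=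
  GRing.isZmodMorphism.Build (Bn bS bY X n) (FN n) (@opening n) (@openingB n).

Lemma tens_sumr n (w : FX n) (I : Type) (r : seq I) (F : I -> N) :
  tens w (\sum_(i <- r) F i) = \sum_(i <- r) (tens w (F i) : FN n).
Proof.
elim/big_rec2: _ => [|i x y _ <-]; first by rewrite -[0 in LHS](subrr 0) tensBr subrr.
by rewrite (zmod_morphD (tensBr _)).
Qed.

Lemma opening_bc n w y : opening (bc n w y) = tens (tc w 1 : FX n) (y : N).
Proof.
rewrite -[in RHS](bco_sum bY y) tens_sumr; apply: eq_bigr => j _.
rewrite ffunE bilZl -ract_kmap.
exact: (tensZ (kmap S (bco bY j y)) (tc w 1 : FX n) (bY j : N)).
Qed.

Lemma openingK n t : close (@opening n t) = t.
Proof.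
apply: (@ot_ext_additive _ _ bY _ _ (@close n \o @opening n) idfun) => w y /=.
by rewrite -[tp _ _ _]/(bc n w y) opening_bc close_tens bstar_tc lact1.
Qed.

Lemma opening_dB n t :
  tensor_map N (dFX n) (@opening n.+1 t) = opening (dB n t).
Proof.
apply: (@ot_ext_additive _ _ bY _ _ (tensor_map N (dFX n) \o @opening n.+1)
  (@opening n \o dB n)) => w y /=.
rewrite -[tp _ _ _]/(bc n.+1 w y) opening_bc tensor_mapE dB_bc openingB opening_bc.
rewrite -[dFX n _]/(barD n.+1 _) DS_tc ract1 [LHS]tensBl; congr (_ - _).
have F_add : zmod_morphism (fun w : T n.+1 => tens (w : FX n) (y : N) : FN n) by move=> u v; exact: (@tensBl S (FX n) N y u v).
pose F : {additive T n.+1 -> FN n} := HB.pack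
  (fun w : T n.+1 => tens (w : FX n) (y : N) : FN n)
  (GRing.isZmodMorphism.Build _ _ _ F_add).
apply: (@ot_ext_additive _ _ bS _ _ F (@opening n \o bil_flip (bstar n) y)) => v a.
rewrite /F /= /bil_flip -[tp _ _ _]/(tc v a) bstar_tc opening_bc.
rewrite -[lact _ _ _]/((a : S) *: (y : N)) -tensZ.
by rewrite -[_ *: _]/(ract (T n.+1) (tc v 1) a) ract_tc mul1r.
Qed.

Lemma close_dFX n z : close (tensor_map N (dFX n) z) = dB n (close z).
Proof.
apply: (@tens_ext _ _ _ _ (@close n \o tensor_map N (dFX n)) (dB n \o @close n.+1)) => w y.
rewrite /= tensor_mapE !close_tens -[dFX n _]/(barD n.+1 _).
pose F : {linear T n.+2 -> Bn bS bY X n} := bil_flip (bstar n) y \o barD n.+1.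
pose G : {linear T n.+2 -> Bn bS bY X n} := dB n \o bil_flip (bstar n.+1) y.
apply: (@Tn_ext _ _ _ _ _ _ F G) => v a; rewrite /F /G /= /bil_flip.
by rewrite DS_tc bilBl bstar_ract !bstar_tc dB_bc.
Qed.

Lemma Tor_vanishes_exact n : Tor_vanishes n M N -> exact_at (fun n => dB n) n.
Proof.
move=> /(_ one_sided_resolution).
have -> : homology_vanishes N one_sided_resolution n =
    exact_at (fun n => tensor_map N (dFX n)) n by case: n.
apply: (exact_retract (i := opening) (r := close)).
- by move=> m x dx; rewrite opening_dB dx raddf0.
- by move=> m y; exists (close y); apply: close_dFX.
- exact: openingK.
Qed.
End OneSidedBar.

(** * Change of algebra *)

Section RingChange.
Variables (k : fieldType) (S S' : kAlgType k) (bS : kbasis (kvs S)) (bS' : kbasis (kvs S')).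
Variables (X : bimod S) (X' : bimod S').
Variables (f : {linear X -> X'}) (g : {linear kvs S -> kvs S'}).
Hypothesis gM : {morph g : x y / x * y}.
Hypothesis fR : forall x a, f (ract X x a) = ract X' (f x) (g a).
Hypothesis fL : forall x a, f (bilact X a x) = bilact X' (g a) (f x).

Local Notation T n := (Tn bS n X).
Local Notation T' n := (Tn bS' n X').

(** This is f (x) g^n. The map [g] is multiplicative but may fail to be unital, as for the inclusion
    of a corner; the Hochschild differential only uses products. *)
Fixpoint Tchange n : T n -> T' n :=
  match n return T n -> T' n with
  | 0 => f
  | m.+1 => fun t => \sum_j tc bS' (@Tchange m ((t : ot bS (T m)) j)) (g (bS j))
  end.
Arguments Tchange : simpl never.

Fact Tchange_linear n : linear (@Tchange n).
Proof.
elim: n => [|n IHn]; first exact: linearP.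
move=> c x y; rewrite -[LHS]/(\sum_j _) scaler_sumr -big_split /=.
apply: eq_bigr => j _; rewrite -bilZl -bilDl; congr (tc _ _ _).
by rewrite -(IHn c ((x : ot bS (T n)) j) ((y : ot bS (T n)) j)) !ffunE.
Qed.
HB.instance Definition _ n :=
  GRing.isLinear.Build k (T n) (T' n) *:%R (@Tchange n) (@Tchange_linear n).

Lemma Tchange_tc n w a : Tchange (tc bS w a) = tc bS' (@Tchange n w) (g a).
Proof.
rewrite -[LHS]/(\sum_j _) -[in RHS](bco_sum bS a) linear_sum bil_sumr.
apply: eq_bigr => j _; rewrite ffunE linearZ_LR bilZr -bilZl; congr (tc _ _ _).
by rewrite -linearZ_LR.
Qed.

Lemma Tchange_ract n w a : Tchange (ract (T n) w a) = ract (T' n) (@Tchange n w) (g a).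
Proof.
case: n w => [|n] w; first exact: fR.
pose R : {linear T n.+1 -> T n.+1} := bil_flip (ract (T n.+1)) a.
pose R' : {linear T' n.+1 -> T' n.+1} := bil_flip (ract (T' n.+1)) (g a).
apply: (@Tn_ext _ _ _ _ _ _ (@Tchange n.+1 \o R) (R' \o @Tchange n.+1)) => v b.
by rewrite /R /R' /= /bil_flip ract_tc !Tchange_tc ract_tc gM.
Qed.

Lemma D_Tchange n t : barD bS' X' n (@Tchange n.+1 t) = Tchange (barD bS X n t).
Proof.
elim: n t => [|n IHn] t.
  apply: (@Tn_ext _ _ _ _ _ _ (barD bS' X' 0 \o @Tchange 1) (@Tchange 0 \o barD bS X 0)) => x a.
  by rewrite /= Tchange_tc !D0_tc; apply/esym/fR.
apply: (@Tn_ext _ _ _ _ _ _ (barD bS' X' n.+1 \o @Tchange n.+2) (@Tchange n.+1 \o barD bS X n.+1)).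
by move=> w a; rewrite /= Tchange_tc !DS_tc IHn raddfB /= Tchange_ract Tchange_tc.
Qed.

Lemma Tchange_lact n a w :
  Tchange (Tmn bS (bilact X a) n w) = Tmn bS' (bilact X' (g a)) n (@Tchange n w).
Proof.
elim: n w => [|n IHn] w; first exact: fL.
pose F : {linear T n.+1 -> T' n.+1} := @Tchange n.+1 \o Tmn bS (bilact X a) n.+1.
apply: (@Tn_ext _ _ _ _ _ _ F (Tmn bS' (bilact X' (g a)) n.+1 \o @Tchange n.+1)) => v b.
by rewrite /F /= Tmn_tc !Tchange_tc IHn Tmn_tc.
Qed.

Lemma hoch_Tchange n t : hoch bS' X' n (@Tchange n.+1 t) = Tchange (hoch bS X n t).
Proof.
rewrite /hoch raddfB /= D_Tchange; congr (_ - _).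
apply: (@Tn_ext _ _ _ _ _ _ (@twist _ _ bS' X' n \o @Tchange n.+1) (@Tchange n \o @twist _ _ bS X n)).
by move=> w a; rewrite /= Tchange_tc !tw_tc Tchange_lact.
Qed.
End RingChange.
Arguments Tchange {k S S'} bS bS' {X X'} f g n t : simpl never.

Lemma TchangeK (k : fieldType) (S S' : kAlgType k) (bS : kbasis (kvs S)) (bS' : kbasis (kvs S'))
    (X : bimod S) (X' : bimod S') (f : {linear X -> X'}) (g : {linear kvs S -> kvs S'})
    (f' : {linear X' -> X}) (g' : {linear kvs S' -> kvs S}) n :
  cancel f f' -> cancel g g' ->
  cancel (@Tchange k S S' bS bS' X X' f g n) (@Tchange k S' S bS' bS X' X f' g' n).
Proof.
move=> ff gg; elim: n => [|n IHn] t; first exact: ff.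
apply: (@Tn_ext _ _ _ _ _ _ (@Tchange k S' S bS' bS X' X f' g' n.+1 \o
  @Tchange k S S' bS bS' X X' f g n.+1) idfun) => w a.
by rewrite /= !Tchange_tc IHn gg.
Qed.

Section RegularBar.
Variables (k : fieldType) (C : kAlgType k).

Fact idM : {morph (idfun : {linear kvs C -> kvs C}) : x y / x * y}. Proof. by []. Qed.
Definition regR : rmod C := pullR idM (erefl : (idfun : {linear kvs C -> kvs C}) 1 = 1).
Definition regB : bimod C := pullB idM (erefl : (idfun : {linear kvs C -> kvs C}) 1 = 1).

Variable bC : kbasis (kvs C).

(** x |-> 1 (x) x splits the regular module C as a right module. *)
Lemma reg_exact (Y : lmod C) (bY : kbasis Y) n :
  exact_at (fun n => @dB k C bC Y bY regR n) n.+1.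
Proof.
pose s : {linear regR -> Tn bC 1 regR} := @tc k C bC regR 0 (1 : kvs C).
apply: (@dB_exactS k C bC Y bY regR s) => [x a|x]; rewrite /s.
  by rewrite ract_tc.
by rewrite D0_tc; apply: mul1r.
Qed.

Lemma HH_regular n : HH_vanishes C n <-> exact_at (hoch bC regB) n.
Proof.
apply: (@HH_hoch k C C bC bC idfun) => [c|m]; first by exists c.
exact: reg_exact.
Qed.
End RegularBar.

(** * The ideal LeL and the two corners *)

Section PeirceCut.
Variables (A : pzRingType) (f e : idem_elt A).

Fact peirce_cut_l x : ival f * (ival f * x * ival e) = ival f * x * ival e.
Proof. by rewrite !mulrA idemP. Qed.
Fact peirce_cut_r x : ival f * x * ival e * ival e = ival f * x * ival e.
Proof. by rewrite -mulrA idemP. Qed.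
Definition peirce_cut (x : A) : peirce f e := mk_peirce (peirce_cut_l x) (peirce_cut_r x).
End PeirceCut.

Section Stratified.
Variables (k : fieldType) (L : kAlgType k) (e f : idem_elt L).
Local Notation A := (corner e : kAlgType k).
Local Notation B := (corner f : kAlgType k).
Local Notation X := (rmod_of (S := A) (peirce_right idem1 e)).
Local Notation Y := (lmod_of (S := A) (peirce_left e idem1)).

Lemma kmap_mulr (c : k) (x y : L) : x * (kmap L c * y) = kmap L c * (x * y).
Proof. by rewrite mulrA -kmapC -mulrA. Qed.

Section Corner.
Variable g : idem_elt L.
Local Notation G := (kvs (corner g : kAlgType k)).

Definition corner_val (x : G) : kvs L := peirce_val (x : peirce g g).
Arguments corner_val : simpl never.
Fact corner_val_linear : linear corner_val.
Proof.
move=> c x y; rewrite -[LHS]/(kmap L c * ival g * corner_val x + corner_val y).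
by rewrite -mulrA; congr (_ * _ + _); apply: (peirce_mull (x : peirce g g)).
Qed.
HB.instance Definition _ := GRing.isLinear.Build k G (kvs L) *:%R corner_val corner_val_linear.

Lemma corner_val_inj : injective corner_val. Proof. exact: val_inj. Qed.

Definition corner_cut (x : kvs L) : G := peirce_cut g g x.
Arguments corner_cut : simpl never.
Lemma corner_cutE x : corner_val (corner_cut x) = ival g * x * ival g. Proof. by []. Qed.
Fact corner_cut_linear : linear corner_cut.
Proof.
move=> c x y; apply: corner_val_inj; rewrite linearP /= !corner_cutE !kvs_scaleE.
by rewrite mulrDr mulrDl kmap_mulr -!mulrA.
Qed.
HB.instance Definition _ := GRing.isLinear.Build k (kvs L) G *:%R corner_cut corner_cut_linear.

Lemma corner_cutK : cancel corner_val corner_cut.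
Proof. by move=> x; apply: corner_val_inj; apply: (peirceP (x : peirce g g)). Qed.

Lemma corner_mull (x : G) : ival g * corner_val x = corner_val x.
Proof. exact: (peirce_mull (x : peirce g g)). Qed.
Lemma corner_mulr (x : G) : corner_val x * ival g = corner_val x.
Proof. exact: (peirce_mulr (x : peirce g g)). Qed.
End Corner.

Definition vX (x : X) : kvs L := peirce_val (x : peirce idem1 e).
Arguments vX : simpl never.
Fact vX_linear : linear vX.
Proof.
move=> c x y; rewrite -[LHS]/(vX x * (kmap L c * ival e) + vX y).
by rewrite kmap_mulr; congr (_ * _ + _); apply: (peirce_mulr (x : peirce idem1 e)).
Qed.
HB.instance Definition _ := GRing.isLinear.Build k X (kvs L) *:%R vX vX_linear.
Lemma vX_inj : injective vX. Proof. exact: val_inj. Qed.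
Lemma vX_mulr x : vX x * ival e = vX x.
Proof. exact: (peirce_mulr (x : peirce idem1 e)). Qed.
Lemma vX_ract x (a : kvs A) : vX (ract X x a) = vX x * corner_val a. Proof. by []. Qed.

Definition cutX (x : kvs L) : X := peirce_cut idem1 e x.
Arguments cutX : simpl never.
Lemma cutXE x : vX (cutX x) = x * ival e.
Proof. by rewrite -[LHS]/(1 * x * ival e) mul1r. Qed.
Fact cutX_linear : linear cutX.
Proof.
move=> c x y; apply: vX_inj; rewrite linearP /= !cutXE !kvs_scaleE.
by rewrite mulrDl -!mulrA.
Qed.
HB.instance Definition _ := GRing.isLinear.Build k (kvs L) X *:%R cutX cutX_linear.

Definition vY (y : Y) : kvs L := peirce_val (y : peirce e idem1).
Arguments vY : simpl never.
Fact vY_linear : linear vY.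
Proof.
move=> c x y; rewrite -[LHS]/(kmap L c * ival e * vY x + vY y).
by rewrite -mulrA; congr (_ * _ + _); apply: (peirce_mull (x : peirce e idem1)).
Qed.
HB.instance Definition _ := GRing.isLinear.Build k Y (kvs L) *:%R vY vY_linear.
Lemma vY_inj : injective vY. Proof. exact: val_inj. Qed.
Lemma vY_mull y : ival e * vY y = vY y.
Proof. exact: (peirce_mull (y : peirce e idem1)). Qed.
Lemma vY_lact (a : kvs A) y : vY (lact Y a y) = corner_val a * vY y. Proof. by []. Qed.

Definition cutY (x : kvs L) : Y := peirce_cut e idem1 x.
Arguments cutY : simpl never.
Lemma cutYE x : vY (cutY x) = ival e * x.
Proof. by rewrite -[LHS]/(ival e * x * 1) mulr1. Qed.
Fact cutY_linear : linear cutY.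
Proof.
move=> c x y; apply: vY_inj; rewrite linearP /= !cutYE !kvs_scaleE.
by rewrite mulrDr kmap_mulr.
Qed.
HB.instance Definition _ := GRing.isLinear.Build k (kvs L) Y *:%R cutY cutY_linear.

(* [ideal g] is {x | g x g = 0}; for g = 1 - e and (1 - e) L e L (1 - e) = 0 it  *)
(* is the ideal LeL.                                                            *)
Section Ideal.
Variable g : idem_elt L.

Definition ker_pred : {pred kvs L} := fun x => ival g * (x : L) * ival g == 0.
Fact ker_pred_closed : submod_closed ker_pred.
Proof.
split=> [|c x y]; rewrite /ker_pred !unfold_in; first by rewrite mulr0 mul0r.
move=> /eqP fx /eqP fy; rewrite kvs_scaleE mulrDr mulrDl fy addr0 kmap_mulr.
by rewrite -mulrA fx mulr0.
Qed.
HB.instance Definition _ := GRing.isSubmodClosed.Build k (kvs L) ker_pred ker_pred_closed.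

Record ideal := Ideal { ideal_val :> kvs L; _ : ideal_val \in ker_pred }.
HB.instance Definition _ := [isSub for ideal_val].
HB.instance Definition _ := [Choice of ideal by <:].
HB.instance Definition _ := [SubChoice_isSubLmodule of ideal by <:].

Lemma ideal_inj : injective ideal_val. Proof. exact: val_inj. Qed.
Fact ideal_val_linear : linear ideal_val. Proof. by []. Qed.
HB.instance Definition _ := GRing.isLinear.Build k ideal (kvs L) *:%R ideal_val ideal_val_linear.

Lemma idealP (x : ideal) : ival g * (x : kvs L) * ival g = 0.
Proof. exact/eqP/(valP x). Qed.

Fact ideal_cut_in (x : kvs L) : x - ival g * x * ival g \in ker_pred.
Proof.
by rewrite unfold_in mulrBr mulrBl !mulrA idemP -[X in _ - X]mulrA idemP subrr.
Qed.
Definition ideal_cut (x : kvs L) : ideal := Ideal (ideal_cut_in x).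
Fact ideal_cut_linear : linear ideal_cut.
Proof.
move=> c x y; apply: ideal_inj; rewrite linearP /=.
rewrite mulrDr mulrDl opprD addrACA scalerBr; congr (_ - _ + _).
by rewrite !kvs_scaleE kmap_mulr -!mulrA.
Qed.
HB.instance Definition _ := GRing.isLinear.Build k (kvs L) ideal *:%R ideal_cut ideal_cut_linear.

Lemma ideal_cutE x : ival g * x * ival g = 0 -> ideal_cut x = x :> kvs L.
Proof. by move=> /= ->; rewrite subr0. Qed.
End Ideal.

Section CutMul.
Variables (U V Z : lmodType k).
Variables (u : {linear U -> kvs L}) (v : {linear V -> kvs L}) (z : {linear kvs L -> Z}).
(** Every action and pairing between Peirce pieces and the ideal is the product of L followed by a
    linear projection onto its target. Bilinearity is then automatic, and it remains to see in each
    case that the projection fixes the product. *)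
Definition cut_mul : bil U V Z :=
  @Bil k U V Z (fun x y => z (u x * v y))
    (fun y => linearP (z \o bil_flip (kmul L) (v y) \o u)) (fun x => linearP (z \o kmul L (u x) \o v)).
Lemma cut_mulE x y : cut_mul x y = z (u x * v y). Proof. by []. Qed.
End CutMul.

Local Notation id_L := (idfun : {linear kvs L -> kvs L}).
Definition YL : bil Y (kvs L) Y := cut_mul vY id_L cutY.
Definition LX : bil (kvs L) X X := cut_mul id_L vX cutX.
Definition XY : bil X Y (ideal f) := cut_mul vX vY (@ideal_cut f).
Definition YX : bil Y X (kvs A) := cut_mul vY vX (@corner_cut e).

Lemma YLE y a : vY (YL y a) = vY y * a.
Proof. by rewrite cut_mulE cutYE mulrA vY_mull. Qed.
Lemma LXE a x : vX (LX a x) = a * vX x.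
Proof. by rewrite cut_mulE cutXE -mulrA vX_mulr. Qed.
Lemma YXE y x : corner_val (YX y x) = vY y * vX x.
Proof. by rewrite cut_mulE corner_cutE mulrA vY_mull -mulrA vX_mulr. Qed.

Lemma LXM x a b : LX a (LX b x) = LX (a * b) x.
Proof. by apply: vX_inj; rewrite !LXE mulrA. Qed.
Lemma LX1 x : LX 1 x = x.
Proof. by apply: vX_inj; rewrite !LXE mul1r. Qed.
Lemma LX_rlin a : rlin (LX a).
Proof. by move=> x c; apply: vX_inj; rewrite vX_ract !LXE vX_ract mulrA. Qed.
Lemma YLM y a b : YL (YL y a) b = YL y (a * b).
Proof. by apply: vY_inj; rewrite !YLE mulrA. Qed.
Lemma YL1 y : YL y 1 = y.
Proof. by apply: vY_inj; rewrite !YLE mulr1. Qed.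
Lemma YL_lact c y a : YL (lact Y c y) a = lact Y c (YL y a).
Proof. by apply: vY_inj; rewrite vY_lact !YLE vY_lact mulrA. Qed.

Variables (bL : kbasis (kvs L)) (bA : kbasis (kvs A)) (bB : kbasis (kvs B)) (bY : kbasis Y).

(* Le (x) A^q (x) eL, as a L-bimodule *)
Local Notation Z q := (@Bn k A bA Y bY X q).
Local Notation TA q := (Tn bA q X).
Local Notation bc q := (@bc k A bA Y bY X q).
Local Notation dZ q := (@dB k A bA Y bY X q).
Local Notation zstar q := (@bstar k A bA Y bY X q).

Definition zR q : bil (Z q) (kvs L) (Z q) := star bY bY YL (TA q).
Definition zLX q : bil (kvs L) (TA q) (TA q) := @bTn k A bA X X (kvs L) LX q.
Definition zL q : bil (kvs L) (Z q) (Z q) := btmap bY (zLX q).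
Lemma zR_bc q w y a : zR q (bc q w y) a = bc q w (YL y a).
Proof. exact: star_tp. Qed.
Lemma zL_bc q a w y : zL q a (bc q w y) = bc q (zLX q a w) y.
Proof. exact: btmap_tp. Qed.
Lemma zLXE q a w : zLX q a w = Tmn bA (LX a) q w. Proof. by []. Qed.
Lemma zLX_tc q a w c : zLX q.+1 a (tc bA w c) = tc bA (zLX q a w) c.
Proof. exact: (@Tmn_tc k A bA X X (LX a) q w c). Qed.

Fact zRM q x a b : zR q (zR q x a) b = zR q x (a * b).
Proof.
apply: (@Bn_ext _ _ _ _ _ _ _ _ (bil_flip (zR q) b \o bil_flip (zR q) a) (bil_flip (zR q) (a * b))).
by move=> w y; rewrite /= /bil_flip !zR_bc YLM.
Qed.
Fact zR1 q x : zR q x 1 = x.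
Proof.
apply: (@Bn_ext _ _ _ _ _ _ _ _ (bil_flip (zR q) 1) idfun).
by move=> w y; rewrite /= /bil_flip zR_bc YL1.
Qed.
Fact zLM q x a b : zL q a (zL q b x) = zL q (a * b) x.
Proof.
apply: (@Bn_ext _ _ _ _ _ _ _ _ (zL q a \o zL q b) (zL q (a * b))) => w y.
rewrite /= !zL_bc !zLXE Tmn_comp; congr (bc q _ _); apply: Tmn_eq => z /=.
exact: LXM.
Qed.
Fact zL1 q x : zL q 1 x = x.
Proof.
apply: (@Bn_ext _ _ _ _ _ _ _ _ (zL q 1) idfun) => w y.
by rewrite /= zL_bc zLXE Tmn_id //; apply: LX1.
Qed.
Fact zLR q x a b : zL q a (zR q x b) = zR q (zL q a x) b.
Proof.
apply: (@Bn_ext _ _ _ _ _ _ _ _ (zL q a \o bil_flip (zR q) b) (bil_flip (zR q) b \o zL q a)).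
by move=> w y; rewrite /= /bil_flip !(zL_bc, zR_bc).
Qed.
Definition ZR q : rmod L := RMod (@zRM q) (@zR1 q).
Definition ZB q : bimod L := @BiMod _ _ (ZR q) (zL q) (@zLM q) (@zL1 q) (@zLR q).

Lemma dZ_rlin q : rlin (X := ZB q.+1) (Y := ZB q) (dZ q).
Proof.
move=> t a; pose R m : {linear Z m -> Z m} := bil_flip (zR m) a.
apply: (@Bn_ext _ _ _ _ _ _ _ _ (dZ q \o R q.+1) (R q \o dZ q)) => w y.
rewrite /R /= /bil_flip zR_bc !dB_bc bilBl zR_bc; congr (_ - _).
pose F : {linear TA q.+1 -> Z q} := bil_flip (zstar q) (YL y a).
pose G : {linear TA q.+1 -> Z q} := R q \o bil_flip (zstar q) y.
apply: (@Tn_ext _ _ _ _ _ _ F G) => v c; rewrite /F /G /R /= /bil_flip.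
by rewrite !bstar_tc zR_bc YL_lact.
Qed.

Lemma dZ_llin q : llin (X := ZB q.+1) (Y := ZB q) (dZ q).
Proof.
move=> a t; apply: (@Bn_ext _ _ _ _ _ _ _ _ (dZ q \o zL q.+1 a) (zL q a \o dZ q)) => w y.
rewrite /= zL_bc !dB_bc bilBr zL_bc !zLXE D_Tmn; last exact: LX_rlin.
congr (_ - _).
pose F : {linear TA q.+1 -> Z q} := bil_flip (zstar q) y \o zLX q.+1 a.
pose G : {linear TA q.+1 -> Z q} := zL q a \o bil_flip (zstar q) y.
apply: (@Tn_ext _ _ _ _ _ _ F G) => v c; rewrite /F /G /= /bil_flip.
by rewrite zLX_tc !bstar_tc zL_bc.
Qed.

Hypothesis ef : ival e + ival f = 1.
Hypothesis NM0 : forall x y : L, ival f * x * ival e * y * ival f = 0.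

Lemma fe0 : ival f * ival e = 0.
Proof. by apply: (addIr (ival e)); rewrite -{2}(idemP e) -mulrDl addrC ef mul1r add0r. Qed.

(** Insert e + f between x and y: the summand f x e y f is zero. *)
Lemma cut_mulr_f (x y : L) : ival f * x * y * ival f = (ival f * x * ival f) * (ival f * y * ival f).
Proof.
rewrite !mulrA -[X in X * y * _]mulr1 -ef mulrDr !mulrDl NM0 add0r.
by rewrite -[ival f * x * ival f * ival f]mulrA idemP.
Qed.

Definition proj : {linear kvs L -> kvs B} := @corner_cut f.
Lemma projM : {morph proj : x y / x * y}.
Proof.
move=> x y; apply: val_inj; apply: etrans (cut_mulr_f x y).
by rewrite -[ival f * (x : L) * (y : L)]mulrA.
Qed.
Lemma proj1 : proj 1 = 1.
Proof. by apply: val_inj; rewrite /= mulr1 idemP. Qed.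
Lemma proj_surj b : exists a, proj a = b.
Proof. by exists (corner_val b); apply: corner_cutK. Qed.

Local Notation I := (ideal f).
Definition iR : bil I (kvs L) I := cut_mul (@ideal_val f) id_L (@ideal_cut f).
Definition iL : bil (kvs L) I I := cut_mul id_L (@ideal_val f) (@ideal_cut f).
Lemma iRE x a : ideal_val (iR x a) = ideal_val x * a.
Proof.
apply: ideal_cutE => /=; have := idealP x; rewrite mulrA cut_mulr_f => ->.
by rewrite mul0r.
Qed.
Lemma iLE a x : ideal_val (iL a x) = a * ideal_val x.
Proof.
apply: ideal_cutE => /=; have := idealP x; rewrite mulrA cut_mulr_f => ->.
by rewrite mulr0.
Qed.
Fact iRM x a b : iR (iR x a) b = iR x (a * b).
Proof. by apply: ideal_inj; rewrite !iRE mulrA. Qed.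
Fact iR1 x : iR x 1 = x.
Proof. by apply: ideal_inj; rewrite !iRE mulr1. Qed.
Fact iLM x a b : iL a (iL b x) = iL (a * b) x.
Proof. by apply: ideal_inj; rewrite !iLE mulrA. Qed.
Fact iL1 x : iL 1 x = x.
Proof. by apply: ideal_inj; rewrite !iLE mul1r. Qed.
Fact iLR x a b : iL a (iR x b) = iR (iL a x) b.
Proof. by apply: ideal_inj; rewrite !(iLE, iRE) mulrA. Qed.
Definition IR : rmod L := RMod iRM iR1.
Definition IB : bimod L := @BiMod _ _ IR iL iLM iL1 iLR.

(** * The resolution of the ideal by Le (x) A^q (x) eL *)

Definition mu : {linear Z 0 -> I} := tlift XY.
Lemma mu_bc x y : ideal_val (mu (bc 0 x y)) = vX x * vY y.
Proof.
rewrite [mu _]tlift_tp; apply: ideal_cutE.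
by rewrite /= -(vX_mulr x) !mulrA; apply: NM0.
Qed.

Lemma mu_rlin : rlin (X := ZB 0) (Y := IB) mu.
Proof.
move=> t a; pose F : {linear Z 0 -> I} := mu \o bil_flip (zR 0) a.
apply: (@Bn_ext _ _ _ _ _ _ _ _ F (bil_flip iR a \o mu)) => x y.
rewrite /F /= /bil_flip zR_bc; apply: ideal_inj.
by rewrite iRE !mu_bc YLE mulrA.
Qed.

Lemma mu_llin : llin (X := ZB 0) (Y := IB) mu.
Proof.
move=> a t; apply: (@Bn_ext _ _ _ _ _ _ _ _ (mu \o zL 0 a) (iL a \o mu)) => x y.
rewrite /= zL_bc; apply: ideal_inj.
by rewrite iLE !mu_bc -[zLX 0 a x]/(LX a x) LXE mulrA.
Qed.

Lemma mu_dZ t : mu (dZ 0 t) = 0.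
Proof.
apply: (@Bn_ext _ _ _ _ _ _ _ _ (mu \o dZ 0) \0) => w y.
rewrite /= dB_bc raddfB /=; apply/eqP; rewrite subr_eq0; apply/eqP.
pose F : {linear TA 1 -> I} := mu \o bil_flip (zstar 0) y.
pose G : {linear TA 1 -> I} := mu \o bil_flip (bc 0) y \o barD bA X 0.
apply: (@Tn_ext _ _ _ _ _ _ F G) => x a; rewrite /F /G /= /bil_flip.
by apply: ideal_inj; rewrite bstar_tc D0_tc !mu_bc vY_lact vX_ract mulrA.
Qed.

Local Notation eX := (cutX (ival e : kvs L)).
Local Notation eY := (cutY (ival e : kvs L)).

(** As fif = 0, an element i of the ideal is ei + fie; the summands lift to e (x) ei and fie (x)
    e. *)
Definition sectI : {linear I -> Z 0} :=
  (bc 0 eX \o cutY \o @ideal_val f) \+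
  (bil_flip (bc 0) eY \o cutX \o kmul L (ival f : kvs L) \o @ideal_val f).
Lemma sectIE i : sectI i =
  bc 0 eX (cutY (ideal_val i)) + bc 0 (cutX ((ival f : kvs L) * ideal_val i)) eY.
Proof. by []. Qed.

Lemma mu_sectI i : mu (sectI i) = i.
Proof.
apply: ideal_inj; rewrite sectIE raddfD raddfD /= -[mu (bc _ _ _) : kvs L]/(ideal_val _).
rewrite -[X in _ + X = _]/(ideal_val _) !mu_bc !cutXE !cutYE.
rewrite mulrA !idemP -mulrA idemP -[X in _ = X]mul1r -ef mulrDl; congr (_ + _).
by rewrite -[RHS]mulr1 -ef mulrDr -[ival f * _]/((ival f : L) * (ideal_val i : L)) idealP addr0.
Qed.

Lemma dZ0_bc v a y :
  dZ 0 (bc 1 (tc bA v a) y) = bc 0 v (lact Y a y) - bc 0 (ract X v a) y.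
Proof. by rewrite dB_bc bstar_tc D0_tc. Qed.

(* N (x)_A M = 0 *)
Hypothesis NM_boundary : forall x y : kvs L, exists u,
  dZ 0 u = bc 0 (cutX (ival f * x)) (cutY (y * ival f)).

(** Split x (x) y into ex (x) y, fx (x) ye and fx (x) yf. Moving exe to the right across the tensor
    sign takes the first to e (x) exy ([u1]), moving eye to the left takes the second to fxye (x) e
    ([u2]), and the third is a boundary by hypothesis ([u3]). *)
Lemma dZ_retract_bc x y : exists u, dZ 0 u = bc 0 x y - sectI (mu (bc 0 x y)).
Proof.
have [u3 du3] := NM_boundary (vX x) (vY y).
pose u1 := bc 1 (tc bA (eX : TA 0) (corner_cut e (vX x))) y.
pose u2 := bc 1 (tc bA (cutX (ival f * vX x) : TA 0) (corner_cut e (vY y))) eY.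
have fex z : ival f * z + ival e * z = z :> kvs L by rewrite -mulrDl addrC ef mul1r.
have fey z : z * ival e + z * ival f = z :> kvs L by rewrite -mulrDr ef mulr1.
exists (u2 + u3 - u1); rewrite sectIE mu_bc raddfB raddfD /= du3 /u1 /u2 !dZ0_bc.
have -> : lact Y (corner_cut e (vX x)) y = cutY (vX x * vY y).
  by apply: vY_inj; rewrite vY_lact corner_cutE cutYE -!mulrA vY_mull.
have -> : ract X eX (corner_cut e (vX x)) = cutX (ival e * vX x).
  by apply: vX_inj; rewrite vX_ract corner_cutE !cutXE !mulrA !idemP.
have -> : lact Y (corner_cut e (vY y)) eY = cutY (vY y * ival e).
  by apply: vY_inj; rewrite vY_lact corner_cutE !cutYE -!mulrA !idemP.
have -> : ract X (cutX (ival f * vX x)) (corner_cut e (vY y)) = cutX (ival f * (vX x * vY y)).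
  apply: vX_inj; rewrite vX_ract corner_cutE !cutXE -!mulrA; congr (_ * (_ * _)).
  by rewrite (mulrA (ival e) (ival e)) idemP mulrA vY_mull.
have -> : bc 0 x y = bc 0 (cutX (ival f * vX x)) (cutY (vY y * ival e)) +
    (bc 0 (cutX (ival f * vX x)) (cutY (vY y * ival f)) + bc 0 (cutX (ival e * vX x)) y).
  rewrite addrA -bilDr -raddfD /= fey.
  have -> : cutY (vY y) = y by apply: vY_inj; rewrite cutYE vY_mull.
  rewrite -bilDl -raddfD /= fex; congr (bc 0 _ _).
  by apply: vX_inj; rewrite cutXE vX_mulr.
rewrite opprB [_ - _ + bc 0 _ _]addrAC -!addrA; congr (_ + (_ + _)).
by rewrite addrC opprD addrA.
Qed.

Lemma dZ_retract t : exists u, dZ 0 u = t - sectI (mu t).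
Proof.
pose u j := projT1 (cid (dZ_retract_bc ((t : ot _ _) j) (bY j))).
have uP j : dZ 0 (u j) = _ := projT2 (cid (dZ_retract_bc ((t : ot _ _) j) (bY j))).
exists (\sum_j u j); rewrite {1 2}(@ot_sum _ _ bY _ t) raddf_sum.
rewrite (raddf_sum mu) (raddf_sum sectI) -sumrB.
by apply: eq_bigr => j _; apply: uP.
Qed.

Lemma mu_ker t : mu t = 0 -> exists u, dZ 0 u = t.
Proof. by move=> t0; have [u du] := dZ_retract t; exists u; rewrite du t0 raddf0 subr0. Qed.

(* B(LeL, L, C) is acyclic for every left L-module C killed by e *)
Section IdealBar.
Variables (C : lmod L) (bC : kbasis C).
Hypothesis eC : forall a y, lact C (ival e * a : kvs L) y = 0.
Hypothesis exZ : forall q, exact_at (fun q => dZ q) q.+1.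
Local Notation dB R n := (@dB k L bL C bC R n).

Definition bcE q : {linear TA q -> Tn bL 0 (ZR q)} := bil_flip (bc q) eY.
Definition sZ_bil q : bil (TA q) Y (Tn bL 1 (ZR q)) :=
  @Bil k (TA q) Y (Tn bL 1 (ZR q)) (fun w y => tc bL (bcE q w) (vY y))
    (fun y => linearP (bil_flip (tc bL) (vY y) \o bcE q))
    (fun w => linearP (tc bL (bcE q w) \o vY)).
(** The section w (x) y |-> (w (x) e) (x) y of the right action, available because y = ey. *)
Definition sZ q : {linear ZR q -> Tn bL 1 (ZR q)} := tlift (sZ_bil q).
Lemma sZ_bc q w y : sZ q (bc q w y) = tc bL (bc q w eY : Tn bL 0 (ZR q)) (vY y).
Proof. exact: tlift_tp. Qed.

Lemma sZ_rlin q : rlin (X := ZR q) (Y := Tn bL 1 (ZR q)) (sZ q).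
Proof.
move=> t a; pose F : {linear Z q -> Tn bL 1 (ZR q)} := sZ q \o bil_flip (zR q) a.
pose G : {linear Z q -> Tn bL 1 (ZR q)} := bil_flip (ract (Tn bL 1 (ZR q))) a \o sZ q.
apply: (@Bn_ext _ _ _ _ _ _ _ _ F G) => w y.
rewrite /F /G -[LHS]/(sZ q (zR q _ a)) -[RHS]/(ract _ (sZ q (bc q w y)) a).
by rewrite zR_bc !sZ_bc ract_tc YLE.
Qed.

Lemma sZ_mul q x : barD bL (ZR q) 0 (sZ q x) = x.
Proof.
apply: (@Bn_ext _ _ _ _ _ _ _ _ (barD bL (ZR q) 0 \o sZ q) idfun) => w y.
rewrite -[LHS]/(barD bL (ZR q) 0 (sZ q _)) sZ_bc D0_tc [LHS]zR_bc; congr (bc q _ _).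
by apply: vY_inj; rewrite YLE cutYE idemP vY_mull.
Qed.

(** [sZ] contracts the positive degrees. The homology in degree 0 is Z_q (x)_L C, that is Le (x) A^q
    (x) eC, and e kills C. *)
Lemma ZR_exact q n : exact_at (fun n => dB (ZR q) n) n.
Proof.
case: n => [|n]; last first.
  by apply: dB_exactS; [exact: sZ_rlin|exact: sZ_mul].
apply: (dB_exact0 (s := sZ q)); first exact: sZ_mul.
move=> x c.
pose F : {linear Z q -> _} := bil_flip (@bstar k L bL C bC (ZR q) 0) c \o sZ q.
apply: (@Bn_ext _ _ _ _ _ _ _ _ F \0) => w y.
rewrite -[LHS]/(bstar _ _ _ _ (sZ q _) c) sZ_bc bstar_tc.
by rewrite -(vY_mull y) eC bil0r.
Qed.

(** In the bicomplex B(Z_i, L, C)_j the rows (fixed i) are acyclic and the columns (fixed j) resolve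
    B(I, L, C)_j, so the latter is acyclic as well. Degree 0 follows directly from surjectivity of
    Z_0 -> I. *)
Lemma IR_exact n : exact_at (fun n => dB IR n) n.
Proof.
pose pi n : {linear _ -> _} := @Bmn k L bL C bC (ZR 0) IR mu n.
have pi_surj m s : exists t, pi m t = s.
  by apply: Bmn_surj => i; exists (sectI i); apply: mu_sectI.
case: n => [|n].
  move=> s; have [t <-] := pi_surj _ s.
  have [u <-] := @ZR_exact 0 0 t; exists (pi 1 u).
  by apply: dB_Bmn; apply: mu_rlin.
(* The rows resolve zero, so the complex they are compared with is built from the zero module, here
   functions on the empty ordinal. *)
pose O := {ffun 'I_0 -> k^o}.
have O0 (x y : O) : x = y by apply/ffunP => -[].
pose dv i j : {linear _ -> _} := @Bmn k L bL C bC (ZR i.+1) (ZR i) (dZ i) j.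
pose zero (U : zmodType) : {additive U -> O} := \0.
apply: (@bicomplex_exact (fun i j => Bn bL bC (ZR i) j) (fun=> O) (fun j => Bn bL bC IR j)
  dv (fun i j => dB (ZR i) j) (fun=> zero _) pi (fun=> zero _) (fun j => dB IR j)).
- by move=> i j x; apply/esym/dB_Bmn/dZ_rlin.
- by move=> i j x; rewrite /dv /= Bmn_comp Bmn0 // => z; apply: dB_dB.
- by move=> i j x; apply: dB_dB.
- by [].
- by [].
- by move=> i r; exists 0.
- by move=> i x _; apply: (@ZR_exact i 0).
- by move=> i j x dx; apply: (@ZR_exact i j.+1).
- by move=> j x; apply/esym/dB_Bmn/mu_rlin.
- by move=> j x; rewrite /pi /dv /= Bmn_comp Bmn0 // => z; apply: mu_dZ.
- exact: pi_surj.
- by move=> j x; apply: Bmn_exact; apply: mu_ker.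
- by move=> i j x; apply: Bmn_exact; apply: exZ.
by move=> x _; exists 0.
Qed.
End IdealBar.

(** * Hochschild homology of L with coefficients in fLf and in the ideal *)

Hypothesis exZ : forall q, exact_at (fun q => dZ q) q.+1.

Lemma ideal_val_onto_ker x : proj x = 0 -> exists i : I, ideal_val i = x.
Proof.
by move=> x0; exists (ideal_cut f x); apply: ideal_cutE; apply: (congr1 (@corner_val f) x0).
Qed.

Definition valI : {linear IB -> regB L} := @ideal_val f.
Lemma valI_rlin : rlin (X := IB) (Y := regB L) valI. Proof. exact: iRE. Qed.
Lemma valI_llin : llin (X := IB) (Y := regB L) valI. Proof. by move=> a x; apply: iLE. Qed.

Definition projB : bimod L := pullB projM proj1.
Definition projL : lmod L := pullL projM proj1.
Definition regP : {linear regB L -> projB} := proj.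
Lemma regP_rlin : rlin (X := regB L) (Y := projB) regP.
Proof. by move=> x a; apply: projM. Qed.
Lemma regP_llin : llin (X := regB L) (Y := projB) regP.
Proof. by move=> x a; apply: projM. Qed.

(** The long exact sequence of B(I, L, B) -> B(L, L, B) -> B(B, L, B). Degree 1 of the quotient uses
    degree 0 of the first complex, which is why [IR_exact] includes that degree. *)
Lemma proj_exact n : exact_at (fun n => @dB k L bL projL bB projB n) n.+1.
Proof.
have eC (a : kvs L) (y : projL) : lact projL (ival e * a : kvs L) y = 0.
  rewrite -[LHS]/(proj (ival e * a) * y); suff -> : proj (ival e * a) = 0 by rewrite mul0r.
  by apply: corner_val_inj; rewrite /proj corner_cutE mulrA fe0 !mul0r raddf0.
pose i m : {linear _ -> _} := @Bmn k L bL projL bB IB (regB L) valI m.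
pose p m : {linear _ -> _} := @Bmn k L bL projL bB (regB L) projB regP m.
apply: (@exact_quo (fun n => @Bn k L bL projL bB IB n) (fun n => @Bn k L bL projL bB (regB L) n)
  (fun n => @Bn k L bL projL bB projB n)
  (fun n => @dB k L bL projL bB IB n) (fun n => @dB k L bL projL bB (regB L) n)
  (fun n => @dB k L bL projL bB projB n) i p).
- by move=> m x; apply/esym/dB_Bmn/valI_rlin.
- by move=> m x; apply/esym/dB_Bmn/regP_rlin.
- by move=> m x; apply: Bmn_inj => z z0; apply: ideal_inj; apply: z0.
- move=> m x; rewrite /i /p /= Bmn_comp Bmn0 // => z.
  by apply: corner_val_inj; rewrite raddf0; apply: idealP.
- by move=> m x; apply: Bmn_exact => z; apply: ideal_val_onto_ker.
- by move=> m x; apply: Bmn_surj; apply: proj_surj.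
- by move=> m x; apply: dB_dB.
- exact: reg_exact.
exact: IR_exact.
Qed.

Lemma HH_quotient n : HH_vanishes B n <-> exact_at (hoch bL projB) n.
Proof. by apply: (@HH_hoch k L B bL bB proj) => [|m]; [exact: proj_surj|exact: proj_exact]. Qed.

(** The inclusion of fLf, which sends the unit to f, and the morphism [proj] induce maps of
    Hochschild complexes whose composite on fLf is the identity. *)
Lemma HH_retract n : HH_vanishes L n -> HH_vanishes B n.
Proof.
rewrite (HH_regular bL) (HH_regular bB).
pose i : {linear kvs B -> kvs L} := @corner_val f.
have iM : {morph i : x y / x * y} by [].
have ip : cancel i proj by apply: corner_cutK.
apply: (@exact_retract (fun n => Tn bB n (regB B)) (fun n => Tn bL n (regB L)) _ _
  (fun m => @Tchange k B L bB bL (regB B) (regB L) i i m)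
  (fun m => @Tchange k L B bL bB (regB L) (regB B) proj proj m)).
- move=> m x dx.
  by rewrite (@hoch_Tchange k B L bB bL (regB B) (regB L) i i) // dx raddf0.
- move=> m y; exists (@Tchange k L B bL bB (regB L) (regB B) proj proj m.+1 y).
  rewrite (@hoch_Tchange k L B bL bB (regB L) (regB B) proj proj) //.
  + exact: projM.
  + by move=> x a; apply: projM.
  by move=> x a; apply: projM.
by move=> m x; apply: TchangeK.
Qed.

(** H_(n+1)(L, I) sits between H_(n+2)(L, B) and H_(n+1)(L, L). *)
Lemma ideal_exact n : exact_at (hoch bL (regB L)) n.+1 -> exact_at (hoch bL projB) n.+2 ->
  exact_at (hoch bL IB) n.+1.
Proof.
pose i m : {linear _ -> _} := @Tmn k L bL IB (regB L) valI m.
pose p m : {linear _ -> _} := @Tmn k L bL (regB L) projB regP m.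
apply: (@exact_sub (fun n => Tn bL n IB) (fun n => Tn bL n (regB L)) (fun n => Tn bL n projB)
  (hoch bL IB) (hoch bL (regB L)) (hoch bL projB) i p).
- by move=> m x; apply: esym; apply: hoch_Tmn; [exact: valI_rlin|exact: valI_llin].
- by move=> m x; apply: esym; apply: hoch_Tmn; [exact: regP_rlin|exact: regP_llin].
- by move=> m x; apply: (@Tmn_inj _ _ _ _ _ valI) => z z0; apply: ideal_inj; apply: z0.
- move=> m x; rewrite /i /p /= Tmn_comp (@Tmn0 _ _ _ _ _ (regP \o valI)) // => z.
  by apply: corner_val_inj; rewrite raddf0; apply: idealP.
- by move=> m x; apply: (@Tmn_exact _ _ _ _ _ _ valI regP) => z; apply: ideal_val_onto_ker.
- by move=> m x; apply: (@Tmn_surj _ _ _ _ _ regP); apply: proj_surj.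
by move=> m x; apply: hoch_hoch.
Qed.

(** * Hochschild homology of L with coefficients in Le (x) A^q (x) eL *)

Section CornerColumns.
Variable q : nat.

(* x |-> c_j(x) e on Le, c_j being the j-th coordinate of L *)
Definition coordE (j : 'I_(bdim bL)) : {linear X -> X} :=
  bil_flip (@Bil k k^o X X (fun c x => c *: x)
     (fun x c a b => etrans (scalerDl _ _ _) (congr1 (+%R^~ _) (esym (scalerA _ _ _))))
     (fun c => linearP (c \*: idfun))) eX \o bco bL j \o vX.
Lemma coordEE j x : coordE j x = bco bL j (vX x) *: eX. Proof. by []. Qed.

Definition sgm j : {linear ZB q -> ZB q} := @Bmn k A bA Y bY X X (coordE j) q.
Lemma sgm_bc j w y : sgm j (bc q w y) = bc q (Tmn bA (coordE j) q w) y.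
Proof. exact: Bmn_bc. Qed.

Lemma sgm_rlin j : rlin (sgm j).
Proof.
move=> t a; pose R : {linear Z q -> Z q} := bil_flip (zR q) a.
apply: (@Bn_ext _ _ _ _ _ _ _ _ (sgm j \o R) (R \o sgm j)) => w y.
by rewrite -[LHS]/(sgm j (zR q _ a)) -[RHS]/(zR q (sgm j _) a) zR_bc !sgm_bc zR_bc.
Qed.

Lemma sgm_sum t : \sum_j zL q (bL j) (sgm j t) = t.
Proof.
have F_lin : linear (fun t : Z q => \sum_j zL q (bL j) (sgm j t)).
  move=> c x y; rewrite scaler_sumr -big_split /=; apply: eq_bigr => j _.
  by rewrite linearP bilDr bilZr.
pose F : {linear Z q -> Z q} := HB.pack (fun t : Z q => \sum_j zL q (bL j) (sgm j t))
  (GRing.isLinear.Build _ _ _ _ _ F_lin).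
apply: (@Bn_ext _ _ _ _ _ _ _ _ F idfun) => w y.
rewrite -[LHS]/(\sum_j zL q (bL j) (sgm j _)).
under eq_bigr do rewrite sgm_bc zL_bc zLXE Tmn_comp.
rewrite -bil_suml; congr (bc q _ _).
transitivity (Tmn bA (idfun : X -> X) q w); last exact: Tmn_id.
rewrite (@Tmn_lin _ _ _ _ _ _ (fun=> 1) (fun j => LX (bL j) \o coordE j)) => [|x].
  by under [RHS]eq_bigr do rewrite scale1r.
under eq_bigr => j _ do
  rewrite scale1r -[_ x]/(LX (bL j) (coordE j x)) coordEE bilZr -bilZl.
rewrite -bil_suml bco_sum; apply: vX_inj.
by rewrite LXE cutXE idemP vX_mulr.
Qed.

Lemma sgm_lact j a t : sgm j (zL q a t) = \sum_i bco bL j (a * bL i) *: sgm i t.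
Proof.
have F_lin : linear (fun t : Z q => \sum_i bco bL j (a * bL i) *: sgm i t).
  move=> c x y; rewrite scaler_sumr -big_split /=; apply: eq_bigr => i _.
  by rewrite linearP scalerDr !scalerA mulrC.
pose F : {linear Z q -> Z q} := HB.pack (fun t : Z q => \sum_i bco bL j (a * bL i) *: sgm i t)
  (GRing.isLinear.Build _ _ _ _ _ F_lin).
apply: (@Bn_ext _ _ _ _ _ _ _ _ (sgm j \o zL q a) F) => w y.
rewrite -[LHS]/(sgm j (zL q a _)) -[RHS]/(\sum_i bco bL j (a * bL i) *: sgm i _).
rewrite zL_bc sgm_bc zLXE Tmn_comp.
under eq_bigr do rewrite sgm_bc -bilZl.
rewrite -bil_suml; congr (bc q _ _); apply: Tmn_lin => x.
rewrite -[LHS]/(coordE j (LX a x)) coordEE LXE; under eq_bigr do rewrite coordEE scalerA.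
rewrite -scaler_suml; congr (_ *: _).
rewrite -[in LHS](bco_sum bL (vX x)) -[a * _]/(kmul L a _) bil_sumr linear_sum.
by apply: eq_bigr => i _; rewrite bilZr linearZ_LR mulrC.
Qed.

(** The maps [sgm] are the components of the bimodule section x (x) u (x) y |-> x (x) (e (x) u (x)
    y) from Z_q to L (x) Z_q. *)
Lemma Zcol_exact n : exact_at (hoch bL (ZB q)) n.+1.
Proof. by apply: hoch_lproj_exact; [exact: sgm_rlin|exact: sgm_sum|exact: sgm_lact]. Qed.

(* x (x) u (x) y |-> yx (x) u *)
Definition YXA : bil Y X (regB A) := YX.
Lemma YXA_rlin y : rlin (X := X) (Y := regB A) (YXA y).
Proof.
move=> x a; apply: (@corner_val_inj e).
rewrite -[RHS]/(corner_val (YX y x) * corner_val a) -[LHS]/(corner_val (YX y (ract X x a))).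
by rewrite !YXE vX_ract mulrA.
Qed.

Definition wrapA : {linear Z q -> Tn bA q (regB A)} :=
  tlift (bswap (@bTn k A bA X (regB A) Y YXA q)).
Lemma wrapA_bc w y : wrapA (bc q w y) = Tmn bA (YXA y) q w.
Proof. exact: tlift_tp. Qed.

Lemma wrapA_hoch t : wrapA (hoch bL (ZB q) 0 t) = 0.
Proof.
apply: (@Tn_ext _ _ _ _ _ _ (wrapA \o hoch bL (ZB q) 0) \0) => z a.
rewrite -[LHS]/(wrapA (hoch bL (ZB q) 0 _)) hoch0_tc raddfB; apply/eqP; rewrite subr_eq0; apply/eqP.
pose F : {linear Z q -> Tn bA q (regB A)} := wrapA \o bil_flip (zR q) a.
apply: (@Bn_ext _ _ _ _ _ _ _ _ F (wrapA \o zL q a)) => w y.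
rewrite -[LHS]/(wrapA (zR q _ a)) -[RHS]/(wrapA (zL q a _)) zR_bc zL_bc !wrapA_bc zLXE Tmn_comp.
apply: Tmn_eq => x; apply: (@corner_val_inj e).
by rewrite -[LHS]/(corner_val (YX _ x)) -[RHS]/(corner_val (YX y (LX a x))) !YXE YLE LXE mulrA.
Qed.

Definition coordA (i : 'I_(bdim bY)) : {linear regB A -> X} :=
  bil_flip (@Bil k k^o X X (fun c x => c *: x)
     (fun x c a b => etrans (scalerDl _ _ _) (congr1 (+%R^~ _) (esym (scalerA _ _ _))))
     (fun c => linearP (c \*: idfun))) eX \o bco bY i \o cutY \o @corner_val e.
Lemma coordAE i (a : kvs A) : coordA i a = bco bY i (cutY (corner_val a)) *: eX.
Proof. by []. Qed.

(* a (x) u |-> e (x) u (x) a *)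
Definition unwrapA (t : Tn bA q (regB A)) : Z q :=
  \sum_i bc q (Tmn bA (coordA i) q t) (bY i).

Lemma unwrapAK t : wrapA (unwrapA t) = t.
Proof.
rewrite /unwrapA (linear_sum wrapA).
under eq_bigr do rewrite wrapA_bc Tmn_comp.
transitivity (Tmn bA (idfun : regB A -> regB A) q t); last exact: Tmn_id.
rewrite (@Tmn_lin _ _ _ _ _ _ (fun=> 1) (fun i => YXA (bY i) \o coordA i)) => [|a].
  by under [RHS]eq_bigr do rewrite scale1r.
under eq_bigr => i _ do
  rewrite scale1r -[_ a]/(YXA (bY i) (coordA i a)) coordAE bilZr -bilZl.
rewrite -bil_suml bco_sum; apply: (@corner_val_inj e).
rewrite -[RHS]/(corner_val (YX _ _)) YXE cutYE cutXE corner_mull.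
by rewrite idemP corner_mulr.
Qed.

(** Both sides send x (x) u (x) y to e (x) u (x) yx; on the right, x is expanded in the basis of
    L. *)
Lemma unwrapA_wrapA t : unwrapA (wrapA t) = \sum_j zR q (sgm j t) (bL j).
Proof.
have U_lin : linear unwrapA.
  move=> c x y; rewrite /unwrapA scaler_sumr -big_split /=; apply: eq_bigr => j _.
  by rewrite (linearP (Tmn bA (coordA j) q)) bilDl bilZl.
pose U : {linear Tn bA q (regB A) -> Z q} := HB.pack unwrapA (GRing.isLinear.Build _ _ _ _ _ U_lin).
have F_lin : linear (fun t : Z q => \sum_j zR q (sgm j t) (bL j)).
  move=> c x y; rewrite scaler_sumr -big_split /=; apply: eq_bigr => j _.
  by rewrite linearP bilDl bilZl.
pose F : {linear Z q -> Z q} := HB.pack (fun t : Z q => \sum_j zR q (sgm j t) (bL j))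
  (GRing.isLinear.Build _ _ _ _ _ F_lin).
apply: (@Bn_ext _ _ _ _ _ _ _ _ (U \o wrapA) F) => w y.
rewrite -[LHS]/(unwrapA (wrapA _)) -[RHS]/(\sum_j zR q (sgm j _) (bL j)) wrapA_bc /unwrapA.
under [RHS]eq_bigr do rewrite sgm_bc zR_bc -[YL y _](bco_sum bY) bil_sumr.
rewrite exchange_big /=; apply: eq_bigr => i _.
under [RHS]eq_bigr do rewrite bilZr -bilZl.
rewrite -bil_suml Tmn_comp; congr (bc q _ _); apply: Tmn_lin => x.
rewrite -[LHS]/(coordA i (YXA y x)) coordAE; under eq_bigr do rewrite coordEE scalerA.
rewrite -scaler_suml; congr (_ *: _).
have -> : cutY (corner_val (YXA y x)) = YL y (vX x).
  apply: vY_inj; rewrite YLE cutYE -[corner_val _]/(corner_val (YX y x)) YXE.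
  by rewrite mulrA vY_mull.
rewrite -[in LHS](bco_sum bL (vX x)) bil_sumr linear_sum.
by apply: eq_bigr => j _; rewrite bilZr linearZ_LR mulrC.
Qed.

(** By [hoch_hl0] the difference of t and sum_j sgm_j(t) b_j is a Hochschild boundary, and this sum
    is [unwrapA (wrapA t)]. So [wrapA] identifies H_0(L, Z_q) with A (x) A^q. *)
Lemma wrapA_ker t : wrapA t = 0 -> exists u, hoch bL (ZB q) 0 u = t.
Proof.
move=> t0; exists (- @left_homotopy k L bL (ZB q) sgm 0 t).
rewrite raddfN /= (hoch_hl0 sgm_sum) -[\sum_j _]/(\sum_j zR q (sgm j t) (bL j)).
rewrite -unwrapA_wrapA t0 opprB; suff -> : unwrapA 0 = 0 by rewrite subr0.
by rewrite /unwrapA big1 // => i _; rewrite raddf0 bil0l.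
Qed.
End CornerColumns.

Lemma wrapA_dZ q t : wrapA q (dZ q t) = - hoch bA (regB A) q (wrapA q.+1 t).
Proof.
apply: (@Bn_ext _ _ _ _ _ _ _ _ (wrapA q \o dZ q) (\- (hoch bA (regB A) q \o wrapA q.+1))) => w y.
rewrite -[LHS]/(wrapA q (dZ q _)) -[RHS]/(- hoch bA (regB A) q (wrapA q.+1 _)).
rewrite dB_bc (linearB (wrapA q)) !wrapA_bc.
rewrite /hoch opprB D_Tmn; last exact: YXA_rlin.
congr (_ - _).
pose F : {linear TA q.+1 -> Tn bA q (regB A)} := wrapA q \o bil_flip (zstar q) y.
pose G : {linear TA q.+1 -> Tn bA q (regB A)} := @twist _ _ bA (regB A) q \o Tmn bA (YXA y) q.+1.
apply: (@Tn_ext _ _ _ _ _ _ F G) => v a.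
rewrite -[LHS]/(wrapA q (zstar q _ y)) -[RHS]/(twist (Tmn bA (YXA y) q.+1 _)).
rewrite bstar_tc wrapA_bc Tmn_tc tw_tc Tmn_comp; apply: Tmn_eq => x.
apply: (@corner_val_inj e).
rewrite -[LHS]/(corner_val (YX _ x)) -[RHS]/(corner_val a * corner_val (YX y x)).
by rewrite !YXE vY_lact mulrA.
Qed.

(** The bicomplex Z_j (x) L^i: for fixed i it resolves I (x) L^i, since [mu] and [dZ] resolve I; for
    fixed j it resolves A (x) A^j through [wrapA]. *)
Lemma corner_exact n : exact_at (hoch bL IB) n.+1 -> exact_at (hoch bA (regB A)) n.+1.
Proof.
move=> exI.
(* [wrapA] carries [dZ] to minus the Hochschild differential, so the bicomplex is compared with the
   negated complex, which has the same cycles and boundaries. *)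
suff : exact_at (fun m => \- hoch bA (regB A) m) n.+1.
  move=> ex x dx; have [|y yx] := ex x; first by rewrite /= dx oppr0.
  by exists (- y); rewrite raddfN.
pose dh i j : {linear _ -> _} := @Tmn k L bL (ZB j.+1) (ZB j) (dZ j) i.
pose rho i : {linear _ -> _} := @Tmn k L bL (ZB 0) IB mu i.
apply: (@bicomplex_exact (fun i j => Tn bL i (ZB j)) (fun i => Tn bL i IB)
  (fun j => Tn bA j (regB A)) (fun i j => hoch bL (ZB j) i) dh rho (fun j => wrapA j)
  (fun i => hoch bL IB i) (fun j => \- hoch bA (regB A) j)); last exact: exI.
- by move=> i j x; apply: hoch_Tmn; [exact: dZ_rlin|exact: dZ_llin].
- by move=> i j x; apply: hoch_hoch.
- move=> i j x; rewrite /dh /= Tmn_comp (@Tmn0 k L bL (ZB j.+2) (ZB j) (dZ j \o dZ j.+1)) // => z.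
  exact: dB_dB.
- by move=> i x; apply: esym; apply: hoch_Tmn; [exact: mu_rlin|exact: mu_llin].
- move=> i x; rewrite /rho /dh /= Tmn_comp (@Tmn0 k L bL (ZB 1) IB (mu \o dZ 0)) // => z.
  exact: mu_dZ.
- move=> i r; apply: (@Tmn_surj k L bL (ZB 0) IB mu) => z; exists (sectI z); exact: mu_sectI.
- by move=> i x; apply: (@Tmn_exact k L bL (ZB 1) (ZB 0) IB (dZ 0) mu) => z; apply: mu_ker.
- by move=> i j x; apply: (@Tmn_exact k L bL (ZB j.+2) (ZB j.+1) (ZB j) (dZ j.+1) (dZ j)) => z; apply: exZ.
- by move=> j x; apply: wrapA_dZ.
- by move=> j x; apply: wrapA_hoch.
- by move=> j s; exists (unwrapA s); apply: unwrapAK.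
- by move=> j x; apply: wrapA_ker.
by move=> i j x; apply: Zcol_exact.
Qed.

End Stratified.

(** * Consequences of fLe (x)_A eLf = 0, and the theorem *)

(** A universal property for maps balanced only modulo a subgroup [H]; it avoids forming the
    quotient by [H]. It is used with [H] zero and with [H] the group of boundaries. *)
Lemma tensor_lift_mod (S : Type) (M N Z : zmodType) (ract : S -> M -> M) (lact : S -> N -> N)
    (b : M -> N -> Z) (H : Z -> Prop) :
  H 0 -> (forall x y, H x -> H y -> H (x - y)) ->
  (forall n, zmod_morphism (b^~ n)) -> (forall m, zmod_morphism (b m)) ->
  (forall s m n, H (b (ract s m) n - b m (lact s n))) ->
  forall m n, pure ract lact m n = 0 -> H (b m n).
Proof.
move=> H0 HB bBl bBr bS m n.
have fU m' n' : free_lift b << (m', n') >> = b m' n' by rewrite /free_lift liftU scale1r.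
have fB := @free_liftB M N Z b.
have rel_H x : tensor_rel ract lact x -> H (free_lift b x).
  elim=> [|u v _ fu _ fv|p p' q|p q q'|s p q].
  - by have := fB 0 0; rewrite !subrr => ->.
  - by rewrite fB; apply: HB.
  - by rewrite fB (zmod_morphD fB) !fU (zmod_morphD (bBl q)) subrr.
  - by rewrite fB (zmod_morphD fB) !fU (zmod_morphD (bBr p)) subrr.
  - by rewrite fB !fU; apply: bS.
move=> mn0; rewrite -fU; apply: rel_H; rewrite -[<< _ >>]subr0.
by apply/tensor_pi_eq; rewrite raddf0.
Qed.

Section Assembly.
Variables (k : fieldType) (L : kAlgType k) (e : idem_elt L).
Local Notation f := (idemC e).

Lemma idemC_sum : ival e + ival f = 1.
Proof. by rewrite /= addrC subrK. Qed.

Hypothesis NM0 : forall t : tensor_mod (R := corner e) (peirce_right f e) (peirce_left e f), t = 0.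

Lemma NM_mul0 (x y : L) : ival f * x * ival e * y * ival f = 0.
Proof.
pose m (u : peirce_right f e) (v : peirce_left e f) : L := val u * val v.
have mBl v : zmod_morphism (m^~ v) by move=> u u'; rewrite /m raddfB /= mulrBl.
have mBr u : zmod_morphism (m u) by move=> v v'; rewrite /m raddfB /= mulrBr.
have := tensor_lift_mod (H := fun z => z = 0) (b := m) erefl _ mBl mBr _
  (NM0 (tens (peirce_cut f e x : peirce_right f e) (peirce_cut e f y : peirce_left e f))).
rewrite /m /= -!mulrA (mulrA (ival e) (ival e)) idemP; apply.
  by move=> a b -> ->; rewrite subrr.
by move=> s u v; rewrite /m /= mulrA subrr.
Qed.

(** The map (u, v) |-> u (x) v from fLe and eLf to Le (x) eL is balanced over eLe up to boundaries,
    so a tensor that vanishes over eLe is sent to a boundary. *)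
Lemma NM_boundary (bA : kbasis (kvs (corner e : kAlgType k)))
    (bY : kbasis (lmod_of (S := corner e : kAlgType k) (peirce_left e idem1))) (x y : kvs L) :
  exists u, @dB _ _ bA _ bY (rmod_of (peirce_right idem1 e)) 0 u =
    bc bA bY _ 0 (cutX e (ival f * x)) (cutY e (y * ival f)).
Proof.
pose b (u : peirce_right f e) (v : peirce_left e f) :=
  bc bA bY (rmod_of (peirce_right idem1 e)) 0
    (cutX e (val u : kvs L)) (cutY e (val v : kvs L)).
pose H z := exists u, @dB _ _ bA _ bY (rmod_of (peirce_right idem1 e)) 0 u = z.
have bBl v : zmod_morphism (b^~ v).
  by move=> u u'; rewrite /b (raddfB val) (raddfB (cutX e)) bilBl.
have bBr u : zmod_morphism (b u).
  by move=> v v'; rewrite /b (raddfB val) (raddfB (cutY e)) bilBr.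
have := tensor_lift_mod (H := H) (b := b) _ _ bBl bBr _
  (NM0 (tens (peirce_cut f e x : peirce_right f e) (peirce_cut e f y : peirce_left e f))).
rewrite /b /=.
have -> : cutX e (ival f * x * ival e : kvs L) = cutX e (ival f * x).
  by apply: vX_inj; rewrite !cutXE -!mulrA idemP.
have -> : cutY e (ival e * y * ival f : kvs L) = cutY e (y * ival f).
  by apply: vY_inj; rewrite !cutYE !mulrA idemP.
apply.
- by exists 0; rewrite raddf0.
- by move=> z z' [u <-] [u' <-]; exists (u - u'); rewrite raddfB.
move=> s u v.
(* The boundary of u (x) s (x) v is u (x) sv - us (x) v, hence the sign. *)
exists (- bc bA bY (rmod_of (peirce_right idem1 e)) 1
  (tc bA (cutX e (val u : kvs L) : Tn bA 0 (rmod_of (peirce_right idem1 e))) s)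
  (cutY e (val v : kvs L))).
rewrite raddfN /= dZ0_bc opprB.
have -> : ract (rmod_of (peirce_right idem1 e)) (cutX e (val u : kvs L)) s =
    cutX e (val u * val s : L).
  apply: vX_inj; rewrite vX_ract !cutXE -[corner_val s]/(val s).
  by rewrite -!mulrA (peirce_mulr s) (peirce_mull s).
have -> : lact (lmod_of (peirce_left e idem1)) s (cutY e (val v : kvs L)) =
    cutY e (val s * val v : L).
  apply: vY_inj; rewrite vY_lact !cutYE -[corner_val s]/(val s).
  by rewrite !mulrA (peirce_mull s) (peirce_mulr s).
by [].
Qed.
End Assembly.

Theorem theorem4p6 (k : fieldType) (L : kAlgType k) (e : idem_elt L) :
  finite_dimensional L ->
  strongly_stratifying e ->
  HH_finite L ->
  HH_finite (corner e : kAlgType k) /\ HH_finite (corner (idemC e) : kAlgType k).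
Proof.
move=> [n [b bP]] [TorA NM0 _] [N HHL].
have spL : spanned (kvs L) by exists n, b.
have cut_onto (g : idem_elt L) (v : kvs (corner g : kAlgType k)) : exists u : kvs L, corner_cut g u = v.
  by exists (corner_val v); apply: corner_cutK.
have [bL] := spanned_basis spL.
have [bA] := spanned_basis (spanned_onto (cut_onto e) spL).
have [bB] := spanned_basis (spanned_onto (cut_onto (idemC e)) spL).
have spX : spanned (rmod_of (S := corner e : kAlgType k) (peirce_right idem1 e)).
  apply: (spanned_onto (f := cutX e)) spL => v.
  by exists (vX v); apply: vX_inj; rewrite cutXE vX_mulr.
have [bY] : inhabited (kbasis (lmod_of (S := corner e : kAlgType k) (peirce_left e idem1))).
  apply: spanned_basis; apply: (spanned_onto (f := cutY e)) spL => v.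
  by exists (vY v); apply: vY_inj; rewrite cutYE vY_mull.
have ef := idemC_sum e; have NM_mul := NM_mul0 NM0.
have NM_bound := NM_boundary NM0 bA bY.
have exZ q := Tor_vanishes_exact bA spX bY (TorA q.+1 isT).
have HHB m : (N < m)%N -> HH_vanishes (corner (idemC e) : kAlgType k) m.
  by move=> /HHL; apply: (HH_retract bL bB ef NM_mul).
split; exists N => // m Nm; case: m Nm => // m Nm.
(* For N < m + 1 both HH_(m+1)(L) and HH_(m+2)(B) vanish, hence H_(m+1)(L, I) and then HH_(m+1)(A);
   the bound N is not raised. *)
apply/(HH_regular bA)/(corner_exact NM_bound exZ)/(ideal_exact (ef := ef) (NM0 := NM_mul)).
  exact/(HH_regular bL)/HHL.
exact/(HH_quotient bL bB ef NM_mul NM_bound exZ)/HHB/ltnW.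
Qed.
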